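(* Let $\mathcal{S}$ and $\mathcal{T}$ be operator systems. If $\mathcal{S}$ and $\mathcal{T}$ are $\Delta$-equivalent then the lattices $\mathrm{Ker}_{\mathcal{A}_{\mathcal{S}}}(\mathcal{S})$ and $\mathrm{Ker}_{\mathcal{A}_{\mathcal{T}}}(\mathcal{T})$ are isomorphic.
   Context: An operator system is a (not necessarily closed) selfadjoint subspace of some $\mathcal{B}(H)$ containing $I_H$. $[\,\cdot\,]$ is norm-closed linear span. A TRO is a linear subspace $\mathcal{M}\subseteq\mathcal{B}(H,K)$ with $\mathcal{M}\mathcal{M}^*\mathcal{M}\subseteq\mathcal{M}$; it is non-degenerate if $I_H\in[\mathcal{M}^*\mathcal{M}]$ and $I_K\in[\mathcal{M}\mathcal{M}^*]$. Concrete operator systems $\mathcal{S}\subseteq\mathcal{B}(H)$, $\mathcal{T}\subseteq\mathcal{B}(K)$ are TRO-equivalent if there is a non-degenerate TRO $\mathcal{M}\subseteq\mathcal{B}(H,K)$ with $\mathcal{M}^*\mathcal{T}\mathcal{M}\subseteq\overline{\mathcal{S}}$ and $\mathcal{M}\mathcal{S}\mathcal{M}^*\subseteq\overline{\mathcal{T}}$ (norm closures). Operator systems are $\Delta$-equivalent if they have unital complete order embeddings with TRO-equivalent images. $\mathcal{I}(\mathcal{S})$ is the injective envelope of $\mathcal{S}$ with its C*-algebra structure, $\mathcal{S}\subseteq\mathcal{I}(\mathcal{S})$, and the multiplier C*-algebra of $\mathcal{S}$ is $\mathcal{A}_{\mathcal{S}}=\{a\in\mathcal{I}(\mathcal{S}):a\mathcal{S}\subseteq\mathcal{S},\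 a^*\mathcal{S}\subseteq\mathcal{S}\}$, considered as contained in $\mathcal{S}$. A C*-representation of $\mathcal{S}$ is a pair $(H,\phi)$ with $\phi:\mathcal{S}\to\mathcal{B}(H)$ a unital completely positive map whose restriction to $\mathcal{A}_{\mathcal{S}}$ is a *-homomorphism. $\mathrm{Ker}_{\mathcal{A}_{\mathcal{S}}}(\mathcal{S})$ is the set of all subspaces $\mathcal{J}\subseteq\mathcal{S}$ of the form $\mathcal{J}=\ker\phi$ for some C*-representation $(H,\phi)$ of $\mathcal{S}$. It is a lattice under $\mathcal{J}_1\wedge\mathcal{J}_2=\mathcal{J}_1\cap\mathcal{J}_2$ and $\mathcal{J}_1\vee\mathcal{J}_2=$ the smallest element of $\mathrm{Ker}_{\mathcal{A}_{\mathcal{S}}}(\mathcal{S})$ containing $\mathcal{J}_1+\mathcal{J}_2$.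
   Formalization: For operator systems that are not norm closed, the kernel lattices and injective envelopes are those of the norm closures of S and T; the claim read literally fails there (piecewise linear functions in C[0,1] versus C[0,1]). *)

(* Defs.v *)
From HB Require Import structures.
From mathcomp Require Import all_boot all_order all_algebra complex.
From mathcomp Require Import all_classical all_reals topology normedtype.
Set Implicit Arguments.
Unset Strict Implicit.
Unset Printing Implicit Defensive.
Import Order.TTheory GRing.Theory Num.Theory numFieldNormedType.Exports.
Local Open Scope classical_set_scope.
Local Open Scope ring_scope.
Local Open Scope complex_scope.

(* The form is linear in the first variable and conjugate-linear in the second.
   The zero space is a Hilbert space. *)
HB.mixin Record CompleteNormedModule_isHilbert (R : realType) H
    of CompleteNormedModule R[i] H := {
  dotH : {dot H for (@Num.conj R[i])};
  dotH_norm : forall x : H, dotH x x = `|x| ^+ 2 }.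

#[short(type="hilbertType")]
HB.structure Definition Hilbert (R : realType) :=
  {H of CompleteNormedModule_isHilbert R H & CompleteNormedModule R[i] H}.

Section Operators.
Context {R : realType}.
Implicit Types H K L : hilbertType R.

(* Operators are plain functions, with the pointwise linear structure. *)
Definition bounded_op {H K} : set (H -> K) :=
  [set f | linear f /\ continuous f].

Definition is_adjoint {H K} (f : H -> K) (g : K -> H) : Prop :=
  forall x y, dotH (f x) y = dotH x (g y).

(* Meaningful for bounded f, for which the adjoint exists and is unique. *)
Definition adj {H K} (f : H -> K) : K -> H :=
  xget (0 : K -> H) [set g | is_adjoint f g].

Definition lin_subspace {H K} (A : set (H -> K)) : Prop :=
  A 0 /\ forall (a : R[i]) f g, A f -> A g -> A (a *: f + g).

(* Closure for the operator norm: ||f - g|| <= e is spelled out pointwise. *)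
Definition op_closure {H K} (A : set (H -> K)) : set (H -> K) :=
  [set f | bounded_op f /\
     forall e : R[i], 0 < e ->
       exists2 g, A g & forall x, `|f x - g x| <= e * `|x| ].

Definition op_span {H K} (A : set (H -> K)) : set (H -> K) :=
  [set f | exists n (c : 'I_n -> R[i]) (g : 'I_n -> H -> K),
     (forall i, A (g i)) /\ f = \sum_(i < n) c i *: g i].

Definition operator_system {H} (S : set (H -> H)) : Prop :=
  [/\ S `<=` bounded_op, lin_subspace S,
      forall f, S f -> S (adj f) & S idfun].

Definition mx_over {H n} (S : set (H -> H)) (A : 'M[H -> H]_n) : Prop :=
  forall i j, S (A i j).

(* Positivity of A as an operator on the n-fold direct sum of H:
   0 <= <A x, x>, which in R[i] says that <A x, x> is real and nonnegative. *)
Definition mx_positive {H n} (A : 'M[H -> H]_n) : Prop :=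
  forall x : 'I_n -> H,
    0 <= \sum_(i < n) \sum_(j < n) dotH (A i j (x j)) (x i).

(* A map defined on S is a function on all of H -> H, of which only the values
   on S matter. *)
Definition linear_on {H K} (S : set (H -> H)) (phi : (H -> H) -> (K -> K)) :=
  forall (a : R[i]) f g, S f -> S g -> phi (a *: f + g) = a *: phi f + phi g.

Definition cp_map {H K} (S : set (H -> H)) (T : set (K -> K))
    (phi : (H -> H) -> (K -> K)) : Prop :=
  [/\ linear_on S phi, forall f, S f -> T (phi f) &
      forall n (A : 'M[H -> H]_n),
        mx_over S A -> mx_positive A -> mx_positive (map_mx phi A)].

Definition ucp_map {H K} (S : set (H -> H)) (T : set (K -> K))
    (phi : (H -> H) -> (K -> K)) : Prop :=
  cp_map S T phi /\ phi idfun = idfun.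

Definition unital_complete_order_embedding {H K} (S : set (H -> H))
    (phi : (H -> H) -> (K -> K)) : Prop :=
  [/\ ucp_map S bounded_op phi,
      forall f g, S f -> S g -> phi f = phi g -> f = g &
      forall n (A : 'M[H -> H]_n),
        mx_over S A -> mx_positive (map_mx phi A) -> mx_positive A].

Definition TRO {H K} (M : set (H -> K)) : Prop :=
  [/\ M `<=` bounded_op, lin_subspace M &
      forall m1 m2 m3, M m1 -> M m2 -> M m3 -> M (m1 \o adj m2 \o m3)].

Definition nondegenerate_TRO {H K} (M : set (H -> K)) : Prop :=
  [/\ TRO M,
      op_closure (op_span [set adj m1 \o m2 | m1 in M & m2 in M]) idfun &
      op_closure (op_span [set m1 \o adj m2 | m1 in M & m2 in M]) idfun].

Definition TRO_equivalent {H K} (S : set (H -> H)) (T : set (K -> K)) : Prop :=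
  exists M : set (H -> K),
    [/\ nondegenerate_TRO M,
        forall m1 t m2, M m1 -> T t -> M m2 ->
          op_closure S (adj m1 \o t \o m2) &
        forall m1 s m2, M m1 -> S s -> M m2 ->
          op_closure T (m1 \o s \o adj m2)].

Definition Delta_equivalent {H K} (S : set (H -> H)) (T : set (K -> K)) : Prop :=
  exists (H' K' : hilbertType R) (phi : (H -> H) -> (H' -> H'))
         (psi : (K -> K) -> (K' -> K')),
    [/\ unital_complete_order_embedding S phi,
        unital_complete_order_embedding T psi &
        TRO_equivalent (phi @` S) (psi @` T)].

(* Injectivity in the category of operator systems and completely positive
   maps. *)
Definition injective_operator_system {L} (E : set (L -> L)) : Prop :=
  operator_system E /\
  forall H (U V : set (H -> H)) (phi : (H -> H) -> (L -> L)),
    operator_system U -> operator_system V -> U `<=` V -> cp_map U E phi ->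
    exists2 psi : (H -> H) -> (L -> L),
      cp_map V E psi & forall f, U f -> psi f = phi f.

Definition unital_Cstar_subalgebra {L} (E : set (L -> L)) : Prop :=
  [/\ operator_system E, forall f g, E f -> E g -> E (f \o g) &
      op_closure E `<=` E].

(* (E, kappa) is the injective envelope of S in the sense of Hamana: E is
   injective, and the identity is the only completely positive map of E into
   itself fixing kappa(S).  The envelope, with its Choi-Effros C*-algebra
   structure, is given in a faithful representation on L, so that its product
   and involution are composition and adjoint.  It is unique up to a
   *-isomorphism intertwining the embeddings of S. *)
Definition injective_envelope {H L} (S : set (H -> H)) (E : set (L -> L))
    (kappa : (H -> H) -> (L -> L)) : Prop :=
  [/\ unital_Cstar_subalgebra E, injective_operator_system E,
      unital_complete_order_embedding S kappa, kappa @` S `<=` E &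
      forall theta : (L -> L) -> (L -> L),
        cp_map E E theta -> (forall s, S s -> theta (kappa s) = kappa s) ->
        forall f, E f -> theta f = f].

Definition multiplier_algebra {H L} (S : set (H -> H)) (E : set (L -> L))
    (kappa : (H -> H) -> (L -> L)) : set (L -> L) :=
  [set a | [/\ E a,
      forall s, S s -> (kappa @` S) (a \o kappa s) &
      forall s, S s -> (kappa @` S) (adj a \o kappa s)]].

(* A multiplier a lies in kappa(S), as a = a 1; this is the corresponding
   subset of S. *)
Definition multipliers_in {H L} (S : set (H -> H)) (E : set (L -> L))
    (kappa : (H -> H) -> (L -> L)) : set (H -> H) :=
  [set a | S a /\ multiplier_algebra S E kappa (kappa a)].

(* Products and adjoints of multipliers are those of E, pulled back along
   kappa; they need not be the operations of B(H). *)
Definition Cstar_representation {H L K} (S : set (H -> H)) (E : set (L -> L))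
    (kappa : (H -> H) -> (L -> L)) (phi : (H -> H) -> (K -> K)) : Prop :=
  let A := multipliers_in S E kappa in
  [/\ ucp_map S bounded_op phi,
      forall a b c, A a -> A b -> A c -> kappa c = kappa a \o kappa b ->
        phi c = phi a \o phi b &
      forall a c, A a -> A c -> kappa c = adj (kappa a) ->
        phi c = adj (phi a)].

(* Meant for norm-closed S, which is replaced by op_closure S in general: for
   non-closed S the multipliers need not be complete, and Ker is not invariant
   under Delta-equivalence.  For instance, the piecewise linear functions are
   Delta-equivalent to their closure C[0,1], but have only scalar multipliers,
   and their Ker, unlike that of C[0,1], is not distributive.
   As K may be the zero space, S itself belongs to Ker. *)
Definition Ker {H L} (S : set (H -> H)) (E : set (L -> L))
    (kappa : (H -> H) -> (L -> L)) : set (set (H -> H)) :=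
  [set J | exists (K : hilbertType R) (phi : (H -> H) -> (K -> K)),
     Cstar_representation S E kappa phi /\ J = [set s | S s /\ phi s = 0]].

(* J is the smallest member of the family Lat that contains J1 + J2. *)
Definition is_join {H} (Lat : set (set (H -> H))) (J1 J2 J : set (H -> H)) :=
  [/\ Lat J, [set f + g | f in J1 & g in J2] `<=` J &
      forall J', Lat J' -> [set f + g | f in J1 & g in J2] `<=` J' ->
        J `<=` J'].

Definition lattice_isomorphic {H K} (Lat1 : set (set (H -> H)))
    (Lat2 : set (set (K -> K))) : Prop :=
  exists F : set (H -> H) -> set (K -> K),
    [/\ set_bij Lat1 Lat2 F,
        forall J1 J2, Lat1 J1 -> Lat1 J2 -> F (J1 `&` J2) = F J1 `&` F J2 &
        forall J1 J2 J, Lat1 J1 -> Lat1 J2 ->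
          is_join Lat1 J1 J2 J -> is_join Lat2 (F J1) (F J2) (F J)].

End Operators.

(* Main.v *)
Require Import Defs.
(* Replace S and T by norm-closed concrete systems S <= B(H), T <= B(K) with
   M^* T M <= S and M S M^* <= T, where the TRO M is norm closed; then there are
   finite families in M with sum_i p_i r_i^* = 1_K and sum_j f_j^* g_j = 1_H.
   The isomorphism sends J to {t in T : M^* t M <= J}, with inverse
   J' |-> {s in S : M s M^* <= J'}.

   If J is the kernel of a C*-representation phi of S on K0, then the first set
   is the kernel of the representation of T induced to M (x)_{M^*M} K0.  For
   this representation to be multiplicative on A_T one needs m^* b n in A_S for
   b in A_T and m, n in M, and that its products in I(S) are computed from those
   of b in I(T).  Both follow from one criterion: if a linear map tau of S is the
   off-diagonal part of a completely positive map M_2(S) -> S whose (2,2) part is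
   the identity, then tau is, in I(S), multiplication by tau(1).  Multiplication
   by m^* b n is such a map, since it factors through matrices over T. *)
From HB Require Import structures.
From mathcomp Require Import all_boot all_order all_algebra complex.
From mathcomp Require Import all_classical all_reals topology normedtype.
From mathcomp Require Import ring.
Set Implicit Arguments.
Unset Strict Implicit.
Unset Printing Implicit Defensive.
Import Order.TTheory GRing.Theory Num.Theory numFieldNormedType.Exports.
Local Open Scope classical_set_scope.
Local Open Scope ring_scope.

(** * Hilbert spaces and bounded operators *)

(** No map between I(S) and I(T) is given, and products of multipliers are not those of B(H) and
    B(K). What both sides share is the order on matrices over the two systems, so products are
    recognised through positivity: in a positive 3 by 3 kernel containing the blocks r r^*, r, r^*,
    1, a vanishing Schur complement forces one off-diagonal entry to be r times another
    ([kpos_schur]). This gives both the multiplication criterion in the envelope and the bimodule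
    property of C*-representations. Two properties of the envelope do the work: injectivity extends
    a map on 2 by 2 matrices, and rigidity fixes its corner. The finite families are exact because
    an element of the span of M^* M within 1/2 of the unit is inverted by a Neumann series inside
    the closure of M. They also keep the tensor product M (x)_{M^*M} K0 inside a finite power of K0.
    The two maps between kernels are inverse to each other because kernels are bimodules over M^* M,
    respectively M M^*. *)

Section Inner.
Context {R : realType}.
Local Notation C := (complex R).
Variables (V : lmodType C) (B : V -> V -> C).
Hypotheses (BL : forall a x y z, B (a *: x + y) z = a * B x z + B y z)
  (BC : forall x y, B x y = (B y x)^*) (Bpos : forall x, x != 0 -> 0 < B x x).

Lemma inner_0l z : B 0 z = 0.
Proof. by apply: (@addrI _ (B 0 z)); rewrite -[X in X + _]mul1r -BL scaler0 !addr0. Qed.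
Lemma inner_0r z : B z 0 = 0.
Proof. by rewrite BC inner_0l conjC0. Qed.
Lemma inner_R a x y z : B z (a *: x + y) = a^* * B z x + B z y.
Proof. by rewrite BC BL rmorphD rmorphM /= -!BC. Qed.

Lemma inner_ZZ a x : B (a *: x) (a *: x) = `|a| ^+ 2 * B x x.
Proof. by rewrite -[a *: x]addr0 !(BL, inner_R, inner_0l, inner_0r) ?mulr0 !addr0 mulrA normCK. Qed.

Lemma inner_CS x y : `|B x y| ^+ 2 <= B x x * B y y.
Proof.
have [->|y0] := eqVneq y 0; first by rewrite !inner_0r normr0 expr0n mulr0.
set a := B x y; set d := B y y.
have d0 : 0 < d by exact: Bpos.
have dr : d^* = d by apply/CrealP; rewrite gtr0_real.
(* The vector is [d x - a y]; the trailing [+ 0] gives it the shape [a *: x + y] on which [BL] and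
   [inner_R] rewrite. *)
have : 0 <= B (- a *: y + (d *: x + 0)) (- a *: y + (d *: x + 0)).
  by have [->|/Bpos/ltW//] := eqVneq (- a *: y + (d *: x + 0)) 0; rewrite inner_0l.
rewrite !(BL, inner_R, inner_0l, inner_0r) rmorphN /= dr (BC y x) -/a -/d.
set b := B x x.
rewrite [X in 0 <= X -> _](_ : _ = d * (b * d - a * a^*)); last by ring.
by rewrite pmulr_rge0// subr_ge0 normCK.
Qed.

End Inner.

Section Dot.
Context {R : realType}.
Local Notation C := (complex R).
Implicit Types H K : hilbertType R.

Lemma dotC H (x y : H) : dotH x y = (dotH y x)^*.
Proof. by rewrite hermC expr0 mul1r. Qed.
Lemma dotDl H (x y z : H) : dotH (x + y) z = dotH x z + dotH y z.
Proof. exact: linearDl. Qed.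
Lemma dotDr H (x y z : H) : dotH z (x + y) = dotH z x + dotH z y.
Proof. exact: linearDr. Qed.
Lemma dotZl H a (x y : H) : dotH (a *: x) y = a * dotH x y.
Proof. exact: linearZl_LR. Qed.
Lemma dotZr H a (x y : H) : dotH x (a *: y) = a^* * dotH x y.
Proof. by rewrite linearZr_LR. Qed.
Lemma dotNl H (x y : H) : dotH (- x) y = - dotH x y.
Proof. exact: linearNl. Qed.
Lemma dotNr H (x y : H) : dotH x (- y) = - dotH x y.
Proof. exact: linearNr. Qed.
Lemma dot0l H (x : H) : dotH 0 x = 0.
Proof. exact: linear0l. Qed.
Lemma dot0r H (x : H) : dotH x 0 = 0.
Proof. exact: linear0r. Qed.
Lemma dot_suml H I (r : seq I) P (F : I -> H) y :
  dotH (\sum_(i <- r | P i) F i) y = \sum_(i <- r | P i) dotH (F i) y.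
Proof. by elim/big_rec2: _ => [|i a b _ <-]; rewrite ?dot0l ?dotDl. Qed.
Lemma dot_sumr H I (r : seq I) P (F : I -> H) y :
  dotH y (\sum_(i <- r | P i) F i) = \sum_(i <- r | P i) dotH y (F i).
Proof. by elim/big_rec2: _ => [|i a b _ <-]; rewrite ?dot0r ?dotDr. Qed.

Lemma dot_ge0 H (x : H) : 0 <= dotH x x.
Proof. by rewrite dotH_norm exprn_ge0. Qed.

Lemma dot_inj H (x y : H) : (forall z, dotH x z = dotH y z) -> x = y.
Proof.
move=> xy; apply/eqP; rewrite -subr_eq0 -normr_eq0 -sqrf_eq0 -dotH_norm.
by rewrite dotDl dotNl xy subrr.
Qed.

Lemma dot_injr H (x y : H) : (forall z, dotH z x = dotH z y) -> x = y.
Proof. by move=> xy; apply: dot_inj => z; rewrite dotC xy -dotC. Qed.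

Lemma Cauchy_Schwarz H (x y : H) : `|dotH x y| <= `|x| * `|y|.
Proof.
have h : `|dotH x y| ^+ 2 <= dotH x x * dotH y y.
  apply: inner_CS => [a u v w|u v|u u0]; first by rewrite dotDl dotZl.
    exact: dotC.
  by rewrite dotH_norm exprn_gt0// normr_gt0.
by rewrite -ler_sqr ?nnegrE ?mulr_ge0// exprMn -!dotH_norm.
Qed.

Lemma norm_le_dot H (x : H) (c : C) : 0 <= c -> (forall y, `|dotH x y| <= c * `|y|) -> `|x| <= c.
Proof.
move=> c0 h; have [->|x0] := eqVneq x 0; first by rewrite normr0.
have nx : 0 < `|x| by rewrite normr_gt0.
have := h x; rewrite dotH_norm expr2 ger0_norm ?mulr_ge0//.
by rewrite ler_pM2r.
Qed.

Lemma parallelogram H (x y : H) :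
  `|x + y| ^+ 2 + `|x - y| ^+ 2 = 2 * (`|x| ^+ 2 + `|y| ^+ 2).
Proof. rewrite -!dotH_norm !(dotDl, dotDr, dotNl, dotNr); ring. Qed.

End Dot.

Section Linear.
Context {R : realType}.
Local Notation C := (complex R).
Variables (H K : lmodType C) (f : H -> K) (lf : linear f).
Lemma linD x y : f (x + y) = f x + f y.
Proof. by rewrite -[x in f (x + _)]scale1r lf scale1r. Qed.
Lemma lin0 : f 0 = 0.
Proof. by apply: (@addrI _ (f 0)); rewrite -linD !addr0. Qed.
Lemma linZ a x : f (a *: x) = a *: f x.
Proof. by rewrite -[a *: x in LHS]addr0 lf lin0 addr0. Qed.
Lemma linN x : f (- x) = - f x.
Proof. by rewrite -scaleN1r linZ scaleN1r. Qed.
Lemma linB x y : f (x - y) = f x - f y.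
Proof. by rewrite linD linN. Qed.
Lemma lin_sum I (r : seq I) P (F : I -> H) :
  f (\sum_(i <- r | P i) F i) = \sum_(i <- r | P i) f (F i).
Proof. by elim/big_rec2: _ => [|i a b _ <-]; rewrite ?lin0 ?linD. Qed.
End Linear.

Section Bounded.
Context {R : realType}.
Local Notation C := (complex R).
Implicit Types H K L : hilbertType R.

Lemma bounded_opP H K (f : H -> K) :
  bounded_op f <-> linear f /\ exists2 c : C, 0 <= c & forall x, `|f x| <= c * `|x|.
Proof.
split=> -[lf].
- move=> cf; split=> //.
  have /cvgrPdist_lt /(_ 1 ltr01) := cf 0; rewrite (lin0 lf).
  move=> /nbhs_ballP[e /= e0 he].
  (* Scaled to norm [e / 2], every nonzero vector falls in the ball that [f] maps into the unit
     ball. *)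
  exists (2 / e) => [|x]; first by rewrite divr_ge0// ltW.
  have [->|x0] := eqVneq x 0; first by rewrite (lin0 lf) !normr0 mulr0.
  have nx : 0 < `|x| by rewrite normr_gt0.
  have p : 0 < e / 2 / `|x| by rewrite !divr_gt0.
  have e2 : e / 2 < e by rewrite ltr_pdivrMr// ltr_pMr// ltr1n.
  have h : `|f ((e / 2 / `|x|) *: x)| < 1.
    rewrite -normrN -sub0r; apply: he; rewrite -ball_normE /= sub0r normrN.
    by rewrite normrZ (gtr0_norm p) divfK ?gt_eqF.
  move/ltW: h; rewrite (linZ lf) normrZ (gtr0_norm p) => h.
  have := ler_wpM2l (ltW (_ : 0 < 2 / e * `|x|)) h.
  rewrite !mulr_gt0 ?invr_gt0// => /(_ isT); rewrite mulr1 mulrA.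
  have -> : 2 / e * `|x| * (e / 2 / `|x|) = 1.
    field; rewrite !gt_eqF//.
  by rewrite mul1r.
- case=> c c0 hc; split=> // x; apply/cvgrPdist_lt => e e0.
  have c1 : 0 < c + 1 by rewrite ltr_wpDl.
  apply/nbhs_ballP; exists (e / (c + 1)); first by rewrite /= divr_gt0.
  move=> y; rewrite -ball_normE /= => xy; rewrite -(linB lf).
  apply: le_lt_trans (hc _) _.
  apply: (@le_lt_trans _ _ ((c + 1) * `|x - y|)).
    by rewrite ler_wpM2r// lerDl.
  by rewrite mulrC -ltr_pdivlMr.
Qed.

Lemma bop_lin H K (f : H -> K) : bounded_op f -> linear f.
Proof. by case. Qed.

Lemma bop_bound H K (f : H -> K) : bounded_op f ->
  exists2 c : C, 0 < c & forall x, `|f x| <= c * `|x|.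
Proof.
move=> /bounded_opP[_ [c c0 h]]; exists (c + 1) => [|x]; first by rewrite ltr_wpDl.
by apply: le_trans (h x) _; rewrite ler_wpM2r// lerDl.
Qed.

Lemma bop_id H : bounded_op (@idfun H).
Proof. by apply/bounded_opP; split=> //; exists 1 => // x; rewrite mul1r. Qed.

Lemma bop_comp H K L (f : K -> L) (g : H -> K) :
  bounded_op f -> bounded_op g -> bounded_op (f \o g).
Proof.
move=> bf bg; have [lf lg] := (bop_lin bf, bop_lin bg).
have [c c0 hc] := bop_bound bf; have [d d0 hd] := bop_bound bg.
apply/bounded_opP; split=> [a x y|]; first by rewrite /= lg lf.
exists (c * d) => [|x /=]; first by rewrite mulr_ge0 ?ltW.
by apply: le_trans (hc _) _; rewrite -mulrA ler_pM2l.
Qed.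

Lemma bop_ZD H K a (f g : H -> K) :
  bounded_op f -> bounded_op g -> bounded_op (a *: f + g).
Proof.
move=> bf bg; have [lf lg] := (bop_lin bf, bop_lin bg).
have [c c0 hc] := bop_bound bf; have [d d0 hd] := bop_bound bg.
apply/bounded_opP; split=> [b x y|].
  by rewrite !fctE lg lf !scalerDr !scalerA mulrC addrACA.
exists (`|a| * c + d) => [|x /=]; first by rewrite addr_ge0 ?mulr_ge0// ltW.
rewrite fctE; apply: le_trans (ler_normD _ _) _.
by rewrite mulrDl lerD// normrZ -mulrA ler_wpM2l.
Qed.

Lemma bop_0 H K : bounded_op (0 : H -> K).
Proof.
apply/bounded_opP; split=> [a x y|]; first by rewrite (_ : a *: (0 : H -> K) x + (0 : H ->
  K) y = a *: 0 + 0) ?scaler0 ?addr0.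
by exists 0 => // x; rewrite (_ : (0 : H -> K) x = 0) ?normr0 ?mul0r.
Qed.

Lemma hilbert_complete H (u : nat -> H) :
  (forall e : C, 0 < e -> exists N, forall m n, (N <= m)%N -> (N <= n)%N -> `|u m - u n| <= e) ->
  exists l, forall e : C, 0 < e -> exists N, forall n, (N <= n)%N -> `|u n - l| <= e.
Proof.
move=> cu.
have /cauchy_cvg/cvg_ex[l ul] : cauchy (u @ \oo).
  apply/cauchy_ballP => e e0.
  have [N hN] := cu (e / 2) (divr_gt0 e0 (ltr0Sn _ _)).
  have e2 : e / 2 < e by rewrite ltr_pdivrMr// ltr_pMr// ltr1n.
  exists (u @` [set n | (N <= n)%N], u @` [set n | (N <= n)%N]).
    by split; exists N => // n /= hn; exists n.
  move=> [_ _] [/= [m hm <-] [n hn <-]]; rewrite -ball_normE /=.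
  exact: le_lt_trans (hN _ _ hm hn) e2.
exists l => e e0; have /cvgrPdist_lt/(_ e e0) [N _ hN] := ul.
by exists N => n hn; rewrite distrC ltW//; apply: hN.
Qed.

End Bounded.

Section Scalars.
Context {R : realType}.
Local Notation C := (complex R).

(** The order of complex numbers is partial; the Archimedean property is borrowed from the real
    part, which a positive [e] equals. *)
Lemma inv_nat_small (e : C) : 0 < e -> exists N, forall n, (N <= n)%N -> (n.+1%:R)^-1 <= e.
Proof.
move=> e0; have er : (complex.Re e)%:C%C = e by apply: RRe_real; rewrite gtr0_real.
have r0 : 0 < complex.Re e by rewrite -ltcR er.
exists (Num.bound (complex.Re e)^-1) => n hn.
rewrite invf_ple ?posrE// -er -fmorphV -(rmorph_nat (real_complex R)) lecR.
apply: le_trans (ltW (archi_boundP _)) _; first by rewrite invr_ge0 ltW.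
by rewrite ler_nat (leq_trans hn).
Qed.

(** In a partial order [x] and [y] must first be shown comparable: the case [e = 1] makes [y - x]
    real. *)
Lemma ler_approx (x y : C) : (forall e, 0 < e -> x <= y + e) -> x <= y.
Proof.
move=> h; rewrite -subr_ge0; have r1 := h 1 ltr01.
have xyr : y - x \is Num.real.
  by rewrite -[y - x](addrK 1) rpredB// ger0_real// addrAC subr_ge0.
rewrite real_leNgt ?real0//; apply/negP => xy.
have xy' : 0 < (x - y) / 2 by rewrite divr_gt0// -opprB oppr_gt0.
have := h _ xy'; rewrite -lerBlDl => /le_lt_trans hh.
suff /hh : (x - y) / 2 < x - y by rewrite ltxx.
by rewrite ltr_pdivrMr// ltr_pMr ?ltr1n// -opprB oppr_gt0.
Qed.

Lemma linear_coef_eq0 (a b : C) : 0 <= a ->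
  (forall t : C, 0 <= `|t| ^+ 2 * a + (t * b + (t * b)^*)) -> b = 0.
Proof.
move=> a0 h; have a1 : 0 < a + 1 by rewrite ltr_wpDl.
set s := (a + 1)^-1; have s0 : 0 < s by rewrite invr_gt0.
have sr : s^* = s by apply/CrealP; rewrite gtr0_real.
(* At this [t] the expression equals [|b|^2 s (s a - 2)], whose last factor is negative because
   [s a < 1]. *)
have := h (- s * b^*).
rewrite normCK !rmorphM !rmorphN /= !sr !conjCK.
have -> : - s * b^* * (- s * b) * a + (- s * b^* * b + - s * b * b^*) =
  (b * b^*) * (s * (s * a - 2)) by ring.
rewrite -normCK => hb; apply/eqP; rewrite -normr_eq0 -sqrf_eq0.
rewrite eq_le exprn_ge0// andbT.
have n0 : s * (s * a - 2) < 0.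
  rewrite pmulr_rlt0// subr_lt0 /s mulrC ltr_pdivrMr//.
  by rewrite mulrDr mulr1 (le_lt_trans (_ : _ <= 2 * a)) ?ler_peMl ?ler1n// ltrDl.
by rewrite -(nmulr_lge0 _ n0).
Qed.

Lemma add_conj_le (z : C) : z + z^* <= 2 * `|z|.
Proof.
have -> : z + z^* = 2 * 'Re z by rewrite ReE; field.
by rewrite ler_pM2l// leif_Re_Creal.
Qed.

Lemma ge0_conj (z : C) : 0 <= z -> z^* = z.
Proof. by move=> z0; apply/CrealP; rewrite ger0_real. Qed.

End Scalars.

(** * Riesz representation of bounded functionals *)

Section Riesz.
Context {R : realType}.
Local Notation C := (complex R).
Variables (H : hilbertType R) (f : H -> C) (c : C).
Hypotheses (c0 : 0 <= c) (lf : forall a x y, f (a *: x + y) = a * f x + f y)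
  (hc : forall x, `|f x| <= c * `|x|).

(* The representing vector minimises this functional. *)
Let J (x : H) : C := `|x| ^+ 2 - (f x + (f x)^*).

Let fD x y : f (x + y) = f x + f y.
Proof. by rewrite -[x in f (x + _)]scale1r lf mul1r. Qed.
Let f0 : f 0 = 0.
Proof. by apply: (@addrI _ (f 0)); rewrite -fD !addr0. Qed.
Let fZ a x : f (a *: x) = a * f x.
Proof. by rewrite -[a *: x in LHS]addr0 lf f0 addr0. Qed.

Let Jreal x : J x \is Num.real.
Proof.
by apply/CrealP; rewrite /J rmorphB /= (ge0_conj (exprn_ge0 _ (normr_ge0 _))) rmorphD /= conjCK
  [X in _ - X]addrC.
Qed.

(** At the midpoint [J] is no smaller than the infimum, so this form of the parallelogram law bounds
    the distance of two near-minimisers. *)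
Let Jpar u v : `|u - v| ^+ 2 = 2 * (J u + J v) - 4 * J (2^-1 *: (u + v)).
Proof.
rewrite /J !fZ !fD normrZ exprMn.
have -> : `|2^-1| = 2^-1 :> C by rewrite ger0_norm ?invr_ge0 ?ler0n.
have := parallelogram u v; rewrite rmorphM rmorphD fmorphV /= conjC_nat => h.
have -> : `|u - v| ^+ 2 = (`|u + v| ^+ 2 + `|u - v| ^+ 2) - `|u + v| ^+ 2 by ring.
by rewrite h; field.
Qed.

Let Jlow x : - c ^+ 2 <= J x.
Proof.
have cr : c * `|x| \is Num.real by rewrite ger0_real// (le_trans _ (hc x)).
have h : f x + (f x)^* <= 2 * (c * `|x|).
  by apply: le_trans (add_conj_le _) _; rewrite ler_pM2l.
have sq : 0 <= (`|x| - c) ^+ 2.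
  by rewrite real_exprn_even_ge0// rpredB// ger0_real.
rewrite /J -subr_ge0 (le_trans sq)// -subr_ge0.
have -> : `|x| ^+ 2 - (f x + (f x)^*) - - c ^+ 2 - (`|x| - c) ^+ 2 =
  2 * (c * `|x|) - (f x + (f x)^*) by ring.
by rewrite subr_ge0.
Qed.

Let E := [set r : R | exists x, r%:C%C = J x].

Let hasinf : has_inf E.
Proof.
split; first by exists (complex.Re (J 0)), 0; rewrite RRe_real.
exists (complex.Re (- c ^+ 2)) => r [x rx].
by rewrite -lecR rx RRe_real// rpredN ger0_real// exprn_ge0.
Qed.

Let m : C := (inf E)%:C%C.

Let m_low x : m <= J x.
Proof.
rewrite -[J x]RRe_real// lecR; apply: (ge_inf hasinf.2).
by exists x; rewrite RRe_real.
Qed.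

Let m_adh n : exists x, J x <= m + n.+1%:R^-1.
Proof.
have n0 : 0 < (n.+1%:R)^-1 :> R by rewrite invr_gt0 ltr0n.
have [r [x rx] /ltW hr] := inf_adherent n0 hasinf.
exists x; rewrite -rx /m -[n.+1%:R](rmorph_nat (real_complex R)) -fmorphV -rmorphD.
by rewrite lecR.
Qed.

(** If [f] is [dotH _ y], then [J x] is [|x - y|^2 - |y|^2]; so [y] is found as the minimiser of
    [J], and the first-order condition there returns [f]. *)
Lemma riesz : exists y, forall x, f x = dotH x y.
Proof.
have [u hu] := choice m_adh.
have cau (e : C) : 0 < e -> exists N, forall i j, (N <= i)%N -> (N <= j)%N -> `|u i - u j| <= e.
  (* Two values within [e^2 / 4] of the infimum give, by [Jpar], a squared distance of at most
     [2 (e^2 / 4 + e^2 / 4) = e^2]. *)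
  move=> e0; have [N hN] := inv_nat_small (divr_gt0 (exprn_gt0 2 e0) (ltr0Sn C 3)).
  exists N => i j hi hj; rewrite -ler_sqr ?nnegrE ?(ltW e0)//.
  rewrite Jpar.
  rewrite lerBlDr.
  apply: (@le_trans _ _ (2 * ((m + e ^+ 2 / 4) + (m + e ^+ 2 / 4)))).
    by rewrite ler_pM2l// lerD// (le_trans (hu _))// lerD2l hN.
  have -> : 2 * ((m + e ^+ 2 / 4) + (m + e ^+ 2 / 4)) = e ^+ 2 + 4 * m by field.
  by rewrite lerD2l ler_pM2l.
have [y hy] := hilbert_complete cau.
exists y => z.
(* Minimality of [J] at [y], compared with [y + x]; for [x = t *: z] the part linear in [t] must
   vanish, by [linear_coef_eq0]. *)
suff q x : 0 <= `|x| ^+ 2 + (dotH x y - f x + (dotH x y - f x)^*).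
  apply/eqP; rewrite eq_sym -subr_eq0; apply/eqP.
  apply: (@linear_coef_eq0 _ (`|z| ^+ 2)) => [|t]; first by rewrite exprn_ge0.
  by have := q (t *: z); rewrite normrZ exprMn dotZl fZ -mulrBr.
apply: ler_approx => e e0.
have xp : 0 < 2 * (`|x| + 1) by rewrite mulr_gt0// ltr_wpDl.
have [N1 h1] := hy _ (divr_gt0 (divr_gt0 e0 (ltr0Sn _ 1)) xp).
have [N2 h2] := inv_nat_small (divr_gt0 e0 (ltr0Sn C 1)).
pose n := maxn N1 N2.
have {}h1 := h1 n (leq_maxl _ _); have {}h2 := h2 n (leq_maxr _ _).
have : J (u n) <= J (u n + x) + e / 2.
  by apply: le_trans (hu n) _; rewrite lerD.
have d1 : dotH x (u n) - dotH x y + (dotH x (u n) - dotH x y)^* <= e / 2.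
  rewrite -dotNr -dotDr; set w := dotH _ _.
  apply: le_trans (add_conj_le _) _.
  apply: (@le_trans _ _ (2 * (`|x| * `|u n - y|))).
    by rewrite ler_pM2l// Cauchy_Schwarz.
  apply: (@le_trans _ _ (2 * (`|x| + 1) * `|u n - y|)).
    by rewrite -mulrA ler_pM2l// ler_wpM2r// lerDl.
  by rewrite mulrC -ler_pdivlMr.
move: d1; rewrite /J fD -!dotH_norm !(dotDl, dotDr) (dotC (u n) x).
move: (dotH x (u n)) (dotH x y) (f x) (f (u n)) (dotH (u n) (u n)) (dotH x x).
move=> p q r s v w; rewrite !rmorphD !rmorphN /=.
rewrite -subr_ge0 => d1; rewrite -subr_ge0 => h.
suff -> : w + (q - r + (q^* - r^*)) + e =
  (v + p^* + (p + w) - (s + r + (s^* + r^*)) + e / 2 - (v - (s + s^*))) +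
  (e / 2 - (p - q + (p^* - q^*))) by exact: addr_ge0.
by field.
Qed.
End Riesz.

Section Adjoint.
Context {R : realType}.
Local Notation C := (complex R).
Implicit Types H K L M : hilbertType R.

Lemma adj_exists H K (f : H -> K) : bounded_op f -> exists g, is_adjoint f g.
Proof.
move=> bf; have lf := bop_lin bf; have [c c0 hc] := bop_bound bf.
have /choice[g hg] : forall y, exists z, forall x, dotH (f x) y = dotH x z.
  move=> y; apply: (@riesz _ _ _ (c * `|y|)) => [|a u v|x].
  - by rewrite mulr_ge0// ltW.
  - by rewrite lf dotDl dotZl.
  - by apply: le_trans (Cauchy_Schwarz _ _) _; rewrite mulrAC ler_wpM2r.
by exists g => x y.
Qed.

Lemma adjP H K (f : H -> K) x y : bounded_op f -> dotH (f x) y = dotH x (adj f y).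
Proof.
move=> bf; rewrite /adj.
by case: xgetP => [g _|/(_ _)]; [exact | have [g hg] := adj_exists bf => /(_ g)].
Qed.

Lemma adjP' H K (f : H -> K) x y : bounded_op f -> dotH (adj f x) y = dotH x (f y).
Proof. by move=> bf; rewrite dotC -adjP// -dotC. Qed.

Lemma adj_unique H K (f : H -> K) g : is_adjoint f g -> adj f = g.
Proof.
move=> h; apply: xget_unique => // g' h'; apply/funext => y.
by apply: dot_injr => x; rewrite -h -h'.
Qed.

Lemma adj_lin H K (f : H -> K) : bounded_op f -> linear (adj f).
Proof.
move=> bf a x y; apply: dot_inj => z.
by rewrite adjP'// !(dotDl, dotZl) !adjP'.
Qed.

Lemma adj_bound H K (f : H -> K) (c : C) : bounded_op f -> 0 <= c ->
  (forall x, `|f x| <= c * `|x|) -> forall x, `|adj f x| <= c * `|x|.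
Proof.
move=> bf c0 hc x; apply: norm_le_dot => [|y]; first by rewrite mulr_ge0.
rewrite adjP'//; apply: le_trans (Cauchy_Schwarz _ _) _.
by rewrite [c * _]mulrC -mulrA ler_wpM2l.
Qed.

Lemma bop_adj H K (f : H -> K) : bounded_op f -> bounded_op (adj f).
Proof.
move=> bf; have [c c0 hc] := bop_bound bf.
apply/bounded_opP; split; first exact: adj_lin.
by exists c; [exact: ltW | apply: adj_bound => //; exact: ltW].
Qed.

Lemma adjK H K (f : H -> K) : bounded_op f -> adj (adj f) = f.
Proof. by move=> bf; apply: adj_unique => x y; rewrite adjP'. Qed.

Lemma adj_comp H K L (f : K -> L) (g : H -> K) :
  bounded_op f -> bounded_op g -> adj (f \o g) = adj g \o adj f.
Proof. by move=> bf bg; apply: adj_unique => x y /=; rewrite !adjP. Qed.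

Lemma adj_id H : adj (@idfun H) = idfun.
Proof. exact: adj_unique. Qed.

Lemma adj_ZD H K a (f g : H -> K) : bounded_op f -> bounded_op g ->
  adj (a *: f + g) = a^* *: adj f + adj g.
Proof.
move=> bf bg; apply: adj_unique => x y.
by rewrite !fctE dotDl dotDr dotZl dotZr conjCK !adjP.
Qed.

Lemma adj0 H K : adj (0 : H -> K) = 0.
Proof. by apply: adj_unique => x y; rewrite dot0l dot0r. Qed.

End Adjoint.

(** * Subspaces of operators and their norm closures *)

Section Closed.
Context {R : realType}.
Local Notation C := (complex R).
Implicit Types H K L M : hilbertType R.

Section Sub.
Context {H K : hilbertType R} {S : set (H -> K)} (lS : lin_subspace S).
Lemma ls0 : S 0. Proof. by case: lS. Qed.
Lemma lsZD a f g : S f -> S g -> S (a *: f + g). Proof. by case: lS => _; apply. Qed.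
Lemma lsD f g : S f -> S g -> S (f + g).
Proof. by move=> ? ?; rewrite -[f]scale1r; apply: lsZD. Qed.
Lemma lsZ a f : S f -> S (a *: f).
Proof. by move=> ?; rewrite -[_ *: _]addr0; apply: lsZD ls0. Qed.
Lemma lsN f : S f -> S (- f).
Proof. by rewrite -scaleN1r; apply: lsZ. Qed.
Lemma lsB f g : S f -> S g -> S (f - g).
Proof. by move=> ? ?; apply: lsD => //; apply: lsN. Qed.
Lemma ls_sum I (r : seq I) (P : pred I) (F : I -> H -> K) :
  (forall i, P i -> S (F i)) -> S (\sum_(i <- r | P i) F i).
Proof. by move=> h; elim/big_ind: _ => //; [exact: ls0 | exact: lsD]. Qed.
End Sub.

Lemma bop_sub H K : lin_subspace (@bounded_op R H K).
Proof. by split; [exact: bop_0 | move=> *; exact: bop_ZD]. Qed.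

Lemma adjZ H K a (f : H -> K) : bounded_op f -> adj (a *: f) = a^* *: adj f.
Proof. by move=> bf; rewrite -[a *: f]addr0 adj_ZD ?adj0 ?addr0//; exact: bop_0. Qed.
Lemma adjD H K (f g : H -> K) : bounded_op f -> bounded_op g ->
  adj (f + g) = adj f + adj g.
Proof. by move=> bf bg; rewrite -[f]scale1r adj_ZD// conjC1 !scale1r. Qed.
Lemma adjB H K (f g : H -> K) : bounded_op f -> bounded_op g ->
  adj (f - g) = adj f - adj g.
Proof.
by move=> bf bg; rewrite addrC -scaleN1r adj_ZD// rmorphN1 scaleN1r addrC.
Qed.
Lemma adj_sum H K I (r : seq I) (P : pred I) (F : I -> H -> K) :
  (forall i, P i -> bounded_op (F i)) ->
  adj (\sum_(i <- r | P i) F i) = \sum_(i <- r | P i) adj (F i).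
Proof.
move=> bF; suff [] : bounded_op (\sum_(i <- r | P i) F i) /\
  adj (\sum_(i <- r | P i) F i) = \sum_(i <- r | P i) adj (F i) by [].
elim/big_rec2: _ => [|i a b Pi [bb <-]]; first by rewrite adj0; split=> //; exact: bop_0.
by split; [apply: (lsD (bop_sub _ _)) => //; exact: bF | rewrite adjD//; exact: bF].
Qed.

Lemma op_sumE (V : lmodType C) (T : Type) I (r : seq I) P (F : I -> T -> V) x :
  (\sum_(i <- r | P i) F i) x = \sum_(i <- r | P i) F i x.
Proof. by elim/big_rec2: _ => // i a b _ <-. Qed.

Lemma sub_closure H K (S : set (H -> K)) : S `<=` bounded_op -> S `<=` op_closure S.
Proof.
move=> bS f Sf; split=> [|e e0]; first exact: bS.
by exists f => // x; rewrite subrr normr0 mulr_ge0// ltW.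
Qed.

Lemma closure_bop H K (S : set (H -> K)) : op_closure S `<=` bounded_op.
Proof. by move=> f []. Qed.

Lemma closureK H K (S : set (H -> K)) : op_closure (op_closure S) `<=` op_closure S.
Proof.
move=> f [bf hf]; split=> // e e0; have e2 : 0 < e / 2 by rewrite divr_gt0.
have [g [bg hg] fg] := hf _ e2; have [h Sh gh] := hg _ e2.
exists h => // x; rewrite (_ : f x - h x = (f x - g x) + (g x - h x)); last first.
  by rewrite addrA subrK.
apply: le_trans (ler_normD _ _) _; apply: le_trans (lerD (fg x) (gh x)) _.
by rewrite -mulrDl -splitr.
Qed.

Lemma closure_sub H K (S : set (H -> K)) : S `<=` bounded_op ->
  lin_subspace S -> lin_subspace (op_closure S).
Proof.
move=> bS lS; split; first exact: sub_closure (ls0 lS).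
move=> a f g [bf hf] [bg hg]; split=> [|e e0]; first exact: bop_ZD.
have a1 : 0 < `|a| + 1 by rewrite ltr_wpDl.
have [f' Sf' ff] := hf (e / 2 / (`|a| + 1)) (divr_gt0 (divr_gt0 e0 (ltr0Sn _ 1)) a1).
have [g' Sg' gg] := hg (e / 2) (divr_gt0 e0 (ltr0Sn _ 1)).
exists (a *: f' + g') => [|x]; first exact: lsZD.
rewrite !fctE opprD addrACA -scalerBr (splitr e) mulrDl.
apply: le_trans (ler_normD _ _) _; apply: lerD => //.
rewrite normrZ; apply: (@le_trans _ _ ((`|a| + 1) * `|f x - f' x|)).
  by rewrite ler_wpM2r// lerDl.
apply: le_trans (ler_wpM2l (ltW a1) (ff x)) _.
by rewrite mulrA [_ * (_ / _)]mulrC divfK// gt_eqF.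
Qed.

Lemma closure_comp H K L M (S : set (H -> K)) (T : set (L -> M))
    (f : K -> M) (g : L -> H) : S `<=` bounded_op ->
  bounded_op f -> bounded_op g -> (forall s, S s -> op_closure T (f \o s \o g)) ->
  forall s, op_closure S s -> op_closure T (f \o s \o g).
Proof.
move=> bS bf bg h s [bs hs]; apply: closureK; split=> [|e e0].
  by apply: bop_comp => //; apply: bop_comp.
have [c c0 hc] := bop_bound bf; have [d d0 hd] := bop_bound bg.
have cd : 0 < c * d by rewrite mulr_gt0.
have [s' Ss' ss] := hs (e / (c * d)) (divr_gt0 e0 cd).
exists (f \o s' \o g) => [|x /=]; first exact: h.
rewrite -(linB (bop_lin bf)); apply: le_trans (hc _) _.
apply: le_trans (ler_wpM2l (ltW c0) (ss _)) _.
have e1 : 0 <= c * (e / (c * d)) by rewrite mulr_ge0 ?divr_ge0 ?ltW.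
rewrite mulrA; apply: le_trans (ler_wpM2l e1 (hd _)) _.
have -> // : c * (e / (c * d)) * (d * `|x|) = e * `|x|.
by field; rewrite !gt_eqF.
Qed.

Lemma op_system_closure H (S : set (H -> H)) :
  operator_system S -> operator_system (op_closure S).
Proof.
move=> [bS lS aS iS]; split.
- exact: closure_bop.
- exact: closure_sub.
- move=> f [bf hf]; split=> [|e e0]; first exact: bop_adj.
  have [g Sg fg] := hf e e0; exists (adj g); first exact: aS.
  move=> x; have bg := bS _ Sg.
  have -> : adj f x - adj g x = adj (f - g) x.
    rewrite addrC (_ : f - g = (-1) *: g + f); last by rewrite scaleN1r addrC.
    by rewrite adj_ZD// rmorphN1 !fctE scaleN1r.
  apply: adj_bound (ltW e0) fg x.
  by apply: lsB => //; exact: bop_sub.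
- exact: sub_closure iS.
Qed.

(** The limit is taken pointwise; the Cauchy estimate is relative to [|x|] and survives the limit,
    which is therefore uniform and bounded. *)
Lemma op_complete H K (u : nat -> H -> K) : (forall n, bounded_op (u n)) ->
  (forall e : C, 0 < e -> exists N, forall m n, (N <= m)%N -> (N <= n)%N ->
     forall x, `|u m x - u n x| <= e * `|x|) ->
  exists2 l, bounded_op l & forall e : C, 0 < e -> exists N, forall n, (N <= n)%N ->
     forall x, `|u n x - l x| <= e * `|x|.
Proof.
move=> bu cu.
have /choice[l hl] : forall x, exists l, forall e : C, 0 < e -> exists N,
    forall n, (N <= n)%N -> `|u n x - l| <= e.
  move=> x; apply: hilbert_complete => e e0.
  have x1 : 0 < `|x| + 1 by rewrite ltr_wpDl.
  have [N hN] := cu _ (divr_gt0 e0 x1); exists N => m n hm hn.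
  apply: le_trans (hN _ _ hm hn x) _.
  by rewrite mulrAC ler_pdivrMr// ler_pM2l// lerDl.
have ul (e : C) : 0 < e -> exists N, forall n, (N <= n)%N -> forall x, `|u n x - l x| <= e * `|x|.
  move=> e0; have [N hN] := cu e e0; exists N => n hn x.
  apply: ler_approx => d d0; have [M hM] := hl x d d0.
  have h1 := hN _ _ hn (leq_maxl N M) x; have h2 := hM _ (leq_maxr N M).
  rewrite (_ : u n x - l x = (u n x - u (maxn N M) x) + (u (maxn N M) x - l x)).
    by apply: le_trans (ler_normD _ _) _; apply: lerD.
  by rewrite addrA subrK.
have lim_uniq x y : (forall e : C, 0 < e -> exists N, forall n, (N <= n)%N ->
  `|u n x - y| <= e) -> l x = y.
  move=> hy; apply/eqP; rewrite -subr_eq0 -normr_eq0 eq_le normr_ge0 andbT.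
  apply: ler_approx => e e0; rewrite add0r.
  have e2 : 0 < e / 2 by rewrite divr_gt0.
  have [N hN] := hy _ e2; have [M hM] := hl x _ e2.
  have h1 := hN _ (leq_maxl N M); have h2 := hM _ (leq_maxr N M).
  rewrite (_ : l x - y = (u (maxn N M) x - y) - (u (maxn N M) x - l x)).
    by rewrite (splitr e); apply: le_trans (ler_normB _ _) _; apply: lerD.
  by rewrite opprB [RHS]addrC addrA subrK.
exists l => //; apply/bounded_opP; split.
  move=> a x y; apply: lim_uniq => e e0.
  have a1 : 0 < `|a| + 1 by rewrite ltr_wpDl.
  have e2 : 0 < e / 2 by rewrite divr_gt0.
  have [N hN] := hl x _ (divr_gt0 e2 a1); have [M hM] := hl y _ e2.
  exists (maxn N M) => n; rewrite geq_max => /andP[hn hm].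
  rewrite (bop_lin (bu n)) opprD addrACA -scalerBr (splitr e).
  apply: le_trans (ler_normD _ _) _; apply: lerD; last exact: hM.
  rewrite normrZ; apply: (@le_trans _ _ ((`|a| + 1) * `|u n x - l x|)).
    by rewrite ler_wpM2r// lerDl.
  by rewrite mulrC -ler_pdivlMr// hN.
have [N hN] := ul 1 ltr01; have [c c0 hc] := bop_bound (bu N).
exists (c + 1) => [|x]; first by rewrite addr_ge0// ltW.
have := hN N (leqnn _) x => h.
rewrite (_ : l x = u N x - (u N x - l x)); last by rewrite opprB [RHS]addrC subrK.
by apply: le_trans (ler_normB _ _) _; rewrite mulrDl lerD.
Qed.

End Closed.

(** * Positive operator kernels *)

Section Kernels.
Context {R : realType}.
Local Notation C := (complex R).
Implicit Types (H K L M : hilbertType R) (I J : finType).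

(* [mx_positive] over an arbitrary finite index type. *)
Definition kpos {H I} (A : I -> I -> H -> H) : Prop :=
  forall x : I -> H, 0 <= \sum_i \sum_j dotH (A i j (x j)) (x i).

Lemma kpos_eq H I (A B : I -> I -> H -> H) :
  (forall i j, A i j = B i j) -> kpos A -> kpos B.
Proof.
move=> AB h x; under eq_bigr do under eq_bigr do rewrite -AB.
exact: h.
Qed.

(** [A] is tested on the vector whose [i]-th entry sums [k a (x a)] over the fibre of [p] above [i];
    [p] may repeat or omit indices. *)
Lemma kpos_congr H K I J (p : J -> I) (k : J -> K -> H) (A : I -> I -> H -> H) :
  (forall a, bounded_op (k a)) -> (forall i j, linear (A i j)) -> kpos A ->
  kpos (fun a b => adj (k a) \o A (p a) (p b) \o k b).
Proof.
move=> bk lA hA x.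
have := hA (fun i => \sum_(a | p a == i) k a (x a)).
rewrite (_ : \sum_i _ = \sum_a \sum_b dotH ((adj (k a) \o A (p a) (p b) \o k b) (x b)) (x a))//.
rewrite [RHS](partition_big p predT)//=; apply: eq_bigr => i _.
under eq_bigr do rewrite dot_sumr.
rewrite exchange_big /=; apply: eq_bigr => a /eqP <-.
rewrite [RHS](partition_big p predT)//=; apply: eq_bigr => j _.
rewrite (lin_sum (lA _ _)) dot_suml; apply: eq_bigr => b /eqP <-.
by rewrite adjP'.
Qed.

Lemma kpos_pull H I J (p : J -> I) (A : I -> I -> H -> H) :
  (forall i j, linear (A i j)) -> kpos A -> kpos (fun a b => A (p a) (p b)).
Proof.
move=> lA /(kpos_congr p (fun=> @bop_id R H) lA); apply: kpos_eq => a b.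
by rewrite adj_id.
Qed.

(** This is the compression of [A] by the column with entries [k a], which leaves only the second
    index: [A] is tested at [k a (x i)]. *)
Lemma kpos_compress H K I J (k : J -> K -> H) (A : J * I -> J * I -> H -> H) :
  (forall a, bounded_op (k a)) -> kpos A ->
  kpos (fun i j => \sum_a \sum_b (adj (k a) \o A (a, i) (b, j) \o k b)).
Proof.
move=> bk hA x; have := hA (fun q => k q.1 (x q.2)).
rewrite (_ : \sum_i _ = \sum_i \sum_j dotH ((\sum_a \sum_b (adj (k a) \o A (a, i) (b, j) \o k
  b)) (x j)) (x i))//.
transitivity (\sum_a \sum_i \sum_b \sum_j dotH (A (a, i) (b, j) (k b (x j))) (k a (x i))).
  rewrite (pair_bigA _ (fun a i => \sum_b \sum_j dotH (A (a, i) (b, j) (k b (x j))) (k a (x i))))/=.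
  apply: eq_bigr => -[a i] _ /=; rewrite (pair_bigA _ (fun b j => dotH (A (a, i) (b, j) (k b (x
    j))) (k a (x i))))/=.
  by apply: eq_bigr => -[b j].
rewrite exchange_big; apply: eq_bigr => i _.
transitivity (\sum_a \sum_j \sum_b dotH (A (a, i) (b, j) (k b (x j))) (k a (x i))).
  by apply: eq_bigr => a _; rewrite exchange_big.
rewrite exchange_big; apply: eq_bigr => j _.
rewrite op_sumE dot_suml; apply: eq_bigr => a _.
by rewrite op_sumE dot_suml; apply: eq_bigr => b _; rewrite /= adjP'.
Qed.

Lemma kpos_gram H K I (r : I -> H -> K) : (forall i, bounded_op (r i)) ->
  kpos (fun i j => adj (r i) \o r j).
Proof.
move=> br x; rewrite (_ : \sum_i _ = dotH (\sum_i r i (x i)) (\sum_i r i (x i))).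
  exact: dot_ge0.
rewrite dot_sumr; apply: eq_bigr => i _.
by rewrite dot_suml; apply: eq_bigr => j _; rewrite /= adjP'.
Qed.

Lemma kposD H I (A B : I -> I -> H -> H) : kpos A -> kpos B ->
  kpos (fun i j => A i j + B i j).
Proof.
move=> hA hB x; rewrite (_ : \sum_i _ = \sum_i \sum_j dotH (A i j (x j)) (x i) +
  \sum_i \sum_j dotH (B i j (x j)) (x i)); first exact: addr_ge0.
rewrite -big_split; apply: eq_bigr => i _.
by rewrite -big_split; apply: eq_bigr => j _; rewrite /= -dotDl.
Qed.

(** Complete positivity is stated for ordinals; the enumeration of [I] and its inverse carry it to
    any finite index type, so that kernels may be indexed by products, sums and options. *)
Lemma cp_kpos H K I (S : set (H -> H)) (T : set (K -> K)) phi (A : I -> I -> H -> H) :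
  S `<=` bounded_op -> T `<=` bounded_op -> cp_map S T phi ->
  (forall i j, S (A i j)) -> kpos A -> kpos (fun i j => phi (A i j)).
Proof.
move=> bS bT [_ ST cp] SA hA.
pose B := \matrix_(i < #|I|, j < #|I|) A (enum_val i) (enum_val j).
have hB : mx_positive B.
  have := kpos_pull (@enum_val I predT) (fun i j => bop_lin (bS _ (SA i j))) hA.
  by apply: kpos_eq => i j; rewrite mxE.
have SB : mx_over S B by move=> i j; rewrite mxE.
have : kpos (map_mx phi B) by exact: cp.
move=> /(kpos_pull enum_rank) h; apply: kpos_eq (h _) => i j.
  by rewrite !mxE !enum_rankK.
by apply: bop_lin; apply: bT; rewrite !mxE; apply: ST.
Qed.

Lemma coe_kpos H K I (S : set (H -> H)) phi (A : I -> I -> H -> H) :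
  S `<=` bounded_op -> @unital_complete_order_embedding R H K S phi ->
  (forall i j, S (A i j)) -> kpos (fun i j => phi (A i j)) -> kpos A.
Proof.
move=> bS [[[_ ST _] _] _ cp] SA hA.
pose B := \matrix_(i < #|I|, j < #|I|) A (enum_val i) (enum_val j).
have hB : mx_positive (map_mx phi B).
  have := kpos_pull (@enum_val I predT) (fun i j => bop_lin (ST _ (SA i j))) hA.
  by apply: kpos_eq => i j; rewrite !mxE.
have SB : mx_over S B by move=> i j; rewrite mxE.
have : kpos B by exact: cp.
move=> /(kpos_pull enum_rank) h; apply: kpos_eq (h _) => i j.
  by rewrite !mxE !enum_rankK.
by apply: bop_lin; apply: bS; rewrite !mxE.
Qed.

Lemma sum_option_bool (V : nmodType) (F : option bool -> V) :
  \sum_i F i = F (Some true) + (F (Some false) + F None).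
Proof.
rewrite (bigD1 (Some true))//= (bigD1 (Some false))//= (bigD1 None)//= big1 ?addr0//.
by case=> // -[].
Qed.

(** The values [t = 1] and [t = 'i] determine the imaginary and the real part of [b']. *)
Lemma real_conj (b b' : C) :
  (forall t, t * b + t^* * b' \is Num.real) -> b' = b^*.
Proof.
move=> h; have /CrealP := h 1; have /CrealP := h 'i.
rewrite conjCi conjC1 !mul1r !rmorphD !rmorphM !rmorphN /= conjCi opprK => h1 h2.
have {}h1 : b - b' = - b^* + b'^*.
  apply: (mulfI (neq0Ci C)); rewrite !mulrDr !mulrN -mulNr; move: h1.
  by rewrite !mulNr.
have e2 : 2 != 0 :> C by rewrite pnatr_eq0.
apply: (mulfI e2); have -> : 2 * b' = (b + b') - (b - b') by ring.
by rewrite -h2 h1; ring.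
Qed.

(** Positivity contains reality, which forces [b' = b^*]; the version with one coefficient then
    applies. *)
Lemma linear_coefs_eq0 (a b b' : C) :
  (forall t : C, 0 <= `|t| ^+ 2 * a + (t * b + t^* * b')) -> 0 <= a -> b = 0 /\ b' = 0.
Proof.
move=> h a0; have hb : b' = b^*.
  apply: real_conj => t; have := ger0_real (h t).
  by rewrite rpredDl// ger0_real// mulr_ge0// exprn_ge0.
have b0 : b = 0.
  by apply: (linear_coef_eq0 a0) => t; have := h t; rewrite hb -rmorphM.
by rewrite hb b0 conjC0.
Qed.

Lemma kpos_diag H I (G : I -> I -> H -> H) i x : 
  (forall i j, linear (G i j)) -> kpos G -> 0 <= dotH (G i i x) x.
Proof.
move=> lG /(kpos_pull (fun=> i) lG)/(_ (fun _ : 'I_1 => x)).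
by rewrite !big_ord1.
Qed.

(** Positive kernels are hermitian: the adjoint relation is extracted by polarisation from the
    reality of the quadratic form. *)
Lemma kpos_adjoint H (G : bool -> bool -> H -> H) :
  (forall i j, linear (G i j)) -> kpos G -> is_adjoint (G true false) (G false true).
Proof.
move=> lG hG x y; rewrite [RHS]dotC.
apply/esym/(canLR conjCK)/real_conj => t.
have := ger0_real (hG (fun i => if i then y else t *: x)).
rewrite !big_bool /= !(linZ (lG _ _)) !(dotZl, dotZr).
set p := dotH _ y; set q := dotH _ y; set q' := dotH _ x; set d := dotH _ x.
rewrite (_ : _ + _ = (p + `|t| ^+ 2 * d) + (t * q + t^* * q')); last first.
  by rewrite normCK; ring.
rewrite rpredDl// ger0_real// addr_ge0 ?mulr_ge0 ?exprn_ge0//; exact: kpos_diag.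
Qed.

(** Together with [bound_kpos] this expresses a norm bound as positivity of a 2 by 2 kernel, so that
    unital completely positive maps are seen to be contractive. *)
Lemma kpos_bound H (c : C) (f g : H -> H) : 0 < c -> linear f -> linear g ->
  kpos (fun i j : bool => if i == j then c *: idfun else if i then f else g) ->
  forall x, `|f x| <= c * `|x|.
Proof.
move=> c0 lf lg hG x; have cr := ge0_conj (ltW c0).
have lG (i j : bool) : linear (if i == j then c *: idfun else if i then f else g).
  case: eqP => _; last by case: i.
  by move=> a u v; rewrite !fctE /= scalerDr !scalerA mulrC.
have := kpos_adjoint lG hG; rewrite /= => fg.
(* At this vector the form equals [c (c^2 |x|^2 - |f x|^2)]. *)
have := hG (fun i => if i then f x else - c *: x).
rewrite !big_bool /= !fctE /= !(linZ lf) !(dotZl, dotZr) rmorphN /= cr (_ : dotH (g (f x)) x =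
  dotH (f x) (f x)); last by rewrite dotC -fg -dotC.
move=> h; rewrite -ler_sqr ?nnegrE ?mulr_ge0 ?(ltW c0)//.
move: h; rewrite exprMn -!dotH_norm; set p := dotH _ _; set q := dotH x x.
rewrite (_ : _ + _ = c * (c ^+ 2 * q - p)); last by ring.
by rewrite pmulr_rge0// subr_ge0.
Qed.

Lemma bound_kpos H (c : C) (f : H -> H) : 0 < c -> bounded_op f ->
  (forall x, `|f x| <= c * `|x|) ->
  kpos (fun i j : bool => if i == j then c *: idfun else if i then f else adj f).
Proof.
move=> c0 bf hf x; rewrite !big_bool /= !fctE /= !dotZl adjP'// (dotC _ (f _)).
set u := x true; set v := x false; set z := dotH (f v) u.
have zb : `|z| <= c * `|v| * `|u|.
  by apply: le_trans (Cauchy_Schwarz _ _) _; rewrite ler_wpM2r.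
have : 0 <= c * (`|u| - `|v|) ^+ 2.
  by rewrite mulr_ge0 ?(ltW c0)// real_exprn_even_ge0// rpredB// ger0_real.
have := add_conj_le (- z); rewrite normrN rmorphN /= => h1 h2.
have {}h1 : - z - z^* <= 2 * (c * `|v| * `|u|).
  by apply: le_trans h1 _; rewrite ler_pM2l.
move: h1; rewrite -subr_ge0 => /(addr_ge0 h2); rewrite !dotH_norm; congr (0 <= _).
by ring.
Qed.

(* Test on [(xi, t eta, - r^* xi)]: the terms of degree 0 in [t] cancel. *)
Lemma kpos_schur H (G : option bool -> option bool -> H -> H) (r : H -> H) :
  let a := Some true in let b := Some false in
  (forall i j, linear (G i j)) -> kpos G -> bounded_op r ->
  G a a = r \o adj r -> G a None = r -> G None a = adj r -> G None None = idfun ->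
  G a b = r \o G None b /\ G b a = G b None \o adj r.
Proof.
move=> a b lG hG br Gaa Ga Ga' G0.
suff h x y : dotH (G a b y) x - dotH (r (G None b y)) x = 0 /\
    dotH (G b a x) y - dotH (G b None (adj r x)) y = 0.
  split; apply/funext => u; apply: dot_inj => v; apply/eqP; rewrite -subr_eq0.
    by rewrite (h v u).1.
  by rewrite (h u v).2.
apply: (@linear_coefs_eq0 (dotH (G b b y) y)); last exact: kpos_diag.
move=> t; have := hG (fun i => match i with Some true => x | Some false => t *: y | None => -
  adj r x end).
rewrite !sum_option_bool -/a -/b Gaa Ga Ga' G0 /= !(linZ (lG _ _)) !(dotZl, dotZr).
rewrite !(linN (bop_lin br)) !(linN (lG _ _)) !(dotNl, dotNr) !(adjP' _ _ br) !(adjP _ _ br).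
rewrite normCK.
set p := dotH (adj r x) _; set q := dotH (G b b y) y.
congr (0 <= _).
have -> : dotH x (r (adj r x)) = p by rewrite /p adjP'.
rewrite -/q.
by ring.
Qed.

End Kernels.

(** * Construction of Hilbert spaces *)

Section InnerSpace.
Context {R : realType}.
Local Notation C := (complex R).

(** Completeness is stated with squared distances because the norm exists only once [hilb] has been
    built from these data. *)
Record inner_space := InnerSpace {
  inner_car : lmodType C;
  inner : inner_car -> inner_car -> C;
  innerL : forall a x y z, inner (a *: x + y) z = a * inner x z + inner y z;
  innerC : forall x y, inner x y = (inner y x)^*;
  inner_pos : forall x, x != 0 -> 0 < inner x x;
  inner_complete : forall u : nat -> inner_car,
    (forall e : C, 0 < e -> exists N, forall m n, (N <= m)%N -> (N <= n)%N ->
      inner (u m - u n) (u m - u n) <= e ^+ 2) ->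
    exists l, forall e : C, 0 < e -> exists N, forall n, (N <= n)%N ->
      inner (u n - l) (u n - l) <= e ^+ 2 }.

Variable V : inner_space.

Definition hilb : Type := inner_car V.

HB.instance Definition _ := GRing.Lmodule.copy hilb (inner_car V).

Definition hilb_norm (x : hilb) : C := sqrtC (inner (i:=V) x x).
Definition hilb_dot (x y : hilb) : C := inner (i:=V) x y.

Lemma hilb_dotL a x y z : hilb_dot (a *: x + y) z = a * hilb_dot x z + hilb_dot y z.
Proof. exact: innerL. Qed.
Lemma hilb_dotR a x y z : hilb_dot z (a *: x + y) = a^* * hilb_dot z x + hilb_dot z y.
Proof. exact: (inner_R (@innerL V) (@innerC V)). Qed.
Lemma hilb_dot_ge0 x : 0 <= hilb_dot x x.
Proof.
have [->|/inner_pos/ltW//] := eqVneq x 0.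
by rewrite [hilb_dot _ _](inner_0l (@innerL V)).
Qed.

Lemma hilb_normD x y : hilb_norm (x + y) <= hilb_norm x + hilb_norm y.
Proof.
rewrite -ler_sqr ?nnegrE ?addr_ge0 ?sqrtC_ge0 ?hilb_dot_ge0// sqrrD !sqrtCK.
have -> : inner (i:=V) (x + y) (x + y) = hilb_dot (1 *: x + y) (1 *: x + y) by rewrite scale1r.
rewrite hilb_dotL !hilb_dotR !conjC1 !mul1r (_ : hilb_dot y x = (hilb_dot x y)^*);
  last exact: innerC.
have : hilb_dot x y + (hilb_dot x y)^* <= 2 * (hilb_norm x * hilb_norm y).
  apply: le_trans (add_conj_le _) _; rewrite ler_pM2l//.
  rewrite -ler_sqr ?nnegrE ?mulr_ge0 ?sqrtC_ge0 ?hilb_dot_ge0// exprMn !sqrtCK.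
  exact: (inner_CS (@innerL V) (@innerC V) (@inner_pos V)).
move=> h; rewrite -subr_ge0 in h; rewrite -subr_ge0; congr (0 <= _): h.
by rewrite /hilb_norm -/(hilb_dot x x) -/(hilb_dot y y); ring.
Qed.

Lemma hilb_normZ a x : hilb_norm (a *: x) = `|a| * hilb_norm x.
Proof.
rewrite /hilb_norm [inner _ _](inner_ZZ (@innerL V) (@innerC V)).
by rewrite sqrtCM ?nnegrE ?exprn_ge0 ?hilb_dot_ge0// sqrCK.
Qed.

Lemma hilb_norm0 x : hilb_norm x = 0 -> x = 0.
Proof.
move/eqP; rewrite sqrtC_eq0 => h; apply/eqP; apply: contraTT h => x0.
by rewrite gt_eqF// inner_pos.
Qed.

HB.instance Definition _ := Lmodule_isNormed.Build C hilb hilb_normD hilb_normZ hilb_norm0.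

Lemma hilb_normE (x : hilb) : `|x| = sqrtC (hilb_dot x x). Proof. by []. Qed.

(** A Cauchy filter contains balls of radius [1 / (n + 1)] about points [u n]. Any two of these
    balls meet, so the centres form a Cauchy sequence, and its limit is a limit of the filter. *)
Lemma hilb_cvg (F : set_system hilb) : ProperFilter F -> cauchy F -> cvg F.
Proof.
move=> FF /cauchyP Fc.
have /choice[u hu] : forall n, exists x, F (ball x (n.+1%:R^-1 : C)).
  by move=> n; apply: Fc; rewrite invr_gt0 ltr0n.
have norm_le (x : hilb) (e : C) : 0 <= e -> (inner (i:=V) x x <= e ^+ 2) = (`|x| <= e).
  move=> e0; rewrite hilb_normE -[in RHS]ler_sqr ?nnegrE ?sqrtC_ge0 ?hilb_dot_ge0//.
  by rewrite sqrtCK.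
have [l hl] : exists l : hilb, forall e : C, 0 < e -> exists N, forall n, (N <= n)%N ->
  `|u n - l| <= e.
  have [|l hl] := @inner_complete V u.
    move=> e e0; have [N hN] := inv_nat_small (divr_gt0 e0 (ltr0Sn C 1)).
    exists N => m n hm hn; rewrite [_ <= _](norm_le (u m - u n) e (ltW e0)).
    have [x []] := filter_ex (filterI (hu m) (hu n)).
    rewrite -!ball_normE /= => /ltW um /ltW un.
    rewrite (_ : u m - u n = (u m - x) - (u n - x)); last by rewrite opprB addrA subrK.
    apply: le_trans (ler_normB _ _) _; rewrite (splitr e).
    by apply: lerD; [exact: le_trans um (hN _ hm) | exact: le_trans un (hN _ hn)].
  exists l => e e0; have [N hN] := hl e e0; exists N => n hn.
  by rewrite -norm_le ?(ltW e0)//; exact: hN.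
apply/cvg_ex; exists l; apply/cvgrPdist_lt => e e0.
have e2 : 0 < e / 2 by rewrite divr_gt0.
have [N hN] := inv_nat_small e2; have [M hM] := hl _ (divr_gt0 e2 (ltr0Sn C 1)).
pose n := maxn N M; have {}hM := hM n (leq_maxr _ _).

apply: filterS (hu n) => x; rewrite -ball_normE /= => ux.
rewrite (_ : l - x = (u n - x) - (u n - l)); last first.
  by rewrite opprB [RHS]addrC addrA subrK.
apply: le_lt_trans (ler_normB _ _) _; rewrite (splitr e).
apply: ltr_leD; first exact: lt_le_trans ux (hN _ (leq_maxl _ _)).
by apply: le_trans hM _; rewrite ler_pdivrMr// ler_peMr ?ler1n// ltW.
Qed.

HB.instance Definition _ := Uniform_isComplete.Build hilb hilb_cvg.

Let dotBl z : {morph hilb_dot^~ z : x y / x - y}.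
Proof. by move=> x y; rewrite addrC -scaleN1r hilb_dotL mulN1r addrC. Qed.
Let dotBr z : {morph hilb_dot z : x y / x - y}.
Proof. by move=> x y; rewrite addrC -scaleN1r hilb_dotR rmorphN1 mulN1r addrC. Qed.
Let dotZl' z : scalable_for *%R (hilb_dot^~ z).
Proof.
move=> a x; rewrite /= -[a *: x]addr0 hilb_dotL.
by rewrite [hilb_dot 0 z](inner_0l (@innerL V)) addr0.
Qed.
Let dotZr' z : scalable_for (@Num.conj C \; *%R) (hilb_dot z).
Proof.
move=> a x; rewrite /= -[a *: x]addr0 hilb_dotR.
by rewrite [hilb_dot z 0](inner_0r (@innerL V) (@innerC V)) addr0.
Qed.
Let dotherm x y : hilb_dot x y = (-1) ^+ false * (hilb_dot y x)^*.
Proof. by rewrite expr0 mul1r [LHS]innerC. Qed.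
Let dotpos (u : hilb) : u != 0 -> 0 < hilb_dot u u.
Proof. exact: inner_pos. Qed.

HB.instance Definition _ := isBilinear.Build C hilb hilb C *%R (@Num.conj C \; *%R)
  hilb_dot dotBl dotBr dotZl' dotZr'.
HB.instance Definition _ := isHermitianSesquilinear.Build C hilb false (@Num.conj C)
  hilb_dot dotherm.
HB.instance Definition _ := isDotProduct.Build C hilb hilb_dot dotpos.

Let hilb_dot_norm (x : hilb) : hilb_dot x x = `|x| ^+ 2.
Proof. by rewrite hilb_normE sqrtCK. Qed.

HB.instance Definition _ := CompleteNormedModule_isHilbert.Build R hilb
  hilb_dot_norm.

End InnerSpace.

(** * Finite direct powers of a Hilbert space *)

Section Power.
Context {R : realType}.
Local Notation C := (complex R).
Variables (I : finType) (H : hilbertType R).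

Definition pow_inner (x y : I -> H) : C := \sum_i dotH (x i) (y i).

Lemma pow_innerL a (x y z : I -> H) :
  pow_inner (a *: x + y) z = a * pow_inner x z + pow_inner y z.
Proof.
rewrite /pow_inner mulr_sumr -big_split; apply: eq_bigr => i _ /=.
by rewrite !fctE dotDl dotZl.
Qed.

Lemma pow_innerC (x y : I -> H) : pow_inner x y = (pow_inner y x)^*.
Proof. by rewrite /pow_inner rmorph_sum; apply: eq_bigr => i _; exact: dotC. Qed.

Lemma pow_inner_pos (x : I -> H) : x != 0 -> 0 < pow_inner x x.
Proof.
move=> x0; rewrite lt_def sumr_ge0 ?andbT; last by move=> *; exact: dot_ge0.
apply: contra x0; rewrite psumr_eq0; last by move=> *; exact: dot_ge0.
move=> /allP h; apply/eqP/funext => i.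
have := h i (mem_index_enum i); by rewrite implyTb dotH_norm sqrf_eq0 normr_eq0 => /eqP.
Qed.

Lemma pow_inner_coord (x : I -> H) (e : C) i :
  0 < e -> pow_inner x x <= e ^+ 2 -> `|x i| <= e.
Proof.
move=> e0 h; rewrite -ler_sqr ?nnegrE ?(ltW e0)//; apply: le_trans h.
rewrite /pow_inner (bigD1 i)//= dotH_norm lerDl sumr_ge0// => j _.
Qed.

Lemma pow_inner_complete (u : nat -> I -> H) :
    (forall e : C, 0 < e -> exists N, forall m n, (N <= m)%N -> (N <= n)%N ->
      pow_inner (u m - u n) (u m - u n) <= e ^+ 2) ->
    exists l, forall e : C, 0 < e -> exists N, forall n, (N <= n)%N ->
      pow_inner (u n - l) (u n - l) <= e ^+ 2.
Proof.
move=> hu.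
have /choice[l hl] : forall i, exists l, forall e : C, 0 < e ->
  exists N, forall n, (N <= n)%N -> `|u n i - l| <= e.
  move=> i; apply: hilbert_complete => e e0; have [N hN] := hu e e0.
  by exists N => m n hm hn; exact: (pow_inner_coord i e0 (hN m n hm hn)).
(* The successor keeps [c] positive when [I] is empty; each coordinate may err by [e / c], and
   [c (e / c)^2 <= e^2] since [1 <= c]. *)
exists l => e e0; set c := (#|I|.+1%:R : C).
have c0 : 0 < c by rewrite ltr0n.
have /choice[N hN] : forall i, exists N, forall n, (N <= n)%N -> `|u n i - l i| <= e / c.
  by move=> i; apply: hl; rewrite divr_gt0.
exists (\max_i N i) => n hn.
apply: (@le_trans _ _ (\sum_(i : I) (e / c) ^+ 2)).
  apply: ler_sum => i _; rewrite dotH_norm ler_sqr ?nnegrE ?divr_ge0 ?(ltW e0) ?(ltW c0)//.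
  by apply: hN; apply: leq_trans hn; exact: leq_bigmax.
rewrite sumr_const -mulr_natl expr_div_n mulrCA ger_pMr ?exprn_gt0//.
rewrite ler_pdivrMr ?exprn_gt0// mul1r (le_trans (_ : _ <= c))//.
  by rewrite ler_nat.
by rewrite expr2 ler_peMl ?(ltW c0)// ler1n.
Qed.

Definition hpow : hilbertType R :=
  hilb (InnerSpace pow_innerL pow_innerC pow_inner_pos pow_inner_complete).

Lemma hpow_dot (x y : hpow) : dotH x y = \sum_i dotH (x i) (y i).
Proof. by []. Qed.

Definition hout (i : I) (x : hpow) : H := x i.
Definition hin (i : I) (x : H) : hpow := fun j => if j == i then x else 0.

Lemma houtK i j x : hout i (hin j x) = if i == j then x else 0. Proof. by []. Qed.

Lemma hpow_sum (x : hpow) : x = \sum_i hin i (hout i x).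
Proof.
apply: (@dot_inj _ _ x) => y; rewrite dot_suml hpow_dot; apply: eq_bigr => i _.
rewrite hpow_dot (bigD1 i)//= big1 ?addr0; last first.
  by move=> j ji; rewrite /hin (negPf ji) dot0l.
by rewrite /hin eqxx.
Qed.

Lemma hin_out_dot i x y : dotH (hin i x) y = dotH x (hout i y).
Proof.
rewrite hpow_dot (bigD1 i)//= big1 ?addr0; last first.
  by move=> j ji; rewrite /hin (negPf ji) dot0l.
by rewrite /hin eqxx.
Qed.

Lemma hin_lin i : linear (hin i).
Proof.
by move=> a x y; apply: dot_inj => z; rewrite !(dotDl, dotZl, hin_out_dot).
Qed.

Lemma bop_hin i : bounded_op (hin i).
Proof.
apply/bounded_opP; split; first exact: hin_lin.
exists 1 => // x; rewrite mul1r -ler_sqr ?nnegrE// -!dotH_norm hin_out_dot houtK eqxx.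
exact: lexx.
Qed.

Lemma adj_hin i : adj (hin i) = hout i.
Proof. by apply: adj_unique => x y; exact: hin_out_dot. Qed.

Lemma bop_hout i : bounded_op (hout i).
Proof. by rewrite -adj_hin; apply: bop_adj; exact: bop_hin. Qed.

Lemma adj_hout i : adj (hout i) = hin i.
Proof. by rewrite -adj_hin adjK//; exact: bop_hin. Qed.

End Power.

Section SubType.
Context {R : realType}.
Local Notation C := (complex R).
Variables (V : lmodType C) (P : {pred V}) (hP : submod_closed P).
(* The closure proof is a phantom parameter: the module structure depends on it. *)
Definition subsp (_ : submod_closed P) : Type := {x : V | P x}.
HB.instance Definition _ := SubType.copy (subsp hP) {x : V | P x}.
HB.instance Definition _ := [Choice of subsp hP by <:].
HB.instance Definition _ := GRing.SubChoice_isSubLmodule.Build C V P (subsp hP)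
  (GRing.submod_closed_semi hP).
End SubType.

(** * Closed subspaces with an equivalent inner product *)

Section Weighted.
Context {R : realType}.
Local Notation C := (complex R).
Variables (H : hilbertType R) (P : H -> Prop) (B : H -> H -> C) (c d : C).
Hypotheses (P0 : P 0) (PL : forall a x y, P x -> P y -> P (a *: x + y))
  (Pclosed : forall x, (forall e : C, 0 < e -> exists2 y, P y & `|x - y| <= e) -> P x)
  (BL : forall a x y z, B (a *: x + y) z = a * B x z + B y z)
  (BC : forall x y, B x y = (B y x)^*)
  (c0 : 0 < c) (d0 : 0 < d)
  (Blow : forall x, P x -> `|x| ^+ 2 <= c ^+ 2 * B x x)
  (Bup : forall x, B x x <= d ^+ 2 * `|x| ^+ 2).

Let p : {pred H} := [pred x | `[< P x >]].
Let p_closed : submod_closed p.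
Proof.
split; first exact/asboolP.
by move=> a x y /asboolP Px /asboolP Py; apply/asboolP; exact: PL.
Qed.
Let W := subsp p_closed.
Let PW (x : W) : P (val x). Proof. exact/asboolP/(valP x). Qed.

Let inn (x y : W) := B (val x) (val y).

Let innL a x y z : inn (a *: x + y) z = a * inn x z + inn y z.
Proof. exact: BL. Qed.
Let innC x y : inn x y = (inn y x)^*. Proof. exact: BC. Qed.
Let inn_pos x : x != 0 -> 0 < inn x x.
Proof.
move=> x0; have : 0 < `|val x| ^+ 2.
  by rewrite exprn_gt0// normr_gt0; apply: contra x0 => /eqP h; apply/eqP/val_inj.
by move/lt_le_trans => /(_ _ (Blow (PW x))); rewrite pmulr_rgt0// exprn_gt0.
Qed.

Let inn_complete (u : nat -> W) :
    (forall e : C, 0 < e -> exists N, forall m n, (N <= m)%N -> (N <= n)%N ->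
      inn (u m - u n) (u m - u n) <= e ^+ 2) ->
    exists l, forall e : C, 0 < e -> exists N, forall n, (N <= n)%N ->
      inn (u n - l) (u n - l) <= e ^+ 2.
Proof.
move=> hu.
have [l hl] : exists l : H, forall e : C, 0 < e -> exists N, forall n, (N <= n)%N ->
  `|val (u n) - l| <= e.
  apply: hilbert_complete => e e0; have [N hN] := hu (e / c) (divr_gt0 e0 c0).
  exists N => m n hm hn; rewrite -ler_sqr ?nnegrE ?(ltW e0)//.
  have := Blow (PW (u m - u n)); rewrite [val _]/= => /le_trans; apply.
  by rewrite mulrC -ler_pdivlMr ?exprn_gt0// -expr_div_n; exact: hN.
have Pl : P l.
  apply: Pclosed => e e0; have [N hN] := hl e e0; exists (val (u N)) => //.
  by rewrite distrC hN.
exists (Sub l (introT (asboolP _) Pl) : W) => e e0.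
have [N hN] := hl (e / d) (divr_gt0 e0 d0); exists N => n hn.
apply: le_trans (Bup _) _; rewrite -exprMn ler_sqr ?nnegrE ?mulr_ge0 ?(ltW e0) ?(ltW d0)//.
by rewrite mulrC -ler_pdivlMr//; exact: hN.
Qed.

(** On [P] the form [B] is equivalent to the square of the given norm: [Blow] makes it definite and
    turns its Cauchy sequences into Cauchy sequences of [H], [Pclosed] keeps their limits in [P],
    and [Bup] returns convergence for [B]. *)
Lemma weighted_space : exists (K : hilbertType R) (i : K -> H),
  [/\ linear i, forall x, P (i x), forall y, P y -> exists x, i x = y,
      forall x y, dotH x y = B (i x) (i y) & injective i].
Proof.
exists (hilb (InnerSpace innL innC inn_pos inn_complete)), (fun x => val (x : W)).
split=> //.
by move=> y Py; exists (Sub y (introT (asboolP _) Py) : W).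
Qed.

End Weighted.

(** * Completely positive maps *)

Section CPMaps.
Context {R : realType}.
Local Notation C := (complex R).
Implicit Types (H K L M : hilbertType R).

Section LinearOn.
Context {H K : hilbertType R} {S : set (H -> H)} {phi : (H -> H) -> (K -> K)}.
Hypotheses (lS : lin_subspace S) (lp : linear_on S phi).
Lemma lo0 : phi 0 = 0.
Proof.
have := lp (-1) (ls0 lS) (ls0 lS).
by rewrite scaler0 addr0 scaleN1r addNr.
Qed.
Lemma loD f g : S f -> S g -> phi (f + g) = phi f + phi g.
Proof. by move=> Sf Sg; rewrite -[f]scale1r lp// !scale1r. Qed.
Lemma loZ a f : S f -> phi (a *: f) = a *: phi f.
Proof. by move=> Sf; rewrite -[a *: f]addr0 lp ?lo0 ?addr0//; exact: ls0 lS. Qed.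
Lemma loB f g : S f -> S g -> phi (f - g) = phi f - phi g.
Proof.
move=> Sf Sg; rewrite -scaleN1r addrC lp// scaleN1r addrC//.
Qed.
Lemma lo_sum I (r : seq I) (P : pred I) (F : I -> H -> H) :
  (forall i, P i -> S (F i)) ->
  phi (\sum_(i <- r | P i) F i) = \sum_(i <- r | P i) phi (F i).
Proof.
move=> SF; suff [] : S (\sum_(i <- r | P i) F i) /\
    phi (\sum_(i <- r | P i) F i) = \sum_(i <- r | P i) phi (F i) by [].
elim/big_rec2: _ => [|i a b Pi [Sb <-]]; first by rewrite lo0; split=> //; exact: ls0 lS.
by split; [apply: (lsD lS) => //; exact: SF | rewrite loD//; exact: SF].
Qed.
End LinearOn.

Lemma os_bop H (S : set (H -> H)) : operator_system S -> S `<=` bounded_op.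
Proof. by case. Qed.
Lemma os_sub H (S : set (H -> H)) : operator_system S -> lin_subspace S.
Proof. by case. Qed.
Lemma os_adj H (S : set (H -> H)) f : operator_system S -> S f -> S (adj f).
Proof. by case=> _ _ h _; exact: h. Qed.
Lemma os_id H (S : set (H -> H)) : operator_system S -> S idfun.
Proof. by case. Qed.

Lemma cp_mapW H K (S : set (H -> H)) (T T' : set (K -> K)) phi :
  T `<=` T' -> cp_map S T phi -> cp_map S T' phi.
Proof. by move=> TT [l m p]; split=> // f Sf; apply: TT; exact: m. Qed.

(** A bound [c] of [f] makes the kernel with [c] on the diagonal and [f], [adj f] off it positive;
    its image is positive, hence hermitian. *)
Lemma cp_adj H K (S : set (H -> H)) phi f : operator_system S ->
  @cp_map R H K S bounded_op phi -> S f -> phi (adj f) = adj (phi f).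
Proof.
move=> oS cp Sf; have bf := os_bop oS Sf; have [c c0 hc] := bop_bound bf.
have SA (i j : bool) : S (if i == j then c *: idfun else if i then f else adj f).
  case: eqP => _; first by apply: lsZ (os_sub oS) _ _ (os_id oS).
  by case: i => //; exact: os_adj.
have := cp_kpos (os_bop oS) (@subset_refl _ _) cp SA (bound_kpos c0 bf hc).
move=> /kpos_adjoint h; apply/esym/adj_unique; apply: h => i j.
by case: cp => _ h _; apply/bop_lin/h.
Qed.

Lemma ucp_bound H K (S : set (H -> H)) phi f (c : C) : operator_system S ->
  @ucp_map R H K S bounded_op phi -> S f -> 0 < c ->
  (forall x, `|f x| <= c * `|x|) -> forall x, `|phi f x| <= c * `|x|.
Proof.
move=> oS [cp u] Sf c0 hc; have bf := os_bop oS Sf.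
have SA (i j : bool) : S (if i == j then c *: idfun else if i then f else adj f).
  case: eqP => _; first by apply: lsZ (os_sub oS) _ _ (os_id oS).
  by case: i => //; exact: os_adj.
have := cp_kpos (os_bop oS) (@subset_refl _ _) cp SA (bound_kpos c0 bf hc).
case: (cp) => lp mp _ h; apply: (@kpos_bound _ _ c (phi f) (phi (adj f))) => //.
- by apply: bop_lin; exact: mp.
- by apply: bop_lin; apply: mp; exact: os_adj.
- apply: kpos_eq h => -[] [] //=; by rewrite (loZ (os_sub oS) lp) ?u//; exact: os_id.
Qed.

Lemma ge0_closed (z : C) :
  (forall e : C, 0 < e -> exists2 w, 0 <= w & `|z - w| <= e) -> 0 <= z.
Proof.
move=> h; suff -> : z = `|z| by [].
apply/eqP; rewrite -subr_eq0 -normr_eq0 eq_le normr_ge0 andbT.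
apply: ler_approx => e e0; rewrite add0r (splitr e).
have [w w0 zw] := h _ (divr_gt0 e0 (ltr0Sn C 1)).
rewrite (_ : z - `|z| = (z - w) + (w - `|z|)); last by rewrite addrA subrK.
apply: le_trans (ler_normD _ _) _; apply: lerD => //.
rewrite -{1}(ger0_norm w0); apply: le_trans (ler_dist_dist _ _) _.
by rewrite distrC.
Qed.

Lemma op_eq_approx H K (f g : H -> K) :
  (forall e : C, 0 < e -> forall x, `|f x - g x| <= e * `|x|) -> f = g.
Proof.
move=> h; apply/funext => x; apply/eqP; rewrite -subr_eq0 -normr_eq0.
rewrite eq_le normr_ge0 andbT; apply: ler_approx => e e0; rewrite add0r.
have x1 : 0 < `|x| + 1 by rewrite ltr_wpDl.
apply: le_trans (h (e / (`|x| + 1)) (divr_gt0 e0 x1) x) _.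
by rewrite mulrAC ler_pdivrMr// ler_pM2l// lerDl.
Qed.

Lemma ler_norm_trans (V : normedZmodType C) (x y z : V) (a b : C) :
  `|x - y| <= a -> `|y - z| <= b -> `|x - z| <= a + b.
Proof.
move=> xy yz; rewrite (_ : x - z = (x - y) + (y - z)); last by rewrite addrA subrK.
by apply: le_trans (ler_normD _ _) _; exact: lerD.
Qed.

Lemma sum_dot_bound H (I : finType) (G : I -> I -> H) (x : I -> H) (d : C) : 0 <= d ->
  (forall i j, `|G i j| <= d * `|x j|) ->
  `|\sum_i \sum_j dotH (G i j) (x i)| <= d * (#|I|%:R * \sum_i `|x i| ^+ 2).
Proof.
move=> d0 h.
(* From [2 |x_i| |x_j| <= |x_i|^2 + |x_j|^2]; summation over the other index produces the factor
   [#|I|]. *)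
apply: (@le_trans _ _ (\sum_i \sum_j d / 2 * (`|x i| ^+ 2 + `|x j| ^+ 2))).
  apply: le_trans (ler_norm_sum _ _ _) _; apply: ler_sum => i _.
  apply: le_trans (ler_norm_sum _ _ _) _; apply: ler_sum => j _.
  apply: le_trans (Cauchy_Schwarz _ _) _.
  apply: le_trans (ler_wpM2r _ (h i j)) _ => //.
  rewrite -subr_ge0 (_ : _ - _ = d / 2 * (`|x i| - `|x j|) ^+ 2); last by field.
  by rewrite mulr_ge0 ?divr_ge0// real_exprn_even_ge0// rpredB// ger0_real.
rewrite le_eqVlt; apply/orP; left; apply/eqP.
set N := \sum_i `|x i| ^+ 2.
transitivity (\sum_i d / 2 * (`|x i| ^+ 2 *+ #|I| + N)).
  by apply: eq_bigr => i _; rewrite -mulr_sumr big_split sumr_const.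
have s1 : \sum_i (`|x i| ^+ 2 *+ #|I|) = N *+ #|I| by rewrite sumrMnl.
have s2 : \sum_(i : I) N = N *+ #|I| by rewrite sumr_const.
by rewrite -mulr_sumr big_split s1 s2 mulr_natl /=; field.
Qed.

Lemma real_norm_ge0 (r s : C) : r \is Num.real -> `|r| <= s -> 0 <= r + s.
Proof.
move=> rr rs; have : 0 <= r + `|r|.
  by rewrite -lerBlDr sub0r -[X in X <= _]opprK lerNl opprK -normrN real_ler_norm// rpredN.
by move/le_trans; apply; rewrite lerD2l.
Qed.

(** * Extension of unital completely positive maps to the norm closure *)

Section Extension.
Context {H K : hilbertType R} {S : set (H -> H)} {phi : (H -> H) -> (K -> K)}.
Hypotheses (oS : operator_system S) (up : ucp_map S bounded_op phi).

Let near (f g : H -> H) (e : C) := forall x, `|f x - g x| <= e * `|x|.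
Let near' (f g : K -> K) (e : C) := forall x, `|f x - g x| <= e * `|x|.

Let phi_near f g e : S f -> S g -> 0 < e -> near f g e -> near' (phi f) (phi g) e.
Proof.
move=> Sf Sg e0 h x; have [[lp _ _] _] := up.
have -> : phi f x - phi g x = phi (f - g) x by rewrite (loB lp).
by apply: (ucp_bound oS up) => //; exact: lsB (os_sub oS) _ _ _ _.
Qed.

(** The value at [f] is the limit of [phi] along approximants of [f]. Recording the estimate against
    every approximant [g] and every [e] frees it from the chosen sequence, and linearity and
    agreement on [S] follow from it. *)
Let ext_ex f : exists l, op_closure S f -> bounded_op l /\
  forall e g, 0 < e -> S g -> near f g e -> near' l (phi g) e.
Proof.
case: (pselect (op_closure S f)) => [[bf hf]|?]; last by exists idfun.
have /choice[g hg] : forall n, exists g, S g /\ near f g (n.+1%:R^-1).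
  move=> n; have [|g Sg fg] := hf (n.+1%:R^-1); first by rewrite invr_gt0 ltr0n.
  by exists g.
have gg m n : near (g m) (g n) (m.+1%:R^-1 + n.+1%:R^-1).
  move=> x; rewrite mulrDl; apply: ler_norm_trans (f x) _ _ _ _ _; last exact: (hg n).2.
  by rewrite distrC; exact: (hg m).2.
have [n||l bl hl] := @op_complete _ _ _ (phi \o g).
- by case: up => -[_ h _ _]; apply: h; exact: (hg n).1.
- move=> e e0; have [N hN] := inv_nat_small (divr_gt0 e0 (ltr0Sn C 1)).
  exists N => m n hm hn; apply: phi_near => //; [exact: (hg m).1|exact: (hg n).1|].
  move=> x; apply: le_trans (gg m n x) _; rewrite ler_wpM2r// (splitr e).
  by apply: lerD; exact: hN.
exists l => _; split=> // e h e0 Sh fh x.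
apply: ler_approx => d d0; have x1 : 0 < `|x| + 1 by rewrite ltr_wpDl.
pose d' := d / 2 / (`|x| + 1); have d'0 : 0 < d' by rewrite !divr_gt0.
have [N hN] := inv_nat_small d'0; have [M hM] := hl d' d'0.
pose n := maxn N M.
have h1 : near' (phi (g n)) (phi h) (d' + e).
  apply: phi_near => //; [exact: (hg n).1 | exact: addr_gt0|] => y.
  rewrite mulrDl; apply: (ler_norm_trans _ (fh y)); rewrite distrC.
  apply: le_trans ((hg n).2 y) _; rewrite ler_wpM2r//.
  exact: hN (leq_maxl _ _).
have h2 := hM n (leq_maxr _ _) x; rewrite distrC in h2.
apply: le_trans (ler_norm_trans h2 (h1 x)) _.
rewrite mulrDl addrA addrC lerD2l.
have -> : d = d' * (`|x| + 1) + d' * (`|x| + 1).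
  by rewrite /d' divfK ?gt_eqF// -splitr.
by rewrite lerD// ler_pM2l// lerDl.
Qed.

(** The delicate point is complete positivity: approximants in [S] of the entries of a positive
    matrix need not form a positive matrix. They are made hermitian and then shifted by a small
    multiple of the unit. *)
Lemma ucp_extension : exists phi' : (H -> H) -> (K -> K),
  [/\ ucp_map (op_closure S) bounded_op phi',
      forall f, S f -> phi' f = phi f,
      forall f, op_closure S f -> op_closure (phi @` S) (phi' f) &
      forall e f g, 0 < e -> op_closure S f -> S g -> (forall x, `|f x - g x| <= e * `|x|) ->
         forall x, `|phi' f x - phi g x| <= e * `|x|].
Proof.
have [phi' hp] := choice ext_ex.
have bS := os_bop oS; have lS := os_sub oS; have [[lp mp pp] up1] := up.
have agree f : S f -> phi' f = phi f.
  move=> Sf; have [_ h] := hp f (sub_closure bS Sf).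
  apply: op_eq_approx => e e0; apply: h => // x.
  by rewrite subrr normr0 mulr_ge0// ltW.
have lin : linear_on (op_closure S) phi'.
  move=> a f g Sf Sg; apply: op_eq_approx => e e0 x.
  have a1 : 0 < `|a| + 1 by rewrite ltr_wpDl.
  pose d := e / 2 / (`|a| + 1); have d0 : 0 < d by rewrite !divr_gt0.
  have [f' Sf' ff] := Sf.2 d d0; have [g' Sg' gg] := Sg.2 d d0.
  have hZD (L : hilbertType R) (u u' v v' : L) y : `|u - u'| <= d * y -> `|v - v'| <= d * y ->
      `|(a *: u + v) - (a *: u' + v')| <= e / 2 * y.
    move=> hu hv; rewrite opprD addrACA -scalerBr; apply: le_trans (ler_normD _ _) _.
    rewrite normrZ; apply: le_trans (lerD (ler_wpM2l (normr_ge0 _) hu) hv) _.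
    have -> : e / 2 = d * (`|a| + 1) by rewrite /d divfK ?gt_eqF.
    by rewrite mulrDr mulr1 mulrDl lerD2r mulrCA mulrA.
  have [_ /(_ (e / 2) (a *: f' + g')) h] := hp _ (lsZD (closure_sub bS lS) a Sf Sg).
  have {}h := h (divr_gt0 e0 (ltr0Sn C 1)) (lsZD lS a Sf' Sg')
     (fun x => hZD _ _ _ _ _ _ (ff x) (gg x)) x.
  rewrite (splitr e) mulrDl; apply: (ler_norm_trans h).
  rewrite lp// distrC; apply: hZD; first exact: (hp f Sf).2.
  exact: (hp g Sg).2.
exists phi'; split=> //; last first.
- by move=> e f g e0 Sf Sg; exact: (hp f Sf).2.
- move=> f Sf; split=> [|e e0]; first exact: (hp f Sf).1.
  have [g Sg fg] := Sf.2 e e0; exists (phi g); first by exists g.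
  exact: (hp f Sf).2.
split; last by rewrite agree//; exact: os_id.
split=> // [f Sf|n A SA pA]; first exact: (hp f Sf).1.
move=> x; apply: ge0_closed => e e0.
pose N := \sum_i `|x i| ^+ 2; have N0 : 0 <= N by apply: sumr_ge0 => *; rewrite exprn_ge0.
(* Replacing [A] by its approximant and adding the diagonal shift each cost at most [d n N]; the
   added 1 keeps [c] positive when [n N = 0]. *)
pose c := 2 * (n%:R * N) + 1; have c0 : 0 < c by rewrite ltr_wpDl// !mulr_ge0.
pose d := e / c; have d0 : 0 < d by rewrite divr_gt0.
have /choice[B hB] : forall p : 'I_n * 'I_n, exists g, S g /\ near (A p.1 p.2) g d.
  by move=> p; have [g Sg h] := (SA p.1 p.2).2 d d0; exists g.
have hermA i j : A i j = adj (A j i).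
  apply/esym/adj_unique.
  have lA (k l : 'I_n) : linear (A k l) by apply: bop_lin; exact: (SA k l).1.
  have := kpos_pull (fun b : bool => if b then j else i) lA pA.
  by move/kpos_adjoint; apply=> *; exact: lA.
(* The approximants [B] need not be hermitian; averaging with the adjoints stays within [d] of [A],
   because [A] is hermitian. *)
have [D [SD AD hermD]] : exists D : 'I_n -> 'I_n -> H -> H,
    [/\ forall i j, S (D i j), forall i j, near (A i j) (D i j) d &
        forall i j, D i j = adj (D j i)].
  exists (fun i j => 2^-1 *: (B (i, j) + adj (B (j, i)))).
  have Sb i j : S (B (i, j)) := (hB (i, j)).1.
  have Sb' i j : S (adj (B (i, j))) := os_adj oS (Sb i j).
  have bb i j := bS _ (Sb i j); have bb' i j := bS _ (Sb' i j).
  split=> [i j|i j y|i j].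
  - by apply: (lsZ lS); apply: (lsD lS).
  - rewrite !fctE.
    have -> : A i j y - 2^-1 *: (B (i, j) y + adj (B (j, i)) y) =
      2^-1 *: ((A i j y - B (i, j) y) + (A i j y - adj (B (j, i)) y)).
      rewrite addrACA -opprD [RHS]scalerBr; congr (_ - _).
      have -> : A i j y + A i j y = 2%:R *: A i j y by rewrite scaler_nat mulr2n.
      by rewrite scalerA mulVf ?pnatr_eq0// scale1r.
    rewrite normrZ ger0_norm ?invr_ge0// ler_pdivrMl//.
    apply: le_trans (ler_normD _ _) _; rewrite mulrDl mul1r; apply: lerD;
      first exact: (hB (i, j)).2.
    have -> : A i j y - adj (B (j, i)) y = adj (A j i - B (j, i)) y.
      by rewrite adjB//; [rewrite -hermA|exact: (SA j i).1].
    apply: adj_bound (ltW d0) _ _; last exact: (hB (j, i)).2.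
    by apply: (lsB (bop_sub _ _)) => //; exact: (SA j i).1.
  - rewrite adjZ; last by apply: (lsD (bop_sub _ _)).
    by rewrite adjD// adjK// addrC fmorphV rmorph_nat.
(* By [sum_dot_bound] the shift [n d] outweighs the form of [D - A]; hermitian entries make that
   form real, so that the bound decides the sign. *)
have pD : kpos (fun i j => D i j + (if i == j then n%:R * d else 0) *: idfun).
  move=> y; pose M := \sum_i `|y i| ^+ 2.
  pose Z := \sum_i \sum_j dotH (D i j (y j)) (y i).
  have -> : \sum_i \sum_j dotH ((D i j + (if i == j then n%:R * d else 0) *: idfun) (y j)) (y i)
    = Z + d * (n%:R * M).
    transitivity (\sum_i (\sum_j dotH (D i j (y j)) (y i) + n%:R * d * `|y i| ^+ 2)).
      apply: eq_bigr => i _.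
      transitivity (\sum_j (dotH (D i j (y j)) (y i) + (if i == j then n%:R * d else 0) * dotH
        (y j) (y i))).
        by apply: eq_bigr => j _; rewrite !fctE dotDl dotZl.
      rewrite big_split; congr (_ + _); rewrite (bigD1 i)//= eqxx dotH_norm.
      by rewrite big1 ?addr0// => j ji; rewrite eq_sym (negPf ji) mul0r.
    by rewrite big_split -mulr_sumr /=; congr (_ + _); rewrite mulrAC [_ * d]mulrC.
  have Zr : Z \is Num.real.
    apply/CrealP; rewrite /Z rmorph_sum exchange_big; apply: eq_bigr => i _.
    rewrite rmorph_sum; apply: eq_bigr => j _ /=; rewrite -dotC.
    rewrite [D i j]hermD. by rewrite -adjP//; apply: bS.
  pose ZA := \sum_i \sum_j dotH (A i j (y j)) (y i).
  have ZA0 : 0 <= ZA := pA y.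
  have -> : Z + d * (n%:R * M) = ZA + ((Z - ZA) + d * (n%:R * M)) by rewrite addrA addrCA subrr
    addr0.
  apply: addr_ge0 => //; apply: real_norm_ge0; first by rewrite rpredB// ger0_real.
  rewrite distrC /Z /ZA -sumrB.
  under eq_bigr do rewrite -sumrB.
  under eq_bigr do under eq_bigr do rewrite -dotNl -dotDl.
  rewrite /M -[n in n%:R]card_ord; apply: sum_dot_bound; first exact: ltW.
  by move=> i j; exact: AD.
pose D' i j := D i j + (if i == j then n%:R * d else 0) *: idfun.
have SD' i j : S (D' i j).
  by apply: (lsD lS) => //; apply: (lsZ lS); exact: os_id.
have := cp_kpos bS (@subset_refl _ _) up.1 SD' pD.
move=> /(_ x) hw; exists (\sum_i \sum_j dotH (phi (D' i j) (x j)) (x i)) => //.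
pose G i j := phi' (A i j) (x j) - phi (D i j) (x j).
have -> : \sum_i \sum_j dotH (map_mx phi' A i j (x j)) (x i) -
    \sum_i \sum_j dotH (phi (D' i j) (x j)) (x i) =
    \sum_i \sum_j dotH (G i j) (x i) - d * (n%:R * N).
  rewrite /N mulrA [d * _]mulrC mulr_sumr -!sumrB; apply: eq_bigr => i _ /=.
  have -> : n%:R * d * `|x i| ^+ 2 = \sum_j (if i == j then n%:R * d else 0) * dotH (x j) (x i).
    rewrite (bigD1 i)//= eqxx dotH_norm.
    by rewrite big1 ?addr0// => j ji; rewrite eq_sym (negPf ji) mul0r.
  rewrite -!sumrB; apply: eq_bigr => j _.
  rewrite mxE /G /D' (loD lp)//; last by apply: (lsZ lS); exact: os_id.
  rewrite (loZ lS lp); last exact: os_id.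
  by rewrite up1 !fctE !dotDl dotNl dotZl opprD addrA.
have NN := ger0_norm (mulr_ge0 (ltW d0) (mulr_ge0 (ler0n C n) N0)).
apply: le_trans (ler_normB _ _) _; rewrite NN.
apply: (@le_trans _ _ (d * (n%:R * N) + d * (n%:R * N))).
  rewrite lerD2r /N -[n in n%:R]card_ord; apply: sum_dot_bound; first exact: ltW.
  by move=> i j; exact: (hp _ (SA i j)).2.
have -> : d * (n%:R * N) + d * (n%:R * N) = d * (2 * (n%:R * N)) by ring.
by rewrite /d mulrAC ler_pdivrMr// ler_pM2l// /c lerDl.
Qed.
End Extension.
End CPMaps.

(** * Multipliers in the injective envelope *)

Section Envelope.
Context {R : realType}.
Local Notation C := (complex R).
Variables (H L : hilbertType R) (S : set (H -> H)) (E : set (L -> L))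
  (kappa : (H -> H) -> (L -> L)).
Hypotheses (oS : operator_system S) (hE : injective_envelope S E kappa).

Lemma env_os : operator_system E. Proof. by case: hE => -[]. Qed.
Lemma env_mul f g : E f -> E g -> E (f \o g). Proof. by case: hE => -[_ h _] *; exact: h. Qed.
Lemma env_coe : unital_complete_order_embedding S kappa. Proof. by case: hE. Qed.
Lemma env_sub s : S s -> E (kappa s).
Proof. by case: hE => _ _ _ h _ Ss; apply: h; exists s. Qed.
Lemma env_bop : E `<=` bounded_op. Proof. exact: os_bop env_os. Qed.
Lemma env_cp : cp_map S E kappa.
Proof. by case: env_coe => -[[l _ p] _] _ _; split=> //; exact: env_sub. Qed.
Lemma env_cpb : cp_map S bounded_op kappa.
Proof. by case: env_coe => -[]. Qed.
Lemma env_1 : kappa idfun = idfun. Proof. by case: env_coe => -[]. Qed.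
Lemma env_inj f g : S f -> S g -> kappa f = kappa g -> f = g.
Proof. by case: env_coe => _ h _; exact: h. Qed.
Lemma env_lin : linear_on S kappa. Proof. by case: env_cp. Qed.
Lemma env_adj f : S f -> kappa (adj f) = adj (kappa f).
Proof. exact: cp_adj oS env_cpb. Qed.

Definition env_inv (x : L -> L) : H -> H := xget 0 [set s | S s /\ kappa s = x].

Lemma env_invK s : S s -> env_inv (kappa s) = s.
Proof.
move=> Ss; rewrite /env_inv; case: xgetP => [_ -> [Sx kx]|/(_ s)[]//].
exact: env_inj.
Qed.

Lemma env_invP x : (kappa @` S) x -> S (env_inv x) /\ kappa (env_inv x) = x.
Proof. by case=> s Ss <-; rewrite env_invK. Qed.

Lemma env_inv_lin a x y : (kappa @` S) x -> (kappa @` S) y ->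
  env_inv (a *: x + y) = a *: env_inv x + env_inv y.
Proof.
move=> [s Ss <-] [t St <-]; rewrite -env_lin// !env_invK//.
exact: lsZD (os_sub oS) _ _ _ _ _.
Qed.

Lemma env_img_sub : lin_subspace (kappa @` S).
Proof.
split; first by exists 0; [exact: ls0 (os_sub oS)|rewrite (lo0 (os_sub oS) env_lin)].
move=> a _ _ [s Ss <-] [t St <-]; exists (a *: s + t); last exact: env_lin.
exact: lsZD (os_sub oS) _ _ _ _ _.
Qed.

(** * The off-diagonal criterion for multiplication *)

Section Corner.
Let L2 := hpow bool L.
Definition elem_mx (i j : bool) (w : L -> L) : L2 -> L2 := hin i \o w \o hout j.
Definition entry (X : L2 -> L2) (i j : bool) : L -> L := hout i \o X \o hin j.
Definition mx2 (F : set (L -> L)) : set (L2 -> L2) :=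
  [set X | bounded_op X /\ forall i j, F (entry X i j)].

Lemma entry_elem w i j k l : linear w ->
  entry (elem_mx i j w) k l = if (k == i) && (l == j) then w else 0.
Proof.
move=> lw; apply/funext => x; rewrite /entry /elem_mx /= !houtK.
rewrite [l == j]eq_sym; case: (k == i); case: (j == l) => //=.
exact: lin0 lw.
Qed.

Lemma entryZD a X Y i j : entry (a *: X + Y) i j = a *: entry X i j + entry Y i j.
Proof. by []. Qed.

Lemma entry_adj X i j : bounded_op X -> entry (adj X) i j = adj (entry X j i).
Proof.
move=> bX; have bo := @bop_hout R bool L j.
rewrite /entry adj_comp; [|by apply: bop_comp|exact: bop_hin].
by rewrite adj_comp// adj_hin adj_hout.
Qed.

Lemma mx2_os F : operator_system F -> operator_system (mx2 F).
Proof.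
move=> oF; have lF := os_sub oF; split.
- by move=> X [].
- split; first by split=> [|i j]; [exact: bop_0 | exact: ls0 lF].
  move=> a X Y [bX hX] [bY hY]; split; first exact: bop_ZD.
  by move=> i j; rewrite entryZD; apply: lsZD.
- move=> X [bX hX]; split=> [|i j]; first exact: bop_adj.
  by rewrite entry_adj//; apply: os_adj.
- split=> [|i j]; first exact: bop_id.
  have -> : entry idfun i j = if i == j then idfun else 0.
    by apply/funext => x; rewrite /entry /= houtK; case: eqP.
  by case: eqP => _; [exact: os_id | exact: ls0 lF].
Qed.

Lemma bop_elem i j w : bounded_op w -> bounded_op (elem_mx i j w).
Proof.
move=> bw; apply: bop_comp; last exact: bop_hout.
by apply: bop_comp => //; exact: bop_hin.
Qed.

Lemma mx2_elem F i j w : operator_system F -> F w -> mx2 F (elem_mx i j w).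
Proof.
move=> oF Fw; have bw := os_bop oF Fw; split; first exact: bop_elem.
move=> k l; rewrite entry_elem; last exact: bop_lin.
by case: ifP => // _; exact: ls0 (os_sub oF).
Qed.

Variables (th ta tb : (H -> H) -> (H -> H)).
Hypotheses (th_lin : linear_on S th) (ta_lin : linear_on S ta) (tb_lin : linear_on S tb)
  (th_S : forall s, S s -> S (th s)) (ta_S : forall s, S s -> S (ta s))
  (tb_S : forall s, S s -> S (tb s)).
Hypothesis (pos : forall (I : finType) (A : bool * I -> bool * I -> H -> H),
  (forall p q, S (A p q)) -> kpos A ->
  kpos (fun i j => th (A (true, i) (true, j)) + ta (A (true, i) (false, j)) +
     tb (A (false, i) (true, j)) + A (false, i) (false, j))).

(** The hypothesis [pos] makes this map on 2 by 2 matrices completely positive, with [true] as the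
    first row. It is defined on matrices over the image of [kappa], since injectivity of [E] extends
    it from there to matrices over [E]. *)
Let corner (X : L2 -> L2) : H -> H :=
  th (env_inv (entry X true true)) + ta (env_inv (entry X true false)) +
  tb (env_inv (entry X false true)) + env_inv (entry X false false).

Let cornerS X : mx2 (kappa @` S) X -> S (corner X).
Proof.
move=> [_ hX]; have SX i j : S (env_inv (entry X i j)) := (env_invP (hX i j)).1.
by do !apply: lsD (os_sub oS) _ _ _ _; auto.
Qed.

Let corner_cp : cp_map (mx2 (kappa @` S)) E (kappa \o corner).
Proof.
split.
- move=> a X Y hX hY; rewrite /= -env_lin; try exact: cornerS.
  have SX i j : S (env_inv (entry X i j)) := (env_invP (hX.2 i j)).1.
  have SY i j : S (env_inv (entry Y i j)) := (env_invP (hY.2 i j)).1.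
  congr kappa; rewrite /corner !entryZD !env_inv_lin; try exact: hX.2; try exact: hY.2.
  rewrite th_lin// ta_lin// tb_lin// !scalerDr.
  set x1 := a *: _; set x2 := a *: _; set x3 := a *: _; set x4 := a *: _.
  by rewrite (addrACA x1) (addrACA (x1 + x2)) (addrACA (x1 + x2 + x3)).
- by move=> X hX; apply: env_sub; exact: cornerS.
- move=> n A hA pA.
  (* A matrix of 2 by 2 matrices is flattened to the index [bool * 'I_n]; its positivity descends to
     [S] because [kappa] is a complete order embedding. *)
  pose B p q := env_inv (entry (A p.2 q.2) p.1 q.1).
  have SB p q : S (B p q) := (env_invP ((hA p.2 q.2).2 p.1 q.1)).1.
  have pB : kpos B.
    apply: (coe_kpos (os_bop oS) env_coe) => //.
    have := kpos_congr (fun p : bool * 'I_n => p.2) (fun p => @bop_hin R bool L p.1)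
      (fun i j => bop_lin (hA i j).1) pA.
    apply: kpos_eq => p q; rewrite /B (env_invP ((hA p.2 q.2).2 p.1 q.1)).2.
    by rewrite adj_hin.
  have := cp_kpos (os_bop oS) env_bop env_cp (fun i j => cornerS (hA i j)) (pos SB pB).
  by apply: kpos_eq => i j; rewrite mxE.
Qed.

(* By injectivity the map of [pos] extends to [Phi : M_2(E) -> E], and rigidity
   makes [Phi] the identity on the lower right corner; hence [Phi] is a module
   map on the off-diagonal corners.  No extension theorem for B(H) is needed. *)
Lemma multiplier_criterion s : S s ->
  kappa (ta s) = kappa (ta idfun) \o kappa s /\
  kappa (tb s) = kappa s \o kappa (tb idfun).
Proof.
move=> Ss.
have [_ [_ inj] _ _ rigid] := hE.
have oI : operator_system (kappa @` S).
  split; last by exists idfun; [exact: os_id | exact: env_1].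
  - by move=> _ [t St <-]; apply: env_bop; exact: env_sub.
  - exact: env_img_sub.
  - move=> _ [t St <-]; exists (adj t); first exact: os_adj.
    exact: env_adj.
have sub : mx2 (kappa @` S) `<=` mx2 E.
  by move=> X [bX hX]; split=> // i j; have [t St <-] := hX i j; exact: env_sub.
have [Phi cpP extP] := inj _ _ _ _ (mx2_os oI) (mx2_os env_os) sub corner_cp.
have PU i j t : S t -> Phi (elem_mx i j (kappa t)) = kappa (corner (elem_mx i j (kappa t))).
  by move=> St; apply: extP; apply: mx2_elem => //; exists t.
have lk t : S t -> linear (kappa t) by move=> St; apply/bop_lin/env_bop/env_sub.
have inv0 : env_inv 0 = 0.
  by rewrite -(lo0 (os_sub oS) env_lin) env_invK//; exact: ls0 (os_sub oS).
have th0 := lo0 (os_sub oS) th_lin; have ta0 := lo0 (os_sub oS) ta_lin.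
have tb0 := lo0 (os_sub oS) tb_lin.
have P22 w : E w -> Phi (elem_mx false false w) = w.
  apply: (rigid (fun w => Phi (elem_mx false false w))); last first.
    move=> t St; rewrite PU// /corner !(entry_elem _ _ _ _ (lk _ St)) /= inv0 env_invK//.
    by rewrite th0 ta0 tb0 !add0r.
  case: cpP => lP mP pP; split.
  - move=> a f g Ef Eg; rewrite -lP; try exact: mx2_elem env_os _.
    congr Phi; apply/funext => x; rewrite /elem_mx /= !fctE.
    exact: hin_lin.
  - by move=> f Ef; apply: mP; exact: mx2_elem env_os _.
  - move=> n A EA pA; have -> : map_mx (fun w => Phi (elem_mx false false w)) A = map_mx Phi
    (map_mx (elem_mx false false) A).
      by apply/matrixP => i j; rewrite !mxE.
    apply: pP => [i j|]; first by rewrite mxE; apply: mx2_elem env_os _; exact: EA.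
    have := kpos_congr id (fun _ : 'I_n => @bop_hout R bool L false) (fun i j => bop_lin
      (env_bop (EA i j))) pA.
    by apply: kpos_eq => i j; rewrite mxE adj_hout.
have gram r : E r ->
    Phi (elem_mx false true r) = r \o Phi (elem_mx false true idfun) /\
    Phi (elem_mx true false (adj r)) = Phi (elem_mx true false idfun) \o adj r.
  move=> Er; have br := env_bop Er; have Ear := os_adj env_os Er.
  (* The rows are [r^*] in the lower slot, 1 in the upper slot and 1 in the lower slot. Products of
     the first and the last lie in the lower right corner, where [P22] computes [Phi]; this yields
     the blocks that [kpos_schur] asks for. *)
  pose rows (q : option bool) : L2 -> L :=
    match q with Some true => adj r \o hout false | Some false => hout true | None => hout false
      end.
  have brows q : bounded_op (rows q).
    case: q => [[]|]; try exact: bop_hout.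
    by apply: bop_comp; [exact: bop_adj | exact: bop_hout].
  have E1 := os_id env_os.
  have arow : adj (rows (Some true)) = hin false \o r.
    by rewrite /= adj_comp ?adj_hout ?adjK//; [exact: bop_adj | exact: bop_hout].
  have Vrows p q : mx2 E (adj (rows p) \o rows q).
    case: p q => [[]|] [[]|]; rewrite ?arow /= ?adj_hout.
    + exact: (mx2_elem false false env_os (env_mul Er Ear)).
    + exact: (mx2_elem false true env_os Er).
    + exact: (mx2_elem false false env_os Er).
    + exact: (mx2_elem true false env_os Ear).
    + exact: (mx2_elem true true env_os E1).
    + exact: (mx2_elem true false env_os E1).
    + exact: (mx2_elem false false env_os Ear).
    + exact: (mx2_elem false true env_os E1).
    + exact: (mx2_elem false false env_os E1).
  have pG := cp_kpos (os_bop (mx2_os env_os)) env_bop cpP Vrows (kpos_gram brows).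
  have lG p q : linear (Phi (adj (rows p) \o rows q)).
    by apply/bop_lin/env_bop; case: cpP => _ mP _; apply: mP.
  have [||||] := kpos_schur lG pG br.
  - by rewrite arow; apply: (P22 (r \o adj r)); exact: env_mul.
  - by rewrite arow; apply: (P22 r).
  - by rewrite /= adj_hout; apply: (P22 (adj r)).
  - by rewrite /= adj_hout; apply: (P22 idfun).
  - by rewrite arow /= !adj_hout.
have cft t : S t -> corner (elem_mx false true (kappa t)) = tb t.
  move=> St; rewrite /corner !(entry_elem _ _ _ _ (lk _ St)) /= inv0 env_invK//.
  by rewrite th0 ta0 !(addr0, add0r).
have ctf t : S t -> corner (elem_mx true false (kappa t)) = ta t.
  move=> St; rewrite /corner !(entry_elem _ _ _ _ (lk _ St)) /= inv0 env_invK//.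
  by rewrite th0 tb0 !(addr0, add0r).
have S1 := os_id oS; split.
  have [_] := gram _ (env_sub (os_adj oS Ss)).
  by rewrite env_adj// (adjK (env_bop (env_sub Ss))) -{1}env_1 !PU// !ctf.
have [+ _] := gram _ (env_sub Ss).
by rewrite -{1}env_1 !PU// !cft.
Qed.
End Corner.
End Envelope.

(** * Isomorphisms of lattices of kernels *)

Section Lattices.
Context {R : realType}.
Implicit Types (H K L : hilbertType R).

Definition lat_map {H K} (A : set (set (H -> H))) (B : set (set (K -> K)))
    (F : set (H -> H) -> set (K -> K)) (G : set (K -> K) -> set (H -> H)) : Prop :=
  [/\ forall J, A J -> B (F J), forall J, A J -> G (F J) = J &
      forall J1 J2, A J1 -> A J2 -> F (J1 `&` J2) = F J1 `&` F J2].

Definition lat_iso {H K} (A : set (set (H -> H))) (B : set (set (K -> K))) : Prop :=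
  exists F G, lat_map A B F G /\ lat_map B A G F.

Lemma lat_iso_sym H K (A : set (set (H -> H))) (B : set (set (K -> K))) :
  lat_iso A B -> lat_iso B A.
Proof. by case=> F [G [? ?]]; exists G, F. Qed.

Lemma lat_map_trans H K L (A : set (set (H -> H))) (B : set (set (K -> K)))
    (D : set (set (L -> L))) F G F' G' :
  lat_map A B F G -> lat_map B D F' G' -> lat_map A D (F' \o F) (G \o G').
Proof.
move=> [m i c] [m' i' c']; split=> [J AJ|J AJ|J1 J2 A1 A2] /=; first by auto.
  by rewrite i' ?i//; exact: m.
by rewrite c// c'//; exact: m.
Qed.

Lemma lat_iso_trans H K L (A : set (set (H -> H))) (B : set (set (K -> K)))
    (D : set (set (L -> L))) : lat_iso A B -> lat_iso B D -> lat_iso A D.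
Proof.
move=> [F [G [h1 h2]]] [F' [G' [h3 h4]]]; exists (F' \o F), (G \o G').
by split; [exact: lat_map_trans h1 h3 | exact: lat_map_trans h4 h2].
Qed.

Lemma lat_map_le H K (A : set (set (H -> H))) (B : set (set (K -> K))) F G J1 J2 :
  lat_map A B F G -> A J1 -> A J2 -> J1 `<=` J2 -> F J1 `<=` F J2.
Proof. by move=> [_ _ c] A1 A2 /setIidPl h; apply/setIidPl; rewrite -c// h. Qed.

(* A bijection preserving binary intersections is monotone in both directions,
   so it also preserves the joins. *)
Lemma lat_iso_lattice H K (A : set (set (H -> H))) (B : set (set (K -> K))) :
  (forall J, A J -> J 0 /\ forall f g, J f -> J g -> J (f + g)) ->
  (forall J, B J -> J 0 /\ forall f g, J f -> J g -> J (f + g)) ->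
  lat_iso A B -> lattice_isomorphic A B.
Proof.
move=> hA hB [F [G [FG GF]]]; exists F.
have [mF iF cF] := FG; have [mG iG cG] := GF.
(* Since the members contain 0 and are closed under sums, containing [J1 + J2] means containing
   both, and joins become least upper bounds for inclusion. *)
have sub_sum L (D : set (set (L -> L))) J1 J2 J :
    (forall J, D J -> J 0 /\ forall f g, J f -> J g -> J (f + g)) ->
    D J1 -> D J2 -> D J ->
    ([set f + g | f in J1 & g in J2] `<=` J) <-> (J1 `<=` J /\ J2 `<=` J).
  move=> hD D1 D2 DJ; have [z1 _] := hD _ D1; have [z2 _] := hD _ D2.
  have [_ addJ] := hD _ DJ.
  split=> [h|[h1 h2] _ [f J1f [g J2g <-]]]; last by apply: addJ; auto.
  split=> f Jf; apply: h; first by exists f => //; exists 0; rewrite ?addr0.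
  by exists 0 => //; exists f; rewrite ?add0r.
split=> //; first split.
- exact: mF.
- by move=> J1 J2 /set_mem A1 /set_mem A2 e; rewrite -(iF J1)// e iF.
- by move=> J BJ; exists (G J); [exact: mG | exact: iG].
move=> J1 J2 J A1 A2 [AJ /(sub_sum _ _ _ _ _ hA A1 A2 AJ)[s1 s2] minJ].
have BJ := mF _ AJ; have B1 := mF _ A1; have B2 := mF _ A2.
split=> //; first by apply/(sub_sum _ _ _ _ _ hB) => //; split; exact: (lat_map_le FG).
move=> J' BJ' /(sub_sum _ _ _ _ _ hB B1 B2 BJ')[s1' s2'].
have AJ' := mG _ BJ'.
rewrite -(iG _ BJ'); apply: (lat_map_le FG) => //.
apply: minJ => //; apply/(sub_sum _ _ _ _ _ hA) => //.
by rewrite -(iF J1)// -(iF J2)//; split; exact: (lat_map_le GF).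
Qed.

End Lattices.

(** * Unital complete order isomorphisms and transport of kernels *)

Section Isomorphisms.
Context {R : realType}.
Local Notation C := (complex R).
Implicit Types (H K L : hilbertType R).

Definition coiso {H K} (S : set (H -> H)) (T : set (K -> K)) phi psi : Prop :=
  [/\ ucp_map S T phi, ucp_map T S psi, forall f, S f -> psi (phi f) = f &
      forall g, T g -> phi (psi g) = g].

Lemma coiso_sym H K (S : set (H -> H)) (T : set (K -> K)) phi psi :
  coiso S T phi psi -> coiso T S psi phi.
Proof. by case. Qed.

Lemma ucp_mapW H K (S : set (H -> H)) (T T' : set (K -> K)) phi :
  T `<=` T' -> @ucp_map R H K S T phi -> ucp_map S T' phi.
Proof. by move=> TT [/(cp_mapW TT) ? ?]. Qed.

Lemma cp_comp H K L (S : set (H -> H)) (T : set (K -> K)) (U : set (L -> L)) phi psi :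
  @cp_map R H K S T phi -> @cp_map R K L T U psi -> cp_map S U (psi \o phi).
Proof.
move=> [l m p] [l' m' p']; split=> [a f g Sf Sg|f Sf|n A SA pA] /=.
- by rewrite l// l'//; exact: m.
- by apply: m'; exact: m.
- by rewrite map_mx_comp; apply: p'; [move=> i j; rewrite mxE; apply: m | exact: p].
Qed.

Lemma ucp_comp H K L (S : set (H -> H)) (T : set (K -> K)) (U : set (L -> L)) phi psi :
  @ucp_map R H K S T phi -> @ucp_map R K L T U psi -> ucp_map S U (psi \o phi).
Proof. by move=> [cp u] [cp' u']; split; [exact: cp_comp cp cp' | rewrite /= u u']. Qed.

Lemma coiso_coe H K (S : set (H -> H)) (T : set (K -> K)) phi psi :
  T `<=` bounded_op -> coiso S T phi psi -> @unital_complete_order_embedding R H K S phi.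
Proof.
move=> bT [up us ps _]; split; first exact: ucp_mapW up.
  by move=> f g Sf Sg e; rewrite -(ps f)// e ps.
move=> n A SA pA; case: us => -[_ _ /(_ n (map_mx phi A))] + _.
have [[_ mp _] _] := up.
have -> : map_mx psi (map_mx phi A) = A by apply/matrixP => i j; rewrite !mxE ps.
by apply=> // i j; rewrite mxE; apply: mp.
Qed.

Lemma coe_comp H K L (S : set (H -> H)) (T : set (K -> K)) phi psi :
  @ucp_map R H K S T phi -> @unital_complete_order_embedding R H K S phi ->
  @unital_complete_order_embedding R K L T psi ->
  unital_complete_order_embedding S (psi \o phi).
Proof.
move=> up [_ inj p] [up' inj' p']; have [[_ m _] _] := up.
split; first exact: ucp_comp up up'.
  by move=> f g Sf Sg /inj' e; apply: inj => //; apply: e; exact: m.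
move=> n A SA; rewrite map_mx_comp => /p' h; apply: p => //; apply: h => i j.
by rewrite mxE; apply: m.
Qed.

(** Reflection of positivity by the embedding is complete positivity of its inverse on the image. *)
Lemma coe_coiso H K (S : set (H -> H)) phi : operator_system S ->
  @unital_complete_order_embedding R H K S phi ->
  operator_system (phi @` S) /\ exists psi, coiso S (phi @` S) phi psi.
Proof.
move=> oS [up inj pos]; have [[lp mp pp] u1] := up; have lS := os_sub oS; split.
  split.
  - by move=> _ [f Sf <-]; exact: mp.
  - split; first by exists 0; [exact: ls0 lS | exact: lo0 lS lp].
    move=> a _ _ [f Sf <-] [g Sg <-]; exists (a *: f + g); last exact: lp.
    exact: (lsZD lS).
  - move=> _ [f Sf <-]; exists (adj f); first exact: os_adj.
    by rewrite (cp_adj oS up.1).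
  - by exists idfun => //; exact: os_id.
pose psi g := xget 0 [set f | S f /\ phi f = g].
have psiK f : S f -> psi (phi f) = f.
  move=> Sf; rewrite /psi; case: xgetP => [_ -> [Sx kx]|/(_ f)[]//].
  exact: inj.
have up' : ucp_map S (phi @` S) phi by split=> //; split=> // f Sf; exists f.
have us : ucp_map (phi @` S) S psi.
  split; last by have := psiK _ (os_id oS); rewrite u1.
  split.
  - move=> a _ _ [f Sf <-] [g Sg <-]; rewrite -lp// !psiK//.
    exact: (lsZD lS).
  - by move=> _ [f Sf <-]; rewrite psiK.
  - move=> n A SA pA; apply: pos.
      by move=> i j; rewrite mxE; have [f Sf <-] := SA i j; rewrite psiK.
    rewrite (_ : map_mx phi _ = A)//; apply/matrixP => i j; rewrite !mxE.
    by have [f Sf <-] := SA i j; rewrite psiK.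
by exists psi; split=> // _ [f Sf <-]; rewrite psiK.
Qed.

Lemma op_closureS H K (S T : set (H -> K)) : S `<=` T -> op_closure S `<=` op_closure T.
Proof.
move=> ST f [bf h]; split=> // e e0; have [g Sg fg] := h e e0.
by exists g => //; exact: ST.
Qed.

(** Neither extension enlarges the distance to an approximant, so each composite is within [e] of
    the identity for every [e]. *)
Lemma coiso_closure H K (S : set (H -> H)) (T : set (K -> K)) phi psi :
  operator_system S -> operator_system T -> coiso S T phi psi ->
  exists phi' psi', coiso (op_closure S) (op_closure T) phi' psi'.
Proof.
move=> oS oT [up us ps sp].
have [phi' [up' e1 i1 n1]] := ucp_extension oS (ucp_mapW (os_bop oT) up).
have [psi' [us' e2 i2 n2]] := ucp_extension oT (ucp_mapW (os_bop oS) us).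
have img1 f : op_closure S f -> op_closure T (phi' f).
  move=> /i1; apply: op_closureS => _ [g Sg <-].
  by case: up => -[_ m _] _; exact: m.
have img2 f : op_closure T f -> op_closure S (psi' f).
  move=> /i2; apply: op_closureS => _ [g Sg <-].
  by case: us => -[_ m _] _; exact: m.
have mS g : T g -> S (psi g) by case: us => -[_ m _] _; exact: m.
have mT f : S f -> T (phi f) by case: up => -[_ m _] _; exact: m.
exists phi', psi'; split.
- by have [[l _ p] u] := up'; split=> //; split.
- by have [[l _ p] u] := us'; split=> //; split.
- move=> f Sf; apply: op_eq_approx => e e0 x.
  have e2' : 0 < e / 2 by rewrite divr_gt0.
  have [g Sg fg] := Sf.2 _ e2'.
  have h := n2 _ _ _ e2' (img1 _ Sf) (mT _ Sg) (n1 _ _ _ e2' Sf Sg fg) x.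
  rewrite (splitr e) mulrDl; apply: (ler_norm_trans h); rewrite ps// distrC; exact: fg.
- move=> f Sf; apply: op_eq_approx => e e0 x.
  have e2' : 0 < e / 2 by rewrite divr_gt0.
  have [g Sg fg] := Sf.2 _ e2'.
  have h := n1 _ _ _ e2' (img2 _ Sf) (mS _ Sg) (n2 _ _ _ e2' Sf Sg fg) x.
  rewrite (splitr e) mulrDl; apply: (ler_norm_trans h); rewrite sp// distrC; exact: fg.
Qed.

Section Transport.
Context {H K L : hilbertType R} {S : set (H -> H)} {T : set (K -> K)}.
Context {phi : (H -> H) -> (K -> K)} {psi : (K -> K) -> (H -> H)}.
Variables (E : set (L -> L)) (kS : (H -> H) -> (L -> L)) (kT : (K -> K) -> (L -> L)).
Hypotheses (iso : coiso S T phi psi).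

(** The algebra [E] is kept and only the embedding changes, so that kernels over isomorphic systems
    are compared inside the same algebra. *)
Lemma envelope_transport : S `<=` bounded_op -> T `<=` bounded_op ->
  injective_envelope S E kS -> injective_envelope T E (kS \o psi).
Proof.
move=> bS bT [h1 h2 h3 h4 h5]; have [up us ps sp] := iso.
have [[_ mp _] _] := up; have [[_ ms _] _] := us.
split=> //.
- exact: coe_comp us (coiso_coe bS (coiso_sym iso)) h3.
- by move=> _ [g Tg <-]; apply: h4; exists (psi g) => //; exact: ms.
- move=> theta cp fix_; apply: h5 => // s Ss.
  by have := fix_ (phi s) (mp _ Ss); rewrite /= ps.
Qed.

(** Under the compatibility assumption both systems have the same image in [E]; multipliers and
    their products then correspond, and representations are carried over by composition with
    [psi]. *)
Lemma Ker_transport J : (forall s, S s -> kT (phi s) = kS s) ->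
  Ker S E kS J -> Ker T E kT (phi @` J).
Proof.
move=> compat [M [rho [[ur hm ha] ->]]].
have [up us ps sp] := iso.
have [[_ mp _] _] := up; have [[_ ms _] _] := us.
have compat' t : T t -> kS (psi t) = kT t by move=> Tt; rewrite -compat ?sp//; exact: ms.
have img : kS @` S = kT @` T.
  apply/seteqP; split=> [_ [s Ss <-]|_ [t Tt <-]].
    by exists (phi s); [exact: mp | exact: compat].
  by exists (psi t); [exact: ms | exact: compat'].
have mult a : multipliers_in T E kT a -> multipliers_in S E kS (psi a).
  move=> [Ta [Ea m1 m2]]; split; first exact: ms.
  rewrite compat'//; split=> // s Ss; rewrite img -compat//.
    by apply: m1; exact: mp.
  by apply: m2; exact: mp.
exists M, (rho \o psi); split.
  split; first exact: ucp_comp us ur.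
  - move=> a b c Aa Ab Ac e; apply: hm; try exact: mult.
    by have [Ta _] := Aa; have [Tb _] := Ab; have [Tc _] := Ac; rewrite !compat'.
  - move=> a c Aa Ac e; apply: ha; try exact: mult.
    by have [Ta _] := Aa; have [Tc _] := Ac; rewrite !compat'.
apply/seteqP; split=> [_ [s [Ss rs] <-]|t [Tt rt]] /=.
  by split; [exact: mp | rewrite ps].
by exists (psi t); [split => //; exact: ms | exact: sp].
Qed.

End Transport.

Lemma Ker_iso H K L (S : set (H -> H)) (T : set (K -> K)) phi psi
    (E : set (L -> L)) kS kT : coiso S T phi psi ->
  (forall s, S s -> kT (phi s) = kS s) -> lat_iso (Ker S E kS) (Ker T E kT).
Proof.
move=> iso compat; have [up us ps sp] := iso.
have [[_ mp _] _] := up; have [[_ ms _] _] := us.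
have compat' t : T t -> kS (psi t) = kT t by move=> Tt; rewrite -compat ?sp//; exact: ms.
have subS J : Ker S E kS J -> J `<=` S by move=> [M [rho [_ ->]]] s [].
have subT J : Ker T E kT J -> J `<=` T by move=> [M [rho [_ ->]]] s [].
have imgK H1 K1 (U : set (H1 -> H1)) J (f : (H1 -> H1) -> (K1 -> K1)) g :
    (forall x, U x -> g (f x) = x) -> J `<=` U -> g @` (f @` J) = J.
  move=> fg JU; apply/seteqP; split=> [_ [_ [x Jx <-] <-]|x Jx].
    by rewrite fg//; exact: JU.
  by exists (f x); [exists x | apply: fg; exact: JU].
have imgI H1 K1 (U : set (H1 -> H1)) J1 J2 (f : (H1 -> H1) -> (K1 -> K1)) g :
    (forall x, U x -> g (f x) = x) -> J1 `<=` U -> J2 `<=` U ->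
    f @` (J1 `&` J2) = f @` J1 `&` f @` J2.
  move=> fg h1 h2; apply/seteqP; split=> [_ [x [J1x J2x] <-]|_ [[x J1x <-] [y J2y e]]].
    by split; exists x.
  have := fg x (h1 _ J1x); rewrite -e (fg y (h2 _ J2y)) => yx.
  by exists x => //; split=> //; rewrite -yx.
exists (fun J => phi @` J), (fun J => psi @` J); split; split.
- by move=> J AJ; apply: (Ker_transport iso) AJ.
- by move=> J /subS; exact: imgK.
- by move=> J1 J2 /subS h1 /subS h2; exact: (imgI _ _ _ _ _ _ _ ps h1 h2).
- by move=> J AJ; apply: (Ker_transport (coiso_sym iso)) AJ.
- by move=> J /subT; exact: imgK.
- by move=> J1 J2 /subT h1 /subT h2; exact: (imgI _ _ _ _ _ _ _ sp h1 h2).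
Qed.

Lemma Ker_additive H L (S : set (H -> H)) (E : set (L -> L)) kS J :
  lin_subspace S -> Ker S E kS J -> J 0 /\ forall f g, J f -> J g -> J (f + g).
Proof.
move=> lS [M [rho [[[[l _ _] _] _ _] ->]]]; split=> [|f g [Sf rf] [Sg rg]] /=.
  by split; [exact: ls0 lS | exact: lo0 lS l].
by split; [exact: (lsD lS) | rewrite (loD l)// rf rg addr0].
Qed.

End Isomorphisms.

(** * Multipliers and TRO-equivalence *)

Section Compositions.
Context {R : realType}.
Local Notation C := (complex R).
Implicit Types (H K L M : hilbertType R).

Lemma comp_suml (X : Type) (Y : Type) (V : lmodType C) I (r : seq I) (P : pred I) (F : I -> Y ->
  V) (g : X -> Y) :
  (\sum_(i <- r | P i) F i) \o g = \sum_(i <- r | P i) (F i \o g).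
Proof. by apply/funext => x /=; rewrite !op_sumE. Qed.

Lemma comp_sumr (X : Type) (U V : lmodType C) I (r : seq I) (P : pred I) (F : I -> X ->
  U) (f : U -> V) :
  linear f -> f \o (\sum_(i <- r | P i) F i) = \sum_(i <- r | P i) (f \o F i).
Proof.
by move=> lf; apply/funext => x /=; rewrite !op_sumE (lin_sum lf).
Qed.

Lemma sum_unit_sum (V : nmodType) (J : finType) (F : unit + J -> V) :
  \sum_a F a = F (inl tt) + \sum_j F (inr j).
Proof.
rewrite big_sumType /= (bigD1 tt)//= big1 ?addr0// => -[].
Qed.

End Compositions.

Section Multipliers.
Context {R : realType}.
Local Notation C := (complex R).
Variables (H L : hilbertType R) (S : set (H -> H)) (E : set (L -> L))
  (kappa : (H -> H) -> (L -> L)).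
Hypotheses (oS : operator_system S) (hE : injective_envelope S E kappa).
Local Notation A := (multipliers_in S E kappa).

(** Compression of a 2 by 2 matrix over [S] by the column [(a^*, 1)] is completely positive, keeps
    the lower right entry and has [a \o x] as an off-diagonal part. So [multiplier_criterion]
    applies: a composition that preserves [S] is the product of the envelope. *)
Lemma concrete_left_mult a : bounded_op a -> (forall s, S s -> S (a \o s)) ->
  forall s, S s -> kappa (a \o s) = kappa a \o kappa s.
Proof.
move=> ba Sa s Ss; have la := bop_lin ba.
have Saa x : S x -> S (x \o adj a).
  move=> Sx; have bx := os_bop oS Sx.
  by have := os_adj oS (Sa _ (os_adj oS Sx)); rewrite adj_comp ?adjK//; exact: bop_adj.
have lin1 : linear_on S (fun x => a \o x \o adj a).
  by move=> c f g _ _; apply/funext => x /=; rewrite !fctE la.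
have lin2 : linear_on S (fun x => a \o x).
  by move=> c f g _ _; apply/funext => x /=; rewrite !fctE la.
have lin3 : linear_on S (fun x => x \o adj a) by [].
have S1 x : S x -> S (a \o x \o adj a) by move=> Sx; apply: Saa; exact: Sa.
apply: (multiplier_criterion oS hE lin1 lin2 lin3 S1 Sa Saa _ Ss).1.
move=> I X SX pX.
pose k (b : bool) := if b then adj a else idfun.
have bk b : bounded_op (k b) by case: b; [exact: bop_adj | exact: bop_id].
have := kpos_compress bk pX; apply: kpos_eq => i j.
by rewrite !big_bool /= adjK// adj_id !addrA.
Qed.

Lemma multS a s : A a -> S s -> exists2 u, S u & kappa u = kappa a \o kappa s.
Proof. by move=> [_ [_ h _]] /h. Qed.

Lemma mult_adj a : A a -> A (adj a).
Proof.
move=> [Sa [Ea m1 m2]]; have Sa' := os_adj oS Sa; split => //.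
rewrite (env_adj oS hE)//; split=> //; first by rewrite -(env_adj oS hE)//; exact: (env_sub hE).
by move=> s Ss; rewrite adjK; [exact: m1 | exact: (env_bop hE)].
Qed.

Lemma mult_mul a b : A a -> A b -> exists2 c, A c & kappa c = kappa a \o kappa b.
Proof.
move=> Aa Ab; have [Sa _] := Aa; have [Sb _] := Ab.
have [c Sc kc] := multS Aa Sb; exists c => //; split=> //.
have bb x : S x -> bounded_op (kappa x) by move=> Sx; apply/(env_bop hE)/(env_sub hE).
split; first exact: (env_sub hE).
  move=> s Ss; rewrite kc; have [u Su ku] := multS Ab Ss.
  by have [v Sv kv] := multS Aa Su; exists v => //; rewrite kv ku.
move=> s Ss; rewrite kc adj_comp; [|exact: bb|exact: bb].
rewrite -!(env_adj oS hE)//.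
have [u Su ku] := multS (mult_adj Aa) Ss.
by have [v Sv kv] := multS (mult_adj Ab) Su; exists v => //; rewrite kv ku.
Qed.

Lemma mult_id : A idfun.
Proof.
split; first exact: os_id.
rewrite (env_1 hE); split; first exact: os_id (env_os hE).
  by move=> s Ss; exists s.
by move=> s Ss; rewrite adj_id; exists s.
Qed.

Lemma kpos_sub_sqr (s : L -> L) (c : C) : bounded_op s -> 0 <= c ->
  (forall x, `|s x| <= c * `|x|) ->
  kpos (fun p q : option bool => if (p == Some false) && (q == Some false)
     then c ^+ 2 *: idfun - (adj s \o s) else 0).
Proof.
move=> bs c0 h x; rewrite !sum_option_bool /= !fctE /= !dot0l !(add0r, addr0).
rewrite dotDl dotNl dotZl adjP'// !dotH_norm subr_ge0 -exprMn ler_sqr ?nnegrE ?mulr_ge0//.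
Qed.

(* Schur's argument for the rows [a^*, s, 1]; as [s^* s] need not lie in [S], it
   is replaced by a scalar [c^2] dominating it. *)
Lemma rep_bimod K phi a s u : @Cstar_representation R H L K S E kappa phi ->
  A a -> S s -> S u -> kappa u = kappa a \o kappa s -> phi u = phi a \o phi s.
Proof.
move=> [up hm _] Aa Ss Su ku; have [Sa _] := Aa.
have [w Aw kw] := mult_mul Aa (mult_adj Aa); have [Sw _] := Aw.
have bb x : S x -> bounded_op (kappa x) by move=> Sx; apply/(env_bop hE)/(env_sub hE).
have kadj x : S x -> kappa (adj x) = adj (kappa x) by exact: (env_adj oS hE).
have [c c0 hc] := bop_bound (bb _ Ss).
have Sadj x : S x -> S (adj x) by exact: os_adj oS.
pose B (p q : option bool) : H -> H := match p, q with
  | Some true, Some true => w | Some true, Some false => u | Some true, None => a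
  | Some false, Some true => adj u | Some false, Some false => c ^+ 2 *: idfun | Some false,
    None => adj s
  | None, Some true => adj a | None, Some false => s | None, None => idfun end.
have SB p q : S (B p q).
  case: p q => [[]|] [[]|] //=; try exact: Sadj; try exact: os_id oS.
  by apply: lsZ (os_sub oS) _ _ (os_id oS).
have pB : kpos B.
  apply: (coe_kpos (os_bop oS) (env_coe hE)) => //.
  (* Positivity of [B] is visible only in the envelope, where [kappa] turns it into the Gram kernel
     of [r] plus the correction of [kpos_sub_sqr]; the embedding reflects it to [S]. *)
  pose r (p : option bool) : L -> L := match p with Some true => adj (kappa a) | Some false =>
    kappa s | None => idfun end.
  have br p : bounded_op (r p).
    by case: p => [[]|] /=; [apply: bop_adj; exact: bb | exact: bb | exact: bop_id].
  have := kposD (kpos_gram br) (kpos_sub_sqr (bb _ Ss) (ltW c0) hc).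
  apply: kpos_eq => -[[]|] [[]|] /=; rewrite ?addr0 ?adj_id ?adjK ?kadj ?(env_1 hE) //;
    try exact: bb.
  - by rewrite kw kadj.
  - by rewrite ku adj_comp//; exact: bb.
  - by rewrite addrC subrK (loZ (os_sub oS) (env_lin hE)) ?(env_1 hE)//; exact: os_id.
have pG := cp_kpos (os_bop oS) (@subset_refl _ _) up.1 SB pB.
have [[_ mp _] u1] := up.
have lG p q : linear (phi (B p q)) by apply/bop_lin/mp.
have padj x : S x -> phi (adj x) = adj (phi x) by exact: (cp_adj oS up.1).
have [||||] := kpos_schur lG pG (mp _ Sa) => //=.
- by rewrite (hm a (adj a) w)// ?padj//; exact: mult_adj.
- exact: padj.
Qed.

End Multipliers.

(** * Norm-closed TRO-equivalences with exact finite frames *)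

Section Morita.
Context {R : realType}.
Local Notation C := (complex R).

(* An exact finite form of 1 \in [M^* M]. *)
Definition tro_frames {H K : hilbertType R} (M : set (H -> K)) : Prop :=
  exists (I : finType) (f g : I -> H -> K), [/\ forall i, M (f i), forall i, M (g i) &
    \sum_i (adj (f i) \o g i) = idfun].

Definition tro_data {H K : hilbertType R} (S : set (H -> H)) (T : set (K -> K))
    (M : set (H -> K)) : Prop :=
  [/\ operator_system S, operator_system T, M `<=` bounded_op,
      (forall m t n, M m -> T t -> M n -> S (adj m \o t \o n)) /\
      (forall m s n, M m -> S s -> M n -> T (m \o s \o adj n)) &
      tro_frames M /\ tro_frames [set adj m | m in M]].

Lemma tro_data_sym H K S T M : @tro_data H K S T M -> tro_data T S [set adj m | m in M].
Proof.
move=> [oS oT bM [h1 h2] [f1 f2]]; split=> //.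
- by move=> _ [m Mm <-]; apply: bop_adj; exact: bM.
- split; first by move=> _ s _ [m Mm <-] Ss [n Mn <-]; rewrite adjK; [exact: h2 | exact: bM].
  by move=> _ s _ [m Mm <-] Ss [n Mn <-]; rewrite adjK; [exact: h1 | exact: bM].
split=> //; move: f1 => [I [f [g [Mf Mg fg]]]]; exists I, f, g; split=> //.
- by move=> i; exists (adj (f i)); [exists (f i) | rewrite adjK//; exact: bM].
- by move=> i; exists (adj (g i)); [exists (g i) | rewrite adjK//; exact: bM].
Qed.

Lemma frames_adj H K M : @tro_frames H K M -> M `<=` bounded_op ->
  exists (I : finType) (f g : I -> H -> K), [/\ forall i, M (f i), forall i, M (g i),
    \sum_i (adj (f i) \o g i) = idfun & \sum_i (adj (g i) \o f i) = idfun].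
Proof.
move=> [I [f [g [Mf Mg fg]]]] bM; exists I, f, g; split=> //.
have bf i := bM _ (Mf i); have bg i := bM _ (Mg i).
have := congr1 adj fg; rewrite adj_id adj_sum => [|i _]; last first.
  by apply: bop_comp => //; exact: bop_adj.
by move=> <-; apply: eq_bigr => i _; rewrite adj_comp ?adjK//; exact: bop_adj.
Qed.

Section OneSide.
Context {H K : hilbertType R} {S : set (H -> H)} {T : set (K -> K)} {M : set (H -> K)}.
Hypothesis (hM : tro_data S T M).

Let oS : operator_system S. Proof. by case: hM. Qed.
Let oT : operator_system T. Proof. by case: hM. Qed.
Let bM : M `<=` bounded_op. Proof. by case: hM. Qed.
Let toS m t n : M m -> T t -> M n -> S (adj m \o t \o n).
Proof. by case: hM => _ _ _ [h _] _; exact: h. Qed.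
Let toT m s n : M m -> S s -> M n -> T (m \o s \o adj n).
Proof. by case: hM => _ _ _ [_ h] _; exact: h. Qed.

(** A frame inserted on the right turns [m^* n s] into a sum of terms [m^* (n s f_i^* ) g_i], each
    of which passes through [T] and returns to [S]. *)
Lemma tro_left m n s : M m -> M n -> S s -> S (adj m \o n \o s).
Proof.
move=> Mm Mn Ss; have [I [f [g [Mf Mg fg _]]]] : exists (I : finType) (f g : I -> H -> K),
    [/\ forall i, M (f i), forall i, M (g i), \sum_i (adj (f i) \o g i) = idfun & True].
  by case: hM => _ _ _ _ [[I [f [g [? ? ?]]]] _]; exists I, f, g.
have -> : adj m \o n \o s = \sum_i (adj m \o (n \o s \o adj (f i)) \o g i).
  have [bm bn bs] := And3 (bM Mm) (bM Mn) (os_bop oS Ss).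
  rewrite -[LHS]/((adj m \o n \o s) \o idfun) -fg comp_sumr//.
  by apply: bop_lin; auto using bop_comp, bop_adj.
apply: (ls_sum (os_sub oS)) => i _; apply: toS => //.
exact: toT.
Qed.
End OneSide.
End Morita.

Section RightMult.
Context {R : realType}.
Variables (H L : hilbertType R) (S : set (H -> H)) (E : set (L -> L))
  (kappa : (H -> H) -> (L -> L)).
Hypotheses (oS : operator_system S) (hE : injective_envelope S E kappa).

Lemma concrete_right_mult a : bounded_op a -> (forall s, S s -> S (s \o a)) ->
  forall s, S s -> kappa (s \o a) = kappa s \o kappa a.
Proof.
move=> ba Sa s Ss.
have S_a x : S x -> S (adj a \o x).
  move=> Sx; have := os_adj oS (Sa _ (os_adj oS Sx)).
  have bx := os_bop oS Sx.
  by rewrite adj_comp ?adjK//; exact: bop_adj.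
have Sa1 : S a := Sa _ (os_id oS).
have bb x : S x -> bounded_op (kappa x) by move=> Sx; apply/(env_bop hE)/(env_sub hE).
have bs := os_bop oS Ss.
have := congr1 adj (concrete_left_mult oS hE (bop_adj ba) S_a (os_adj oS Ss)).
rewrite -(env_adj oS hE); last by apply: S_a; exact: os_adj.
rewrite adj_comp; [|exact: bop_adj|exact: bop_adj].
rewrite adj_comp; [|by apply: bb; exact: os_adj|by apply: bb; exact: os_adj].
by rewrite !(env_adj oS hE)// !adjK//; exact: bb.
Qed.
End RightMult.

(** * Compressions of multipliers by elements of the TRO *)

Section Compression.
Context {R : realType}.
Local Notation C := (complex R).
Variables (H K LS LT : hilbertType R) (S : set (H -> H)) (T : set (K -> K)) (M : set (H -> K)).
Variables (ES : set (LS -> LS)) (kS : (H -> H) -> (LS -> LS)).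
Variables (ET : set (LT -> LT)) (kT : (K -> K) -> (LT -> LT)).
Hypotheses (hM : tro_data S T M).
Hypotheses (hES : injective_envelope S ES kS) (hET : injective_envelope T ET kT).

Let oS : operator_system S. Proof. by case: hM. Qed.
Let oT : operator_system T. Proof. by case: hM. Qed.
Let bM : M `<=` bounded_op. Proof. by case: hM. Qed.
Let bS := os_bop oS.
Let bT := os_bop oT.
Let lS := os_sub oS.
Let lT := os_sub oT.
Let toS m t n : M m -> T t -> M n -> S (adj m \o t \o n).
Proof. by case: hM => _ _ _ [h _] _; exact: h. Qed.
Let toT m s n : M m -> S s -> M n -> T (m \o s \o adj n).
Proof. by case: hM => _ _ _ [_ h] _; exact: h. Qed.
Let MMT m n t : M m -> M n -> T t -> T (m \o adj n \o t).
Proof.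
move=> Mm Mn Tt; have := @tro_left _ _ _ _ _ _ (tro_data_sym hM) (adj m) (adj n) t.
by rewrite adjK; [apply=> //; [exists m|exists n]|exact: bM].
Qed.
Let TMM m n t : M m -> M n -> T t -> T (t \o (m \o adj n)).
Proof.
move=> Mm Mn Tt; have := os_adj oT (MMT Mn Mm (os_adj oT Tt)).
have [bm bn bt] := And3 (bM Mm) (bM Mn) (bT Tt).
rewrite (_ : adj _ = t \o (m \o adj n))//; apply: adj_unique => x y /=.
by rewrite (adjP _ _ bn) (adjP' _ _ bm) (adjP' _ _ bt).
Qed.
Let kT_MM m n t : M m -> M n -> T t -> kT (t \o (m \o adj n)) = kT t \o kT (m \o adj n).
Proof.
move=> Mm Mn Tt; have [bm bn] := conj (bM Mm) (bM Mn).
apply: (concrete_right_mult oT hET) => //; first by auto using bop_comp, bop_adj.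
by move=> s; exact: TMM.
Qed.

Section OneMultiplier.
Variables (b : K -> K).
Hypothesis (Ab : multipliers_in T ET kT b).
Let Tb : T b. Proof. by case: Ab. Qed.

Definition lmult (t : K -> K) : K -> K := env_inv T kT (kT b \o kT t).

Let lmultP t : T t -> T (lmult t) /\ kT (lmult t) = kT b \o kT t.
Proof. by case: Ab => _ [_ h _] Tt; apply: env_invP hET _ _; exact: h. Qed.

Lemma lmult_eq t u : T t -> T u -> kT u = kT b \o kT t -> lmult t = u.
Proof.
move=> Tt Tu e; apply: (env_inj hET) => //; first exact: (lmultP Tt).1.
by rewrite (lmultP Tt).2.
Qed.

Let bkT t : T t -> bounded_op (kT t).
Proof. by move=> Tt; apply/(env_bop hET)/(env_sub hET). Qed.

Lemma lmult_lin : linear_on T lmult.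
Proof.
move=> a f g Tf Tg; have lb := bop_lin (bkT Tb).
apply: lmult_eq; first exact: (lsZD lT).
  by apply: (lsZD lT); [exact: (lmultP Tf).1 | exact: (lmultP Tg).1].
rewrite !(env_lin hET)//; [|exact: (lmultP Tf).1 | exact: (lmultP Tg).1].
rewrite (lmultP Tf).2 (lmultP Tg).2; apply/funext => x /=.
by rewrite !fctE lb.
Qed.

(** Right composition with [m n^*] preserves [T], hence is the product of the envelope. So on
    [m n^*] the abstract product by [b] is ordinary composition. *)
Lemma lmult_MM m n : M m -> M n -> lmult (m \o adj n) = b \o (m \o adj n).
Proof.
move=> Mm Mn; have Tmn := TMM Mm Mn (os_id oT).
by apply: lmult_eq => //; [exact: TMM | rewrite kT_MM].
Qed.

Definition rmult (t : K -> K) : K -> K := adj (lmult (adj t)).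

Let rmultP t : T t -> T (rmult t) /\ kT (rmult t) = kT t \o adj (kT b).
Proof.
move=> Tt; have [h1 h2] := lmultP (os_adj oT Tt); split; first exact: os_adj.
rewrite /rmult (env_adj oT hET)// h2 adj_comp; [|exact: bkT|by apply: bkT; exact: os_adj].
by rewrite (env_adj oT hET)// adjK//; exact: bkT.
Qed.

Lemma rmult_lin : linear_on T rmult.
Proof.
move=> a f g Tf Tg; rewrite /rmult adj_ZD; [|exact: bT|exact: bT].
have [Tf' Tg'] := conj (os_adj oT Tf) (os_adj oT Tg).
rewrite lmult_lin// adj_ZD ?conjCK//; apply: bT.
  exact: (lmultP Tf').1.
exact: (lmultP Tg').1.
Qed.

Variables (m n : H -> K).
Hypotheses (Mm : M m) (Mn : M n).
Variables (J : finType) (f g : J -> H -> K).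
Hypotheses (Mf : forall j, M (f j)) (Mg : forall j, M (g j)).
Hypotheses (fg : \sum_j (adj (f j) \o g j) = idfun) (gf : \sum_j (adj (g j) \o f j) = idfun).

(* [tau] is left multiplication by [m^* b n], [tau'] is right multiplication by
   its adjoint and [theta] is conjugation by it, all written in [S] and [T] so
   that only products by the multiplier [b] of [T] occur. *)
Definition tau (s : H -> H) : H -> H :=
  \sum_j (adj m \o lmult (n \o s \o adj (f j)) \o g j).
Definition tau' (s : H -> H) : H -> H :=
  \sum_j (adj (g j) \o rmult (f j \o s \o adj n) \o m).
Definition theta (s : H -> H) : H -> H :=
  adj m \o rmult (lmult (n \o s \o adj n)) \o m.

Lemma conj_lin (p q : H -> K) a (x y : H -> H) : M p ->
  p \o (a *: x + y) \o adj q = a *: (p \o x \o adj q) + (p \o y \o adj q).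
Proof. by move=> Mp; apply/funext => u /=; rewrite !fctE (bop_lin (bM Mp)). Qed.

Lemma conj_lin' (p q : H -> K) a (x y : K -> K) : M p ->
  adj p \o (a *: x + y) \o q = a *: (adj p \o x \o q) + (adj p \o y \o q).
Proof. by move=> Mp; apply/funext => u /=; rewrite !fctE (adj_lin (bM Mp)). Qed.

Lemma tauS s : S s -> S (tau s).
Proof.
move=> Ss; apply: (ls_sum lS) => j _; apply: toS => //.
by apply: (lmultP _).1; exact: toT.
Qed.
Lemma tauS' s : S s -> S (tau' s).
Proof.
move=> Ss; apply: (ls_sum lS) => j _; apply: toS => //.
by apply: (rmultP _).1; exact: toT.
Qed.
Lemma thetaS s : S s -> S (theta s).
Proof.
move=> Ss; apply: toS => //.
by apply: (rmultP _).1; apply: (lmultP _).1; exact: toT.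
Qed.
Lemma tau_lin : linear_on S tau.
Proof.
move=> a x y Sx Sy; rewrite /tau scaler_sumr -big_split; apply: eq_bigr => j _ /=.
by rewrite conj_lin// lmult_lin ?conj_lin'//; exact: toT.
Qed.
Lemma tau_lin' : linear_on S tau'.
Proof.
move=> a x y Sx Sy; rewrite /tau' scaler_sumr -big_split; apply: eq_bigr => j _ /=.
by rewrite conj_lin// rmult_lin ?conj_lin'//; exact: toT.
Qed.
Lemma theta_lin : linear_on S theta.
Proof.
move=> a x y Sx Sy; rewrite /theta conj_lin// lmult_lin; [|exact: toT|exact: toT].
by rewrite rmult_lin ?conj_lin'//; apply: (lmultP _).1; exact: toT.
Qed.

Let frame2 w : bounded_op w ->
  \sum_j \sum_l (adj (g j) \o (f j \o w \o adj (f l)) \o g l) = w.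
Proof.
move=> bw; have bfg j : bounded_op (adj (g j) \o f j \o w).
  have [bf bg] := conj (bM (Mf j)) (bM (Mg j)); auto using bop_comp, bop_adj.
transitivity (\sum_j (adj (g j) \o f j \o w)).
  apply: eq_bigr => j _; rewrite -[RHS]/((adj (g j) \o f j \o w) \o idfun) -fg.
  by rewrite comp_sumr//; exact: bop_lin.
by rewrite -comp_suml gf.
Qed.

(** The completely positive map for the criterion is built in three moves: conjugation by [n] and
    the [f j] takes matrices over [S] to matrices over [T], multiplication of one block by [b] takes
    place in the envelope of [T], and compression by [m] and the [g j] returns to [S]. *)
Lemma tau_mult s : S s -> kS (tau s) = kS (tau idfun) \o kS s.
Proof.
move=> Ss; have := multiplier_criterion oS hES theta_lin tau_lin tau_lin' thetaS tauS tauS' _ Ss.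
case=> // {s Ss} I A SA pA.
(* [inl] indexes the single block that carries [b] and comes from the first row; the [inr j] are
   copies of the second row, one for each frame element. *)
pose p (a : (unit + J) * I) : bool * I := if a.1 is inl _ then (true, a.2) else (false, a.2).
pose gg (a : unit + J) := if a is inr j then f j else n.
have Mgg a : M (gg a) by case: a.
have bgg a : bounded_op (adj (gg a)) by apply: bop_adj; apply: bM.
pose D (a c : (unit + J) * I) := gg a.1 \o A (p a) (p c) \o adj (gg c.1).
have TD a c : T (D a c) by exact: toT.
have pD : kpos D.
  have := kpos_congr p (fun a : (unit + J) * I => bgg a.1) (fun i j => bop_lin (bS (SA i j))) pA.
  by apply: kpos_eq => a c; rewrite adjK//; exact: bM.
pose F (a c : (unit + J) * I) : K -> K := match a.1, c.1 with
  | inl _, inl _ => rmult (lmult (D a c)) | inl _, inr _ => lmult (D a c)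
  | inr _, inl _ => rmult (D a c) | inr _, inr _ => D a c end.
have TF a c : T (F a c).
  rewrite /F; case: a.1 => _; case: c.1 => _ //; first by apply: (rmultP _).1; exact: (lmultP _).1.
    exact: (lmultP _).1.
  exact: (rmultP _).1.
have pF : kpos F.
  apply: (coe_kpos bT (env_coe hET)) => //.
  have pkD := cp_kpos bT (env_bop hET) (env_cp hET) TD pD.
  (* In the envelope of [T], [F] is [D] conjugated by [b^*] on the first block and by 1 on the
     others, and is therefore positive. *)
  pose h (a : (unit + J) * I) : LT -> LT := if a.1 is inl _ then adj (kT b) else idfun.
  have bh a : bounded_op (h a).
    by rewrite /h; case: a.1 => _; [apply: bop_adj; exact: bkT | exact: bop_id].
  have := kpos_congr id bh (fun a c => bop_lin (bkT (TD a c))) pkD.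
  apply: kpos_eq => a c; rewrite /F /h; case: a.1 => _; case: c.1 => _; rewrite ?adjK ?adj_id//;
    try exact: bkT.
  - by rewrite (rmultP (lmultP (TD a c)).1).2 (lmultP (TD a c)).2.
  - by rewrite (lmultP (TD a c)).2.
  - by rewrite (rmultP (TD a c)).2.
pose k (a : unit + J) := if a is inr j then g j else m.
have bk a : bounded_op (k a) by apply: bM; case: a.
have := kpos_compress bk pF; apply: kpos_eq => i j.
rewrite sum_unit_sum; under [X in _ + X]eq_bigr do rewrite sum_unit_sum.
rewrite sum_unit_sum [X in _ + X]big_split /= -!addrA; congr (_ + (_ + (_ + _))).
(* Three blocks are [theta], [tau] and [tau'] by definition; in the fourth the two frame identities
   give back the entry itself. *)
exact/frame2/bS.
Qed.

Lemma tau1 : tau idfun = adj m \o b \o n.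
Proof.
have [bm bn bb] := And3 (bM Mm) (bM Mn) (bT Tb).
transitivity (\sum_j ((adj m \o b \o n) \o (adj (f j) \o g j))).
  by apply: eq_bigr => j _; rewrite lmult_MM.
rewrite -comp_sumr ?fg//.
by apply: bop_lin; auto using bop_comp, bop_adj.
Qed.

Lemma compress_left s : S s -> kS (tau s) = kS (adj m \o b \o n) \o kS s.
Proof. by move=> Ss; rewrite tau_mult// tau1. Qed.

End OneMultiplier.

Lemma mult_compress b m n : multipliers_in T ET kT b -> M m -> M n ->
  multipliers_in S ES kS (adj m \o b \o n).
Proof.
move=> Ab Mm Mn; have [Tb _] := Ab.
have [J [f [g [Mf Mg fg gf]]]] : exists (J : finType) (f g : J -> H -> K),
    [/\ forall i, M (f i), forall i, M (g i), \sum_i (adj (f i) \o g i) = idfun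
      & \sum_i (adj (g i) \o f i) = idfun].
  by case: hM => _ _ _ _ [fr _]; exact: frames_adj.
have Sa := toS Mm Tb Mn; split=> //; split; first exact: (env_sub hES).
  move=> s Ss; exists (tau b m n f g s); first exact: tauS.
  exact: compress_left.
(* The adjoint of [m^* b n] is [n^* b^* m], which is of the same form with [m] and [n] exchanged. *)
move=> s Ss; have Ab' := mult_adj oT hET Ab.
exists (tau (adj b) n m f g s); first exact: tauS.
rewrite compress_left// -(env_adj oS hES)//; congr (kS _ \o _).
have [bm bn bb] := And3 (bM Mm) (bM Mn) (bT Tb).
apply/esym/adj_unique => x y /=.
by rewrite (adjP' _ _ bm) (adjP _ _ bb) -(adjP _ _ bn).
Qed.

(** The identity [\sum_i p_i r_i^* = 1] is inserted between [b] and [b']. By [compress_left] each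
    summand is a product in the envelope of [S], so a product of multipliers of [T] is expressed by
    products of multipliers of [S]. *)
Lemma compress_mul b b' c m q (I J : finType) (p r : I -> H -> K) (f g : J -> H -> K) :
  multipliers_in T ET kT b -> multipliers_in T ET kT b' -> T c ->
  kT c = kT b \o kT b' -> M m -> M q ->
  (forall i, M (p i)) -> (forall i, M (r i)) -> \sum_i (p i \o adj (r i)) = idfun ->
  (forall i, M (f i)) -> \sum_j (adj (f j) \o g j) = idfun ->
  \sum_i tau b m (p i) f g (adj (r i) \o b' \o q) = adj m \o c \o q.
Proof.
move=> Ab Ab' Tc kc Mm Mq Mp Mr pr Mf fg.
have [Tb _] := Ab; have [Tb' _] := Ab'.
rewrite /tau exchange_big /=.
transitivity (\sum_j ((adj m \o c \o q) \o (adj (f j) \o g j))); last first.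
  have [bm bq bc] := And3 (bM Mm) (bM Mq) (bT Tc).
  by rewrite -comp_sumr ?fg//; apply: bop_lin; auto using bop_comp, bop_adj.
apply: eq_bigr => j _.
have Tx i : T (p i \o (adj (r i) \o b' \o q) \o adj (f j)) by apply: toT => //; exact: toS.
rewrite -comp_suml -comp_sumr; last exact: adj_lin (bM Mm).
rewrite -(lo_sum lT (lmult_lin Ab))//.
have -> : \sum_i (p i \o (adj (r i) \o b' \o q) \o adj (f j)) = b' \o (q \o adj (f j)).
  by rewrite -[RHS]/(idfun \o (b' \o (q \o adj (f j)))) -pr comp_suml.
have Tqf := TMM Mq (Mf j) (os_id oT).
rewrite (lmult_eq Ab (u := c \o (q \o adj (f j))))//; [exact: TMM|exact: TMM|].
by rewrite !kT_MM// kc.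
Qed.

End Compression.

(** * The induced representation *)

Section OpMatrix.
Context {R : realType}.
Local Notation C := (complex R).
Variables (I : finType) (H : hilbertType R).

Definition op_mx (G : I -> I -> H -> H) : hpow I H -> hpow I H :=
  \sum_i \sum_j (hin i \o G i j \o hout j).

Lemma op_mx_dot G x y :
  dotH (op_mx G x) y = \sum_i \sum_j dotH (G i j (hout j x)) (hout i y).
Proof.
rewrite /op_mx op_sumE dot_suml; apply: eq_bigr => i _.
rewrite op_sumE dot_suml; apply: eq_bigr => j _.
exact: hin_out_dot.
Qed.

Lemma op_mx_out G x i : hout i (op_mx G x) = \sum_j G i j (hout j x).
Proof.
apply: dot_inj => z; rewrite -adj_hin adjP'; last exact: bop_hin.
rewrite op_mx_dot (bigD1 i)//= [X in _ + X]big1 ?addr0; last first.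
  by move=> k ki; apply: big1 => j _; rewrite houtK (negPf ki) dot0r.
by rewrite dot_suml; apply: eq_bigr => j _; rewrite houtK eqxx.
Qed.

Lemma hpow_eq (x y : hpow I H) : (forall i, hout i x = hout i y) -> x = y.
Proof. by move=> h; rewrite [x]hpow_sum [y]hpow_sum; apply: eq_bigr => i _; rewrite h. Qed.

Lemma bop_op_mx G : (forall i j, bounded_op (G i j)) -> bounded_op (op_mx G).
Proof.
move=> bG; apply: (ls_sum (bop_sub _ _)) => i _; apply: (ls_sum (bop_sub _ _)) => j _.
apply: bop_comp; last exact: bop_hout.
by apply: bop_comp; [exact: bop_hin | exact: bG].
Qed.

Lemma op_mx_mul G G' x : (forall i j, linear (G i j)) ->
  op_mx G (op_mx G' x) = op_mx (fun i j => \sum_k (G i k \o G' k j)) x.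
Proof.
move=> lG; apply: hpow_eq => i; rewrite !op_mx_out.
under eq_bigr do rewrite op_mx_out (lin_sum (lG _ _)).
by rewrite exchange_big; apply: eq_bigr => j _; rewrite op_sumE.
Qed.

Lemma op_mx_adj G : (forall i j, bounded_op (G i j)) ->
  (forall i j, G i j = adj (G j i)) -> is_adjoint (op_mx G) (op_mx G).
Proof.
move=> bG hG x y; rewrite [RHS]dotC !op_mx_dot rmorph_sum exchange_big.
apply: eq_bigr => i _; rewrite rmorph_sum; apply: eq_bigr => j _ /=.
by rewrite -dotC hG adjP'.
Qed.

End OpMatrix.

Section Induced.
Context {R : realType}.
Local Notation C := (complex R).
Variables (H K LS LT : hilbertType R) (S : set (H -> H)) (T : set (K -> K)) (M : set (H -> K)).
Variables (ES : set (LS -> LS)) (kS : (H -> H) -> (LS -> LS)).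
Variables (ET : set (LT -> LT)) (kT : (K -> K) -> (LT -> LT)).
Hypotheses (hM : tro_data S T M).
Hypotheses (hES : injective_envelope S ES kS) (hET : injective_envelope T ET kT).

Let oS : operator_system S. Proof. by case: hM. Qed.
Let oT : operator_system T. Proof. by case: hM. Qed.
Let bM : M `<=` bounded_op. Proof. by case: hM. Qed.
Let bS := os_bop oS.
Let bT := os_bop oT.
Let lS := os_sub oS.
Let lT := os_sub oT.
Let toS m t n : M m -> T t -> M n -> S (adj m \o t \o n).
Proof. by case: hM => _ _ _ [h _] _; exact: h. Qed.
Let toT m s n : M m -> S s -> M n -> T (m \o s \o adj n).
Proof. by case: hM => _ _ _ [_ h] _; exact: h. Qed.
Let MM m n : M m -> M n -> S (adj m \o n).
Proof. by move=> Mm Mn; exact: (toS Mm (os_id oT) Mn). Qed.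

Section Rep.
Variables (K0 : hilbertType R) (phi : (H -> H) -> (K0 -> K0)).
Hypothesis (hphi : Cstar_representation S ES kS phi).
Let up : ucp_map S bounded_op phi. Proof. by case: hphi. Qed.
Let bphi s : S s -> bounded_op (phi s). Proof. by move=> Ss; case: up => -[_ h _] _; exact: h. Qed.
Let lphi : linear_on S phi. Proof. by case: up => -[]. Qed.
Let padj s : S s -> phi (adj s) = adj (phi s).
Proof. exact: (cp_adj oS up.1). Qed.

(** Elements of [M^* M] are compressions of the unit of [T], hence multipliers of [S], and their
    envelope products are compositions; the bimodule property of [phi] then applies. *)
Lemma rep_MM m n s : M m -> M n -> S s -> phi (adj m \o n \o s) = phi (adj m \o n) \o phi s.
Proof.
move=> Mm Mn Ss.
have Sl t : S t -> S (adj m \o n \o t) by exact: (tro_left hM).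
apply: (rep_bimod oS hES hphi) => //.
- exact: (mult_compress hM hES hET (mult_id oT hET) Mm Mn).
- exact: Sl.
- apply: (concrete_left_mult oS hES) => //.
  by have [bm bn] := conj (bM Mm) (bM Mn); auto using bop_comp, bop_adj.
Qed.

Lemma rep_MM' m n s : M m -> M n -> S s -> phi (s \o (adj m \o n)) = phi s \o phi (adj m \o n).
Proof.
move=> Mm Mn Ss; have := congr1 adj (rep_MM Mn Mm (os_adj oS Ss)).
have [bm bn bs] := And3 (bM Mm) (bM Mn) (bS Ss).
have e : adj (adj n \o m) = adj m \o n by rewrite adj_comp ?adjK//; exact: bop_adj.
rewrite -padj; last by apply: (tro_left hM) => //; exact: os_adj.
rewrite adj_comp; [|by auto using bop_comp, bop_adj|exact: bop_adj].
rewrite e adjK// => ->.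
rewrite adj_comp; [|by apply: bphi; exact: MM|by apply: bphi; exact: os_adj].
by rewrite -!padj ?e ?adjK//; [exact: MM | exact: os_adj].
Qed.

Variables (I : finType) (p r : I -> H -> K).
Hypotheses (Mp : forall i, M (p i)) (Mr : forall i, M (r i)).
Hypotheses (pr : \sum_i (p i \o adj (r i)) = idfun).

Lemma rep_left m t q : M m -> T t -> M q ->
  \sum_k (phi (adj m \o p k) \o phi (adj (r k) \o t \o q)) = phi (adj m \o t \o q).
Proof.
move=> Mm Tt Mq.
have Sl k : S (adj m \o p k \o (adj (r k) \o t \o q)).
  by apply: (tro_left hM) => //; exact: toS.
transitivity (\sum_k phi (adj m \o p k \o (adj (r k) \o t \o q))).
  by apply: eq_bigr => k _; rewrite rep_MM//; exact: toS.
rewrite -(lo_sum lS lphi)//; congr phi.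
rewrite -[RHS]/((adj m \o idfun) \o (t \o q)) -pr comp_sumr; last exact: adj_lin (bM Mm).
by rewrite comp_suml.
Qed.

Lemma rep_right m t q : M m -> T t -> M q ->
  \sum_k (phi (adj m \o t \o p k) \o phi (adj (r k) \o q)) = phi (adj m \o t \o q).
Proof.
move=> Mm Tt Mq.
have Sr k : S (adj m \o t \o p k \o (adj (r k) \o q)).
  have h := tro_left hM Mq (Mr k) (os_adj oS (toS Mm Tt (Mp k))).
  have [[bm bt bp] [bq br]] := conj (And3 (bM Mm) (bT Tt) (bM (Mp k))) (conj (bM Mq) (bM (Mr k))).
  rewrite -[X in S X]adjK; last by auto using bop_comp, bop_adj.
  apply: os_adj => //; rewrite adj_comp; [|by auto using bop_comp, bop_adj|by auto using
    bop_comp, bop_adj].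
  by rewrite (@adj_comp _ _ _ _ (adj (r k)) q) ?adjK//; exact: bop_adj.
transitivity (\sum_k phi (adj m \o t \o p k \o (adj (r k) \o q))).
  by apply: eq_bigr => k _; rewrite rep_MM'//; exact: toS.
rewrite -(lo_sum lS lphi)//; congr phi.
rewrite -[RHS]/((adj m \o t) \o (idfun \o q)) -pr comp_suml comp_sumr//.
by have [bm bt] := conj (bM Mm) (bT Tt); apply: bop_lin; auto using bop_comp, bop_adj.
Qed.

(** Each summand of [compress_mul] is an envelope product by the multiplier [m^* b p_k] of [S],
    through which [phi] factors. *)
Lemma rep_mul b b' c m q :
  multipliers_in T ET kT b -> multipliers_in T ET kT b' -> T c ->
  kT c = kT b \o kT b' -> M m -> M q ->
  \sum_k (phi (adj m \o b \o p k) \o phi (adj (r k) \o b' \o q)) = phi (adj m \o c \o q).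
Proof.
move=> Ab Ab' Tc kc Mm Mq; have [Tb _] := Ab; have [Tb' _] := Ab'.
have [J [f [g [Mf Mg fg gf]]]] : exists (J : finType) (f g : J -> H -> K),
    [/\ forall i, M (f i), forall i, M (g i), \sum_i (adj (f i) \o g i) = idfun
      & \sum_i (adj (g i) \o f i) = idfun].
  by case: hM => _ _ _ _ [fr _]; exact: frames_adj.
rewrite -(compress_mul hM hET Ab Ab' Tc kc Mm Mq Mp Mr pr Mf fg).
have St k : S (tau T kT b m (p k) f g (adj (r k) \o b' \o q)).
  by apply: (tauS hM hET) => //; exact: toS.
rewrite (lo_sum lS lphi)//; apply: eq_bigr => k _.
apply/esym/(rep_bimod oS hES hphi) => //; first exact: (mult_compress hM hES hET).
  exact: toS.
by apply: (compress_left hM hES hET) => //; exact: toS.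
Qed.

(* The representation induced to [T] lives on M (x)_{M^*M} K0, realised in K0^I
   as the range of the idempotent [Q] by m (x) xi |-> (phi (r_i^* m) xi)_i; there
   the inner product is the one defined by [W], and [t] acts as [Psi t]. *)
Let Q := op_mx (fun i j => phi (adj (r i) \o p j)).
Let W := op_mx (fun i j => phi (adj (p i) \o p j)).
Let Psi t := op_mx (fun i j => phi (adj (r i) \o t \o p j)).
Let P (x : hpow I K0) := Q x = x.

Let bQ : bounded_op Q.
Proof. by apply: bop_op_mx => i j; apply: bphi; exact: MM. Qed.
Let bW : bounded_op W.
Proof. by apply: bop_op_mx => i j; apply: bphi; exact: MM. Qed.
Let bPsi t : T t -> bounded_op (Psi t).
Proof. by move=> Tt; apply: bop_op_mx => i j; apply: bphi; exact: toS. Qed.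

Let W_adj : is_adjoint W W.
Proof.
apply: op_mx_adj => i j; first by apply: bphi; exact: MM.
rewrite -padj; last exact: MM.
have [b1 b2] := conj (bM (Mp i)) (bM (Mp j)).
by rewrite adj_comp ?adjK//; exact: bop_adj.
Qed.

Let P_Psi t x : T t -> P (Psi t x).
Proof.
move=> Tt; rewrite /P /Q /Psi op_mx_mul; last by move=> i j; apply/bop_lin/bphi/MM.
by congr (op_mx _ x); apply/funext => i; apply/funext => j; exact: rep_left.
Qed.

Let W_Psi t x : T t -> W (Psi t x) = op_mx (fun i j => phi (adj (p i) \o t \o p j)) x.
Proof.
move=> Tt; rewrite /W /Psi op_mx_mul; last by move=> i j; apply/bop_lin/bphi/MM.
by congr (op_mx _ x); apply/funext => i; apply/funext => j; exact: rep_left.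
Qed.

Let Psi_lin a t u x : T t -> T u -> Psi (a *: t + u) x = a *: Psi t x + Psi u x.
Proof.
move=> Tt Tu; apply: hpow_eq => i.
rewrite -[RHS]/(a *: hout i (Psi t x) + hout i (Psi u x)) !op_mx_out.
rewrite scaler_sumr -big_split; apply: eq_bigr => j _ /=.
have -> : adj (r i) \o (a *: t + u) \o p j = a *: (adj (r i) \o t \o p j) + (adj (r i) \o u \o p j).
  by apply/funext => z /=; rewrite !fctE (adj_lin (bM (Mr i))).
by rewrite lphi//; exact: toS.
Qed.

(* Positivity of the Gram matrix of [r i] and the [p j], tested on
   [(- x_i / c, x)]. *)
Let coord_bound i : exists2 c : C, 0 < c &
  forall x, P x -> `|hout i x| ^+ 2 <= c * dotH (W x) x.
Proof.
have [c c0 hc] := bop_bound (bphi (MM (Mr i) (Mr i))).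
exists c => // x Px.
pose g (a : unit + I) := if a is inr j then p j else r i.
have Mg a : M (g a) by case: a => [u|j]; [exact: Mr | exact: Mp].
have SG a b : S (adj (g a) \o g b) by exact: MM.
have pG := cp_kpos bS (@subset_refl _ _) up.1 SG (kpos_gram (fun a => bM (Mg a))).
have := pG; set y := hout i x.
move=> /(_ (fun a => if a is inr j then hout j x else - c^-1 *: y)).
rewrite sum_unit_sum; under [X in _ + X]eq_bigr do rewrite sum_unit_sum.
rewrite sum_unit_sum [X in _ + X]big_split /=.
have l1 := bop_lin (bphi (MM (Mr i) (Mr i))).
have l2 j := bop_lin (bphi (MM (Mp j) (Mr i))).
have e1 : \sum_j phi (adj (r i) \o p j) (hout j x) = y.
  by rewrite /y -{2}Px op_mx_out.
have e2 : \sum_j dotH (phi (adj (r i) \o p j) (hout j x)) (- c^-1 *: y) = - c^-1 * dotH y y.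
  by rewrite -dot_suml e1 dotZr rmorphN fmorphV /= (ge0_conj (ltW c0)).
have e3 : \sum_j dotH (phi (adj (p j) \o r i) (- c^-1 *: y)) (hout j x) = - c^-1 * dotH y y.
  transitivity (\sum_j dotH (- c^-1 *: y) (phi (adj (r i) \o p j) (hout j x))).
    apply: eq_bigr => j _; rewrite -(adjP' _ _ (bphi (MM (Mr i) (Mp j)))) -padj; last exact: MM.
    by rewrite adj_comp ?adjK//; [exact: bM|exact/bop_adj/bM|exact: bM].
  by rewrite -dot_sumr e1 dotZl.
have e5 : \sum_i0 \sum_j dotH (phi (adj (p i0) \o p j) (hout j x)) (hout i0 x) = dotH (W x) x.
  by rewrite /W op_mx_dot.
rewrite e2 e3 e5.
have e4 : dotH (phi (adj (r i) \o r i) (- c^-1 *: y)) (- c^-1 *: y) <= c^-1 * dotH y y.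
  rewrite (linZ l1) dotZl dotZr rmorphN fmorphV /= (ge0_conj (ltW c0)).
  set z := dotH _ _.
  have zr : z \is Num.real.
    by rewrite ger0_real//; exact: (kpos_diag (inl tt) y (fun a b => bop_lin (bphi (SG a b))) pG).
  have zb : z <= c * dotH y y.
    apply: le_trans (real_ler_norm zr) _; apply: le_trans (Cauchy_Schwarz _ _) _.
    by rewrite dotH_norm expr2 mulrA ler_wpM2r.
  have -> : - c^-1 * (- c^-1 * z) = c^-1 * (c^-1 * z) by ring.
  by rewrite ler_pM2l ?invr_gt0// ler_pdivrMl.
move=> h; rewrite -dotH_norm -/y -ler_pdivrMl//.
move: h; set z := dotH (phi _ _) _ in e4 *; set d := dotH y y in e4 *; set B := dotH _ x.
move=> h; have := addr_ge0 h (_ : 0 <= c^-1 * d - z); rewrite subr_ge0 => /(_ e4).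
by rewrite -[_ <= B]subr_ge0; congr (0 <= _); ring.
Qed.

Let W_pos x : 0 <= dotH (W x) x.
Proof.
have := cp_kpos bS (@subset_refl _ _) up.1 (fun i j => MM (Mp i) (Mp j)) (kpos_gram (fun i => bM
  (Mp i))).
by move=> /(_ x); rewrite /W op_mx_dot.
Qed.

Let lower : exists2 c : C, 0 < c & forall x, P x -> `|x| ^+ 2 <= c ^+ 2 * dotH (W x) x.
Proof.
have /choice[ci hci] : forall i, exists c : C, 0 < c /\
    forall x, P x -> `|hout i x| ^+ 2 <= c * dotH (W x) x.
  by move=> i; have [c c0 hc] := coord_bound i; exists c.
have c0 : 0 <= \sum_i ci i by apply: sumr_ge0 => i _; exact/ltW/(hci i).1.
(* The added 1 makes the constant at least 1, so that its square still dominates the sum of the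
   [ci]. *)
exists (\sum_i ci i + 1) => [|x Px]; first by rewrite ltr_wpDl.
apply: (@le_trans _ _ ((\sum_i ci i) * dotH (W x) x)).
  rewrite -dotH_norm hpow_dot mulr_suml; apply: ler_sum => i _.
  by rewrite dotH_norm; exact: (hci i).2.
rewrite ler_wpM2r ?W_pos// (le_trans (_ : _ <= \sum_i ci i + 1)) ?lerDl//.
by rewrite expr2 ler_peMl ?lerDr// addr_ge0.
Qed.

Let upper : exists2 d : C, 0 < d & forall x, dotH (W x) x <= d ^+ 2 * `|x| ^+ 2.
Proof.
have [w w0 hw] := bop_bound bW; exists (w + 1) => [|x]; first by rewrite ltr_wpDl ?ltW.
rewrite -[X in X <= _](ger0_norm (W_pos x)); apply: le_trans (Cauchy_Schwarz _ _) _.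
apply: (@le_trans _ _ (w * `|x| ^+ 2)).
  by rewrite expr2 mulrA ler_wpM2r.
rewrite ler_wpM2r ?exprn_ge0// (le_trans (_ : _ <= w + 1)) ?lerDl//.
have w0' := ltW w0.
by rewrite expr2 ler_peMl ?lerDr// addr_ge0.
Qed.

Let P_closed x : (forall e : C, 0 < e -> exists2 y, P y & `|x - y| <= e) -> P x.
Proof.
move=> h; apply/eqP; rewrite -subr_eq0 -normr_eq0 eq_le normr_ge0 andbT.
apply: ler_approx => e e0; rewrite add0r.
have [q q0 hq] := bop_bound bQ; have q1 : 0 < q + 1 by rewrite ltr_wpDl ?ltW.
have [y Py xy] := h _ (divr_gt0 e0 q1).
have -> : Q x - x = Q (x - y) - (x - y).
  by rewrite (linB (bop_lin bQ)) Py opprB addrA subrK.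
apply: le_trans (ler_normB _ _) _; apply: le_trans (lerD (hq _) (lexx _)) _.
rewrite -[X in _ + X]mul1r -mulrDl; apply: le_trans (ler_wpM2l (ltW q1) xy) _.
by rewrite mulrC divfK ?gt_eqF.
Qed.

(** For the inner product of [W], positivity of [psi] on a matrix over [T] is positivity of [phi] on
    its compressions by the [p_i]; products come from [rep_mul], and the kernel is read off on
    vectors coming from [M]. *)
Lemma induced_rep : exists (K1 : hilbertType R) (psi : (K -> K) -> (K1 -> K1)),
  Cstar_representation T ET kT psi /\
  forall t, T t -> psi t = 0 <-> forall m n, M m -> M n -> phi (adj m \o t \o n) = 0.
Proof.
have lQ := bop_lin bQ; have lW := bop_lin bW.
have [c c0 hc] := lower; have [d d0 hd] := upper.
have PL a x y : P x -> P y -> P (a *: x + y) by move=> Px Py; rewrite /P lQ Px Py.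
have BL a x y z : dotH (W (a *: x + y)) z = a * dotH (W x) z + dotH (W y) z.
  by rewrite lW dotDl dotZl.
have BC x y : dotH (W x) y = (dotH (W y) x)^* by rewrite W_adj dotC.
have [K1 [i0 [li Pi surj dot1 inj]]] := weighted_space (lin0 lQ) PL P_closed BL BC c0 d0 hc hd.
have /choice[psi hpsi] : forall t, exists f : K1 -> K1, T t -> forall x, i0 (f x) = Psi t (i0 x).
  move=> t; have [Tt|] := pselect (T t); last by exists id.
  have /choice[f hf] : forall x, exists y, i0 y = Psi t (i0 x).
    by move=> x; apply: surj; exact: P_Psi.
  by exists f.
exists K1, psi.
have lpsi : linear_on T psi.
  move=> a f g Tf Tg; apply/funext => x; apply: inj.
  rewrite hpsi; last exact: (lsZD lT).
  by rewrite Psi_lin// -!hpsi// -li.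
have bpsi t : T t -> bounded_op (psi t).
  move=> Tt; apply/bounded_opP; split.
    by move=> a x y; apply: inj; rewrite li !hpsi// li (bop_lin (bPsi Tt)).
  have [w w0 hw] := bop_bound (bPsi Tt).
  exists (d * w * c) => [|x]; first by rewrite !mulr_ge0 ?ltW.
  have n1 (y : K1) : `|y| <= d * `|i0 y|.
    rewrite -ler_sqr ?nnegrE ?mulr_ge0 ?(ltW d0)// exprMn -dotH_norm dot1; exact: hd.
  have n2 (y : K1) : `|i0 y| <= c * `|y|.
    rewrite -ler_sqr ?nnegrE ?mulr_ge0 ?(ltW c0)// exprMn -[`|y| ^+ 2]dotH_norm dot1.
    exact: hc.
  apply: le_trans (n1 _) _; rewrite hpsi// -!mulrA ler_pM2l//.
  by apply: le_trans (hw _) _; rewrite ler_pM2l.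
have psi1 : psi idfun = idfun.
  apply/funext => x; apply: inj; rewrite hpsi; last exact: os_id.
  exact: Pi.
have dotpsi t x y : T t -> dotH (psi t x) y =
    \sum_i \sum_j dotH (phi (adj (p i) \o t \o p j) (hout j (i0 x))) (hout i (i0 y)).
  by move=> Tt; rewrite dot1 hpsi// W_Psi// op_mx_dot.
have cppsi : cp_map T bounded_op psi.
  split=> // n A TA pA x.
  pose D (a b : I * 'I_n) := adj (p a.1) \o A a.2 b.2 \o p b.1.
  have SD a b : S (D a b) by exact: toS.
  have pD : kpos D := kpos_congr (fun a : I * 'I_n => a.2) (fun a => bM (Mp a.1))
    (fun i j => bop_lin (bT (TA i j))) pA.
  have := cp_kpos bS (@subset_refl _ _) up.1 SD pD.
  move=> /(_ (fun a => hout a.1 (i0 (x a.2)))).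
  congr (0 <= _); rewrite -(pair_bigA _ (fun i a => \sum_(b : I * 'I_n) dotH (phi (D (i, a) b)
    (hout b.1 (i0 (x b.2)))) (hout i (i0 (x a)))))/=.
  rewrite exchange_big; apply: eq_bigr => a _ /=.
  transitivity (\sum_i \sum_j \sum_b dotH (phi (D (i, a) (j, b)) (hout j (i0 (x b)))) (hout i
    (i0 (x a)))).
    by apply: eq_bigr => i _; rewrite pair_bigA.
  under [RHS]eq_bigr do rewrite mxE dotpsi//.
  rewrite [RHS]exchange_big /=; apply: eq_bigr => i _.
  by rewrite exchange_big.
split.
  split; first by split.
  - move=> a b t Aa Ab At kt; have [Ta _] := Aa; have [Tb _] := Ab; have [Tt _] := At.
    apply/funext => x; apply: inj; rewrite /= !hpsi//.
    rewrite /Psi op_mx_mul; last by move=> i j; apply/bop_lin/bphi/toS.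
    congr (op_mx _ (i0 x)); apply/funext => i; apply/funext => j.
    exact/esym/rep_mul.
  (* [kT] preserves adjoints and is injective, so [t] is the adjoint of [a] in [B(K)], which a
     completely positive map respects. *)
  - move=> a t [Ta _] [Tt _] kt; rewrite -(cp_adj oT cppsi Ta); congr psi.
    apply: (env_inj hET) => //; first exact: os_adj.
    by rewrite kt (env_adj oT hET).
move=> t Tt; split=> [pt0 m q Mm Mq|h].
  have Psi0 x : P x -> Psi t x = 0.
    by move=> /surj[y <-]; rewrite -hpsi// pt0 [LHS](lin0 li).
  apply/funext => xi.
  (* This vector represents the tensor [q (x) xi]; the coordinates of [Psi t x] are the vectors
     [phi (r_i^* t q) xi], by [rep_right]. *)
  pose x : hpow I K0 := fun j => phi (adj (r j) \o q) xi.
  have Px : P x.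
    apply: hpow_eq => i; rewrite op_mx_out.
    have := rep_left (Mr i) (os_id oT) Mq => /(congr1 (fun f => f xi)).
    by rewrite op_sumE.
  have rowz i : phi (adj (r i) \o t \o q) xi = 0.
    have := congr1 (hout i) (Psi0 x Px); rewrite op_mx_out => /= e.
    rewrite -(rep_right (Mr i) Tt Mq) op_sumE.
    exact: e.
  rewrite -(rep_left Mm Tt Mq) op_sumE; apply: big1 => k _.
  by rewrite /= rowz (lin0 (bop_lin (bphi (MM Mm (Mp k))))).
apply/funext => x; apply: inj; rewrite hpsi// [RHS](lin0 li).
apply: hpow_eq => i; rewrite op_mx_out; apply: big1 => j _.
by rewrite h.
Qed.

End Rep.
End Induced.

(** * Transfer of kernels along the TRO *)

Section Push.
Context {R : realType}.
Local Notation C := (complex R).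

Definition push {H K : hilbertType R} (T : set (K -> K)) (M : set (H -> K)) (J : set (H -> H)) :
  set (K -> K) := [set t | T t /\ forall m n, M m -> M n -> J (adj m \o t \o n)].

Section PushSection.
Context {H K LS LT : hilbertType R} {S : set (H -> H)} {T : set (K -> K)} {M : set (H -> K)}.
Context {ES : set (LS -> LS)} {kS : (H -> H) -> (LS -> LS)}.
Context {ET : set (LT -> LT)} {kT : (K -> K) -> (LT -> LT)}.
Hypotheses (hM : tro_data S T M).
Hypotheses (hES : injective_envelope S ES kS) (hET : injective_envelope T ET kT).

Lemma push_Ker J : Ker S ES kS J -> Ker T ET kT (push T M J).
Proof.
move=> [K0 [phi [hphi ->]]].
have [oS oT bM [toS toT] [_ [I [f [g [Mf Mg fg]]]]]] := hM.
have Madj f' : [set adj m | m in M] f' -> M (adj f').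
  by move=> [m Mm <-]; rewrite adjK//; exact: bM.
have pr : \sum_i (adj (f i) \o adj (adj (g i))) = idfun.
  rewrite -fg; apply: eq_bigr => i _; rewrite adjK//.
  by have [m Mm <-] := Mg i; apply: bop_adj; exact: bM.
have [K1 [psi [hpsi kpsi]]] := induced_rep hM hES hET hphi (fun i => Madj _ (Mf i)) (fun i =>
  Madj _ (Mg i)) pr.
exists K1, psi; split=> //; apply/seteqP; split=> t [Tt h]; split=> //.
  by apply/kpsi => // m n Mm Mn; exact: (h m n Mm Mn).2.
move=> m n Mm Mn; split; first exact: toS.
by move/kpsi: h => -> //.
Qed.

(** One inclusion of [G (F J) = J] holds because a frame recovers [s] from its images [m s n^*] in
    [T], the other because the kernel of [phi] is a bimodule over [M^* M]. *)
Lemma push_lat_map : lat_map (Ker S ES kS) (Ker T ET kT) (push T M) (push S [set adj m | m in M]).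
Proof.
have [oS oT bM [toS toT] [fr _]] := hM.
split; first exact: push_Ker.
  move=> J [K0 [phi [hphi ->]]]; apply/seteqP; split=> s.
    move=> [Ss h]; split=> //.
    have [I [f [g [Mf Mg fg]]]] := fr.
    have [[lp _ _] _] : ucp_map S bounded_op phi by case: hphi.
    have bs := os_bop oS Ss.
    (* The frame is inserted on both sides of [s]; the double adjoint puts [g i] in the shape of the
       second TRO, whose elements are adjoints. *)
    have se : s = \sum_i \sum_j (adj (f i) \o (adj (adj (g i)) \o s \o adj (f j)) \o g j).
      transitivity (\sum_i (adj (f i) \o g i \o s)).
        by rewrite -[LHS]/(idfun \o s) -fg comp_suml.
      apply: eq_bigr => i _; have [bf bg] := conj (bM _ (Mf i)) (bM _ (Mg i)).
      rewrite -[LHS]/((adj (f i) \o g i \o s) \o idfun) -fg comp_sumr.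
        by apply: eq_bigr => j _; rewrite adjK.
      by apply: bop_lin; auto using bop_comp, bop_adj.
    have hz i j := (h (adj (g i)) (adj (f j)) (ex_intro2 _ _ _ (Mg i) erefl) (ex_intro2 _ _ _
      (Mf j) erefl)).2 (f i) (g j) (Mf i) (Mg j).
    rewrite /= se (lo_sum (os_sub oS) lp) => [|i _]; last first.
      by apply: (ls_sum (os_sub oS)) => j _; exact: (hz i j).1.
    apply: big1 => i _; rewrite (lo_sum (os_sub oS) lp) => [|j _]; last exact: (hz i j).1.
    by apply: big1 => j _; exact: (hz i j).2.
  move=> [Ss s0]; split=> // _ _ [m Mm <-] [n Mn <-].
  have bb := bM _ Mm; rewrite adjK//; split; first exact: toT.
  move=> p q Mp Mq; split; first by apply: toS => //; exact: toT.
  (* Reassociated, the product is [s] between two elements of [M^* M], which [phi] takes out on the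
     right and on the left. *)
  have -> : adj p \o (m \o s \o adj n) \o q = (adj p \o m \o s) \o (adj n \o q) by [].
  rewrite (rep_MM' hM hES hET hphi)//; last exact: (tro_left hM).
  rewrite (rep_MM hM hES hET hphi)//=; rewrite s0; apply/funext => x /=.
  apply: lin0; have [[[_ mphi _] _] _ _] := hphi.
  by apply/bop_lin/mphi; exact: (toS p idfun m Mp (os_id oT) Mm).
move=> J1 J2 A1 A2; apply/seteqP; split=> t.
  by move=> [Tt h]; split; split=> // m n Mm Mn; have [] := h m n Mm Mn.
by move=> [[Tt h1] [_ h2]]; split=> // m n Mm Mn; split; [exact: h1 | exact: h2].
Qed.

End PushSection.

Lemma push_lat_iso (H K LS LT : hilbertType R) (S : set (H -> H)) (T : set (K ->
  K)) (M : set (H -> K))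
    (ES : set (LS -> LS)) kS (ET : set (LT -> LT)) kT : tro_data S T M ->
  injective_envelope S ES kS -> injective_envelope T ET kT ->
  lat_iso (Ker S ES kS) (Ker T ET kT).
Proof.
move=> hM hES hET; have [_ _ bM _ _] := hM.
exists (push T M), (push S [set adj m | m in M]); split; first exact: push_lat_map.
have := push_lat_map (tro_data_sym hM) hET hES.
rewrite (_ : [set adj m | m in [set adj m | m in M]] = M)//.
apply/seteqP; split=> [_ [_ [m Mm <-] <-]|m Mm]; first by rewrite adjK//; exact: bM.
by exists (adj m); [exists m | rewrite adjK//; exact: bM].
Qed.

End Push.

(** * Frames in a non-degenerate TRO *)

Section Neumann.
Context {R : realType}.
Local Notation C := (complex R).
Implicit Types H K : hilbertType R.

(* [u = a (1 - D)^-1]. *)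
Lemma neumann H K (M : set (H -> K)) (D : H -> H) a :
  lin_subspace M -> M `<=` bounded_op -> bounded_op D ->
  (forall x, `|D x| <= 2^-1 * `|x|) -> (forall u, M u -> M (u \o D)) -> M a ->
  exists2 u, op_closure M u & u = a + (u \o D).
Proof.
move=> lM bM bD hD MD Ma.
pose v (j : nat) := iter j (fun u => u \o D) a.
have Mv j : M (v j) by elim: j => //= j; exact: MD.
pose u k := \sum_(j < k) v j.
have Mu k : M (u k) by apply: ls_sum.
have [A A0 hA] := bop_bound (bM _ Ma).
have hv j x : `|v j x| <= A * 2^-1 ^+ j * `|x|.
  elim: j x => [|j IH] x; first by rewrite expr0 mulr1.
  apply: le_trans (IH _) _.
  have -> : A * 2^-1 ^+ j.+1 * `|x| = A * 2^-1 ^+ j * (2^-1 * `|x|) by rewrite exprSr; ring.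
  by rewrite ler_wpM2l ?mulr_ge0 ?(ltW A0) ?exprn_ge0 ?invr_ge0.
have uS k : u k.+1 = u k + v k by rewrite /u big_ord_recr.
(* The right side is the exact partial sum, from [n] to [n + k - 1], of the geometric bounds on
   [v]. *)
have tail n k x : `|u (n + k)%N x - u n x| <= A * (2 * 2^-1 ^+ n - 2 * 2^-1 ^+ (n + k)) * `|x|.
  elim: k => [|k IH]; first by rewrite addn0 !subrr normr0 mulr0 mul0r.
  rewrite addnS uS; have -> : (u (n + k)%N + v (n + k)%N) x - u n x = (u (n + k)%N x - u n x) +
    v (n + k)%N x.
    by rewrite addrAC.
  apply: le_trans (ler_normD _ _) _; apply: le_trans (lerD IH (hv _ _)) _.
  by rewrite -mulrDl exprS le_eqVlt; apply/orP; left; apply/eqP; field.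
have small (e : C) : 0 < e -> exists N, forall n, (N <= n)%N ->
  forall k x, `|u (n + k)%N x - u n x| <= e * `|x|.
  move=> e0; have [N hN] := inv_nat_small (divr_gt0 e0 (mulr_gt0 A0 (ltr0Sn C 1))).
  exists N => n hn k x; apply: le_trans (tail _ _ _) _; rewrite ler_wpM2r//.
  apply: (@le_trans _ _ (A * 2 * n.+1%:R^-1)).
    rewrite -mulrA ler_pM2l// (le_trans (_ : _ <= 2 * 2^-1 ^+ n))//.
      by rewrite gerBl mulr_ge0// exprn_ge0// invr_ge0.
    rewrite ler_pM2l// exprVn lef_pV2 ?posrE ?exprn_gt0 ?ltr0n//.
    by rewrite -natrX ler_nat ltn_expl.
  by rewrite mulrC -ler_pdivlMr ?mulr_gt0//; exact: hN.
have [m||l bl hl] := @op_complete _ _ _ u; first exact/bM/Mu.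
  move=> e e0; have [N hN] := small _ (divr_gt0 e0 (ltr0Sn C 1)).
  exists N => m n hm hn x; rewrite (splitr e) mulrDl; apply: (ler_norm_trans (y := u N x)).
    by rewrite -(subnKC hm); exact: hN.
  by rewrite distrC -(subnKC hn); exact: hN.
exists l.
  split=> // e e0; have [N hN] := hl e e0; exists (u N) => // x.
  by rewrite distrC; exact: hN.
apply: op_eq_approx => e e0 x.
have e2 : 0 < e / 2 by rewrite divr_gt0.
have [N hN] := hl _ e2.
(* The partial sums satisfy the fixed-point equation up to a shift, [u N.+1 = a + u N \o D]; hence
   the index [N.+1]. *)
rewrite (splitr e) mulrDl; apply: (ler_norm_trans (y := u N.+1 x)).
  by rewrite distrC; exact: hN.
have -> : u N.+1 = a + (u N \o D).
  rewrite /u big_ord_recl comp_suml; congr (_ + _).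
have -> : (a + (u N \o D)) x - (a + (l \o D)) x = u N (D x) - l (D x).
  by rewrite !fctE /= opprD addrACA subrr add0r.
apply: le_trans (hN _ (leqnn _) _) _; rewrite ler_pM2l//.
by apply: le_trans (hD _) _; rewrite ler_piMl// invf_le1 ?ler1n.
Qed.

End Neumann.

Section TroClosure.
Context {R : realType}.
Local Notation C := (complex R).
Implicit Types H K : hilbertType R.

(** Some [g = \sum_i a_i^* b_i] lies within 1/2 of 1, hence is invertible. Replacing [a_i] by
    [u_i = a_i (1 - D)^-1], where [1 - D = g^*], turns the sum into [g^-1 g = 1]; the inclusion of
    [M M^* M] in [M] gives stability under [D] and keeps [u_i] in the closure of [M]. *)
Lemma tro_frames_closure H K (M : set (H -> K)) : TRO M ->
  op_closure (op_span [set adj m1 \o m2 | m1 in M & m2 in M]) idfun ->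
  tro_frames (op_closure M).
Proof.
move=> [bM lM MMM] [_ /(_ 2^-1)]; rewrite invr_gt0 ltr0n => /(_ isT).
move=> [_ [n [c [w [hw ->]]]] near1].
have /choice[ab hab] : forall i, exists p : (H -> K) * (H ->
  K), [/\ M p.1, M p.2 & c i *: w i = adj p.1 \o p.2].
  move=> i; have [a Ma [b Mb <-]] := hw i; exists (a, c i *: b); split=> //=; first exact: (lsZ lM).
  by apply/funext => x; rewrite !fctE /= (linZ (adj_lin (bM _ Ma))).
pose a i := (ab i).1; pose b i := (ab i).2.
have Ma i : M (a i) by have [] := hab i.
have Mb i : M (b i) by have [] := hab i.
pose g := \sum_i (adj (a i) \o b i).
have ge : \sum_(i < n) c i *: w i = g by apply: eq_bigr => i _; have [] := hab i.
have ba i := bM _ (Ma i); have bb i := bM _ (Mb i).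
have bab i : bounded_op (adj (a i) \o b i) by auto using bop_comp, bop_adj.
have bg : bounded_op g by apply: (ls_sum (bop_sub _ _)).
pose D := adj (idfun - g).
have b1g : bounded_op (idfun - g) by apply: (lsB (bop_sub _ _)) => //; exact: bop_id.
have bD : bounded_op D := bop_adj b1g.
have DE : D = idfun - \sum_i (adj (b i) \o a i).
  rewrite /D adjB ?adj_id//; last exact: bop_id.
  rewrite adj_sum//; congr (_ - _); apply: eq_bigr => i _.
  by rewrite adj_comp ?adjK//; exact: bop_adj.
have hD x : `|D x| <= 2^-1 * `|x|.
  by apply: adj_bound => //; [rewrite invr_ge0 ler0n | move=> y; rewrite -ge; exact: near1].
have MD u : M u -> M (u \o D).
  move=> Mu; have lu := bop_lin (bM _ Mu).
  have -> : u \o D = u - \sum_i (u \o adj (b i) \o a i).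
    by rewrite DE; apply/funext => x /=; rewrite !fctE (linB lu) !op_sumE (lin_sum lu).
  by apply: (lsB lM) => //; apply: (ls_sum lM) => i _; exact: MMM.
have /choice[u hu] : forall i, exists u, op_closure M u /\ u = a i + (u \o D).
  by move=> i; have [u ? ?] := neumann lM bM (bop_adj b1g) hD MD (Ma i); exists u.
exists 'I_n, u, b; split=> [i|i|]; [exact: (hu i).1 | exact: sub_closure (Mb i) |].
have bu i : bounded_op (u i) := (hu i).1.1.
pose X := \sum_i (adj (u i) \o b i).
(* The fixed-point equations of the [u i], taken adjoint and summed against [b i]; they say that
   [g X = g]. *)
have gX x : X x = g x + (X x - g (X x)).
  have lG := bop_lin b1g.
  have e1 : X x = \sum_i adj (u i) (b i x) by rewrite /X op_sumE.
  have e2 : g x = \sum_i adj (a i) (b i x) by rewrite /g op_sumE.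
  rewrite -[X x - _]/((idfun - g) (X x)) e2 e1 (lin_sum lG) -big_split.
  apply: eq_bigr => i _ /=.
  rewrite {1}(hu i).2 adjD//; last exact: bop_comp.
  by rewrite adj_comp// /D adjK.
rewrite -/X; apply/funext => x; apply/eqP; rewrite -subr_eq0 -normr_eq0.
have lg := bop_lin bg.
have e0 : g (X x - x) = 0.
  rewrite (linB lg); apply/eqP; rewrite subr_eq0; apply/eqP.
  by apply: (addIr (X x - g (X x))); rewrite -(gX x) [LHS]addrC subrK.
(* A vector killed by [g] has norm at most half its own norm, since [1 - g] is bounded by 1/2; so
   [X x - x] vanishes. *)
have := near1 (X x - x); rewrite ge e0 subr0 /=.
rewrite -subr_le0 -[X in X - _]mul1r -mulrBl pmulr_rle0.
  by rewrite normr_le0 normr_eq0.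
by rewrite subr_gt0 invf_lt1 ?ltr1n.
Qed.

(** One factor at a time is passed to the closure; the left factor is reached from the right one by
    taking adjoints. *)
Lemma closure_sandwich H K (S : set (H -> H)) (T : set (K -> K)) (M : set (H -> K)) :
  operator_system S -> operator_system T -> M `<=` bounded_op ->
  (forall m t n, M m -> T t -> M n -> op_closure S (adj m \o t \o n)) ->
  forall m t n, op_closure M m -> op_closure T t -> op_closure M n ->
    op_closure S (adj m \o t \o n).
Proof.
move=> oS oT bM h; have [bS bT] := conj (os_bop oS) (os_bop oT).
have h1 m t n : M m -> op_closure T t -> M n -> op_closure S (adj m \o t \o n).
  move=> Mm Tt Mn; apply: (closure_comp bT) Tt => //; [exact/bop_adj/bM|exact: bM|].
  by move=> s Ts; exact: h.
have h2 m t n : M m -> op_closure T t -> op_closure M n -> op_closure S (adj m \o t \o n).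
  move=> Mm Tt; have [bm bt] := conj (bM _ Mm) (closure_bop Tt).
  apply: (closure_comp (g := idfun) (f := adj m \o t) bM); [|exact: bop_id|].
    by auto using bop_comp, bop_adj.
  by move=> s Ms; exact: h1.
have h3 m t n : op_closure M m -> op_closure T t -> M n -> op_closure S (adj m \o t \o n).
  move=> Mm Tt Mn; have [[bm bt] bn] := conj (conj (closure_bop Mm) (closure_bop Tt)) (bM _ Mn).
  have oT' := op_system_closure oT; have oS' := op_system_closure oS.
  have := os_adj oS' (h2 _ _ _ Mn (os_adj oT' Tt) Mm).
  rewrite (_ : adj _ = adj m \o t \o n)//; apply: adj_unique => x y /=.
  by rewrite (adjP' _ _ bn) (adjP' _ _ bt) (adjP _ _ bm).
move=> m t n Mm Tt; have [bm bt] := conj (closure_bop Mm) (closure_bop Tt).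
apply: (closure_comp (g := idfun) (f := adj m \o t) bM); [|exact: bop_id|].
  by auto using bop_comp, bop_adj.
by move=> s Ms; exact: h3.
Qed.

Lemma closure_adj H K (M : set (H -> K)) : M `<=` bounded_op ->
  op_closure [set adj m | m in M] = [set adj m | m in op_closure M].
Proof.
have sub (L L' : hilbertType R) (N : set (L -> L')) : N `<=` bounded_op ->
    forall m, op_closure N m -> op_closure [set adj m | m in N] (adj m).
  move=> bN m [bm hm]; split=> [|e e0]; first exact: bop_adj.
  have [g Ng mg] := hm e e0; exists (adj g); first by exists g.
  move=> x; have bg := bN _ Ng.
  rewrite -[_ - _]/((adj m - adj g) x) -adjB//; apply: adj_bound (ltW e0) mg x.
  exact: (lsB (bop_sub _ _)).
move=> bM; apply/seteqP; split=> [m hm|_ [m hm <-]]; last exact: sub.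
have bMa : [set adj m | m in M] `<=` bounded_op.
  by move=> _ [n Mn <-]; apply: bop_adj; exact: bM.
exists (adj m); last by rewrite adjK//; exact: closure_bop hm.
have := sub _ _ _ bMa _ hm; apply: op_closureS => _ [_ [n Mn <-] <-].
by rewrite adjK//; exact: bM.
Qed.

Lemma TRO_adj H K (M : set (H -> K)) : TRO M -> TRO [set adj m | m in M].
Proof.
move=> [bM lM MMM]; split.
- by move=> _ [m Mm <-]; apply: bop_adj; exact: bM.
- split; first by exists 0; [exact: ls0 lM | exact: adj0].
  move=> a _ _ [m Mm <-] [n Mn <-]; exists (a^* *: m + n); first exact: (lsZD lM).
  by rewrite adj_ZD ?conjCK//; exact: bM.
- move=> _ _ _ [m Mm <-] [n Mn <-] [q Mq <-]; exists (q \o adj n \o m); first exact: MMM.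
  have [bm bn bq] := And3 (bM _ Mm) (bM _ Mn) (bM _ Mq).
  apply: adj_unique => x y /=.
  by rewrite (adjP _ _ bq) (adjP' _ _ bn) (adjP _ _ bm) (adjK bn).
Qed.

Lemma TRO_equivalent_data H K (S : set (H -> H)) (T : set (K -> K)) :
  operator_system S -> operator_system T -> TRO_equivalent S T ->
  exists M, tro_data (op_closure S) (op_closure T) M.
Proof.
move=> oS oT [M [[tM n1 n2] hS hT]]; have [bM lM MMM] := tM.
have tMa := TRO_adj tM; have [bMa _ _] := tMa.
exists (op_closure M); split; try exact: op_system_closure.
- exact: closure_bop.
- split; first exact: closure_sandwich.
  move=> m s n Mm Ss Mn.
  have := closure_sandwich oT oS bMa _ (m := adj m) (t := s) (n := adj n).
  rewrite adjK; last exact: closure_bop Mm.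
  apply=> //; try by rewrite closure_adj//; eexists; [|reflexivity].
  by move=> _ t _ [p Mp <-] St [q Mq <-]; rewrite adjK; [exact: hT | exact: bM].
- split; first exact: tro_frames_closure.
  rewrite -closure_adj//; apply: tro_frames_closure => //.
  rewrite (_ : [set adj m1 \o m2 | m1 in [set adj m | m in M] & m2 in [set adj m | m in M]] =
    [set m1 \o adj m2 | m1 in M & m2 in M])//.
  apply/seteqP; split=> [_ [_ [m Mm <-] [_ [n Mn <-] <-]]|_ [m Mm [n Mn <-]]].
    by exists m => //; exists n => //; rewrite adjK//; exact: bM.
  by exists (adj m); [exists m | exists (adj n); [exists n | rewrite adjK//; exact: bM]].
Qed.

End TroClosure.

(** * Reduction of Delta-equivalence to norm-closed TRO-equivalent images *)

Theorem theorem5p1 (R : realType) (H K LS LT : hilbertType R)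
  (S : set (H -> H)) (T : set (K -> K))
  (ES : set (LS -> LS)) (kS : (H -> H) -> (LS -> LS))
  (ET : set (LT -> LT)) (kT : (K -> K) -> (LT -> LT))
  (hS : operator_system S) (hT : operator_system T)
  (hES : injective_envelope (op_closure S) ES kS)
  (hET : injective_envelope (op_closure T) ET kT)
  (hST : Delta_equivalent S T) :
  lattice_isomorphic (Ker (op_closure S) ES kS) (Ker (op_closure T) ET kT).
Proof.
have [oS oT] := conj (op_system_closure hS) (op_system_closure hT).
have [H' [K' [phi [psi [ephi epsi hTRO]]]]] := hST.
have [oS' [phi' iS]] := coe_coiso hS ephi; have [oT' [psi' iT]] := coe_coiso hT epsi.
have [f [f' isoS]] := coiso_closure hS oS' iS.
have [g [g' isoT]] := coiso_closure hT oT' iT.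
have [M hM] := TRO_equivalent_data oS' oT' hTRO.
have bop (L : hilbertType R) (U : set (L ->
  L)) : op_closure U `<=` bounded_op := @closure_bop _ _ _ U.
(* The closed images inherit the given algebras [ES] and [ET] as envelopes, embedded through the
   inverse isomorphisms. *)
have hES' := envelope_transport isoS (bop _ _) (bop _ _) hES.
have hET' := envelope_transport isoT (bop _ _) (bop _ _) hET.
apply: lat_iso_lattice.
- by move=> J; apply: Ker_additive; exact: os_sub.
- by move=> J; apply: Ker_additive; exact: os_sub.
apply: (lat_iso_trans (Ker_iso (kT := kS \o f') ES isoS _)).
  by move=> s Ss; have [_ _ e _] := isoS; rewrite /= e.
apply: lat_iso_trans (push_lat_iso hM hES' hET') (lat_iso_sym _).
apply: (Ker_iso ET isoT).
by move=> s Ss; have [_ _ e _] := isoT; rewrite /= e.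
Qed.
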